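(* Let $p\ge2$ be an integer, $q=e^{i\pi/p}$ (with $i$ here the imaginary unit), and let $1\le i\le p-1$ be an integer. Let $\theta_{j,l},\theta_{j,u}:X^{\otimes(2p-i-1)}\to X^{\otimes(2p+i-1)}$ and $\Gamma_{j,l},\Gamma_{j,u}:X^{\otimes(2p+i-1)}\to X^{\otimes(2p-i-1)}$ ($j=1,2$) be the homomorphisms described in the context, induced by the homomorphisms $\mathcal{P}^+_i\to\mathcal{P}^-_{p-i}$ and $\mathcal{P}^-_{p-i}\to\mathcal{P}^+_i$ respectively. Then, up to nonzero constants, they are given diagrammatically by $$\theta_{1,l}=(\beta\otimes1^{\otimes i})(1^{\otimes(2p-i-1)}\otimes\cap^{(i)}),\qquad \theta_{2,l}=(\beta\alpha\otimes1^{\otimes i})(1^{\otimes(2p-i-1)}\otimes\cap^{(i)}),$$ $$\theta_{1,u}=(\alpha\beta\otimes1^{\otimes i})(1^{\otimes(2p-i-1)}\otimes\cap^{(i)}),\qquad \theta_{2,u}=(\alpha\otimes1^{\otimes i})(1^{\otimes(2p-i-1)}\otimes\cap^{(i)}),$$ $$\Gamma_{1,l}=(1^{\otimes(2p-i-1)}\otimes\cup^{(i)})(\beta\alpha\otimes1^{\otimes i}),\qquad \Gamma_{2,l}=(1^{\otimes(2p-i-1)}\otimes\cup^{(i)})(\alpha\otimes1^{\otimes i}),$$ $$\Gamma_{1,u}=(1^{\otimes(2p-i-1)}\otimes\cup^{(i)})(\beta\otimes1^{\otimes i}),\qquad \Gamma_{2,u}=(1^{\otimes(2p-i-1)}\otimes\cup^{(i)})(\alpha\beta\otimes1^{\otimes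 i}).$$
   Context: $\bar U_q(\mathfrak{sl}_2)$ is the Hopf algebra over a field $\mathbb{K}$ (containing $q$, e.g. $\mathbb{C}$) generated by $E,F,K$ with $KEK^{-1}=q^2E$, $KFK^{-1}=q^{-2}F$, $EF-FE=\frac{K-K^{-1}}{q-q^{-1}}$, $E^p=F^p=0$, $K^{2p}=1$, $\Delta E=E\otimes K+1\otimes E$, $\Delta F=F\otimes 1+K^{-1}\otimes F$, $\Delta K=K\otimes K$. Put $[n]=\frac{q^n-q^{-n}}{q-q^{-1}}$, $[n]!=[1]\cdots[n]$. $X=\mathcal{X}^+_2$ has basis $\nu_0,\nu_1$ with $K\nu_0=q\nu_0$, $K\nu_1=q^{-1}\nu_1$, $E\nu_0=0$, $E\nu_1=\nu_0$, $F\nu_0=\nu_1$, $F\nu_1=0$. For $1\le i_1<\dots<i_n\le z$, $\rho_{i_1,\dots,i_n,z}\in X^{\otimes z}$ is the basis tensor with $\nu_1$ in positions $i_1,\dots,i_n$ and $\nu_0$ elsewhere; $X_{n,z}$ is the span of the $\rho_{i_1,\dots,i_n,z}$; $x_{0,z}=\nu_0^{\otimes z}$, $x_{z,z}=\nu_1^{\otimes z}$. For $1\le s\le p-1$, $\mathcal{P}^\pm_s$ is the $2p$-dimensional indecomposable projective module with basis $\{a_k,b_k\}_{0\le k\le s-1}\cup\{x_j,y_j\}_{0\le j\le p-s-1}$ and action $Ka_k=\pm q^{s-1-2k}a_k$, $Kb_k=\pm q^{s-1-2k}b_k$, $Kx_j=\mp q^{p-s-1-2j}x_j$, $Ky_j=\mp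 q^{p-s-1-2j}y_j$; $Ea_k=\pm[k][s-k]a_{k-1}$, $Eb_k=\pm[k][s-k]b_{k-1}+a_{k-1}$ ($k\ge1$), $Eb_0=x_{p-s-1}$, $Ex_j=\mp[j][p-s-j]x_{j-1}$, $Ey_j=\mp[j][p-s-j]y_{j-1}$ ($j\ge1$), $Ey_0=a_{s-1}$; $Fa_k=a_{k+1}$, $Fb_k=b_{k+1}$ ($k<s-1$), $Fb_{s-1}=y_0$, $Fx_j=x_{j+1}$ ($j<p-s-1$), $Fx_{p-s-1}=a_0$, $Fy_j=y_{j+1}$, with $x_{-1}=a_{-1}=a_s=y_{p-s}=0$. Basis elements of $\mathcal{P}^-_{p-i}$ are written with a tilde. Homomorphisms $\theta_1,\theta_2:\mathcal{P}^+_i\to\mathcal{P}^-_{p-i}$: $\theta_1(b_m)=\tilde x_m$, $\theta_1(y_n)=\tilde a_n$, $\theta_1(a_m)=\theta_1(x_n)=0$; $\theta_2(b_m)=\tilde y_m$, $\theta_2(x_n)=\tilde a_n$, $\theta_2(a_m)=\theta_2(y_n)=0$. Homomorphisms $\Gamma_1,\Gamma_2:\mathcal{P}^-_{p-i}\to\mathcal{P}^+_i$: $\Gamma_1(\tilde b_n)=x_n$, $\Gamma_1(\tilde y_m)=a_m$, $\Gamma_1(\tilde a_n)=\Gamma_1(\tilde x_m)=0$; $\Gamma_2(\tilde b_n)=y_n$, $\Gamma_2(\tilde x_m)=a_m$, $\Gamma_2(\tilde a_n)=\Gamma_2(\tilde y_m)=0$ ($0\le m\le i-1$, $0\le n\le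 p-i-1$). Diagrams (composition right to left, $1$ the identity strand): $\cup:X\otimes X\to\mathbb{K}$, $\cup(\nu_0\otimes\nu_0)=\cup(\nu_1\otimes\nu_1)=0$, $\cup(\nu_0\otimes\nu_1)=-q$, $\cup(\nu_1\otimes\nu_0)=1$; $\cap:\mathbb{K}\to X\otimes X$, $\cap(1)=q^{-1}\nu_1\otimes\nu_0-\nu_0\otimes\nu_1$. $\cup^{(m)}$, $\cap^{(m)}$ are the nested $m$-fold versions on $2m$ strands, pairing position $k$ with $2m+1-k$. $\alpha,\beta\in \mathrm{End}(X^{\otimes(2p-1)})$ are $$\alpha(\rho_{i_1,\dots,i_k,2p-1})=q^{\,k(2p-1)-\frac12(k^2-k)-\sum_j i_j}\,[k]!\,E^{p-k-1}x_{2p-1,2p-1},$$ $$\beta(\rho_{i_1,\dots,i_k,2p-1})=q^{\,k(2p-1)-\frac12(k^2-k)-\sum_j i_j}\,[2p-1-k]!\,F^{k-p}x_{0,2p-1},$$ where negative powers of $E$ and $F$ are $0$ (so $\alpha:X_{k,2p-1}\to X_{k+p,2p-1}$, $\beta:X_{k,2p-1}\to X_{k-p,2p-1}$). Summands. Let $f_n$ be the generic Jones–Wenzl projections with parameter $t$ (loop value $t+t^{-1}$): $f_1=1$, $f_n=f_{n-1}\otimes1-\frac{[n-1]}{[n]}(f_{n-1}\otimes1)(1^{\otimes(n-2)}\otimes\cap\cup)(f_{n-1}\otimes1)$. The summand $\mathcal{P}^+_i$ of $X^{\otimes(2p-i-1)}$ is the image of the idempotent obtained by evaluating $f_{2p-i-1}+\frac{[i]}{[p]}(f_{p-1}\otimes1^{\otimes(p-i)})(1^{\otimes(i-1)}\otimes\cap^{(p-i)}\cup^{(p-i)})(f_{p-1}\otimes1^{\otimes(p-i)})$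 at $t=q$ (after expansion in the diagram basis); projection and inclusion are with respect to this idempotent, and the module identification preserves the grading: $x_n\in X_{n,2p-i-1}$, $a_m,b_m\in X_{p-i+m,2p-i-1}$, $y_n\in X_{p+n,2p-i-1}$. Similarly two copies of $\mathcal{P}^-_{p-i}$ make up the image of the idempotent on $X^{\otimes(2p+i-1)}$ obtained by evaluating $f_{2p+i-1}+\frac{[2p-i]}{[2p]}(f_{2p-1}\otimes1^{\otimes i})(1^{\otimes(2p-i-1)}\otimes\cap^{(i)}\cup^{(i)})(f_{2p-1}\otimes1^{\otimes i})$ at $t=q$: the lower copy ($l$) lies in the weight spaces $X_{0,2p+i-1},\dots,X_{p+i-1,2p+i-1}$ (with $\tilde x_m$, then $\tilde a_n,\tilde b_n$, then $\tilde y_m$ in increasing weights starting at $0,i,p$ respectively), and the upper copy ($u$) lies in the weight spaces $X_{p,2p+i-1},\dots,X_{2p+i-1,2p+i-1}$ (the same weights shifted by $p$). $\theta_{j,l}$ (resp. $\theta_{j,u}$) is the composite of the projection $X^{\otimes(2p-i-1)}\to\mathcal{P}^+_i$, $\theta_j$, and the inclusion of the lower (resp. upper) copy of $\mathcal{P}^-_{p-i}$. $\Gamma_{j,l}$ (resp. $\Gamma_{j,u}$) is the composite of the projection of $X^{\otimes(2p+i-1)}$ onto the lower (resp. upper) copy of $\mathcal{P}^-_{p-i}$, $\Gamma_j$, and the inclusion $\mathcal{P}^+_i\to X^{\otimes(2p-i-1)}$. *)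

(* Defs.v *)
From HB Require Import structures.
From mathcomp Require Import all_boot all_order all_algebra.
From mathcomp Require Import reals trigo.
From mathcomp Require Import complex.

Set Implicit Arguments.
Unset Strict Implicit.
Unset Printing Implicit Defensive.

Import GRing.Theory.
Local Open Scope ring_scope.

Definition exp_ipi (R : realType) (p : nat) : complex R :=
  Complex (cos (pi / p%:R)) (sin (pi / p%:R)).

Definition qnum (F : fieldType) (t : F) (n : nat) : F :=
  (t ^+ n - t ^- n) / (t - t^-1).

Definition qfact (F : fieldType) (t : F) (n : nat) : F :=
  \prod_(1 <= k < n.+1) qnum t k.

Definition lext (K : fieldType) (I : finType) (V : lmodType K) (f : I -> V)
  (v : {ffun I -> K^o}) : V := \sum_b v b *: f b.

Definition eq_up_to_const (K : fieldType) (U : Type) (V : lmodType K)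
  (f g : U -> V) : Prop := exists2 c : K, c != 0 & forall v, f v = c *: g v.

(* The 2n boundary points of an n-strand diagram: inl k is the k-th endpoint on
   the output side, inr k the k-th endpoint on the input side. *)
Definition tl_pt (n : nat) : finType := ('I_n + 'I_n)%type.

(* Position on the boundary circle: outputs from left to right, then inputs from
   right to left. *)
Definition tl_pos n (x : tl_pt n) : nat :=
  match x with inl k => k | inr k => ((2 * n).-1 - k)%N end.

Definition noncrossing_matching n (D : {ffun tl_pt n -> tl_pt n}) : bool :=
  [forall x, (D x != x) && (D (D x) == x)] &&
  [forall x, forall y, ~~ [&& (tl_pos x < tl_pos y)%N,
     (tl_pos y < tl_pos (D x))%N & (tl_pos (D x) < tl_pos (D y))%N]].

Record tl_diagram (n : nat) := TLDiagram {
  tl_match :> {ffun tl_pt n -> tl_pt n};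
  _ : noncrossing_matching tl_match }.

HB.instance Definition _ n := [isSub for @tl_match n].
HB.instance Definition _ n := [Countable of tl_diagram n by <:].
HB.instance Definition _ n := [Finite of tl_diagram n by <:].

Section Composition.
Variables (n : nat) (D1 D2 : tl_diagram n).

(* The graph of D1 stacked on the output side of D2: inl x is a point of D1,
   inr y a point of D2, and the inputs of D1 are glued to the outputs of D2. *)
Definition tl_glue : rel (tl_pt n + tl_pt n)%type := fun u v =>
  match u, v with
  | inl x, inl y => D1 x == y
  | inr x, inr y => D2 x == y
  | inl (inr j), inr (inl k) => j == k
  | inr (inl j), inl (inr k) => j == k
  | _, _ => false
  end.

Definition tl_outer (x : tl_pt n) : (tl_pt n + tl_pt n)%type :=
  match x with inl k => inl (inl k) | inr k => inr (inr k) end.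

Definition tl_comp_rel : rel (tl_pt n) := fun x y =>
  (x != y) && connect tl_glue (tl_outer x) (tl_outer y).

Definition tl_loops : nat :=
  n_comp tl_glue [pred v | [forall x, ~~ connect tl_glue (tl_outer x) v]].

End Composition.

Definition tl_alg (F : fieldType) (n : nat) : lmodType F :=
  {ffun tl_diagram n -> F^o}.

(* The basis element of the diagram whose pairs of matched points are related
   by r. *)
Definition tl_basis (F : fieldType) n (r : rel (tl_pt n)) : tl_alg F n :=
  [ffun D : tl_diagram n => [forall x, r x (D x)]%:R].

Definition tl_mul (F : fieldType) (delta : F) n (f g : tl_alg F n) :
    tl_alg F n :=
  \sum_(D1 : tl_diagram n) \sum_(D2 : tl_diagram n)
     (f D1 * g D2 * delta ^+ tl_loops D1 D2) *: tl_basis F (tl_comp_rel D1 D2).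

Definition tl_id_rel n : rel (tl_pt n) := fun x y =>
  match x, y with
  | inl j, inr k | inr j, inl k => j == k
  | _, _ => false
  end.

(* 1^a (x) cap^(m) cup^(m) (x) 1^(n - a - 2m) *)
Definition tl_nest_rel n (a m : nat) : rel (tl_pt n) := fun x y =>
  let inside (j : nat) := (a <= j < a + 2 * m)%N in
  match x, y with
  | inl j, inl k | inr j, inr k =>
      inside j && (j + k == (2 * a + 2 * m).-1 :> nat)%N
  | inl j, inr k | inr j, inl k => ~~ inside j && (j == k)
  end.

Section JonesWenzl.
Variables (F : fieldType) (t : F) (n : nat).

Let mul := @tl_mul F (t + t^-1) n.

(* f_k (x) 1^(n - k), in the algebra on n >= k strands *)
Fixpoint jones_wenzl (k : nat) : tl_alg F n :=
  match k with
  | k1.+1 =>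
    match k1 with
    | k2.+1 =>
      let f := jones_wenzl k1 in
      f - (qnum t k1 / qnum t k1.+1) *:
            mul (mul f (tl_basis F (tl_nest_rel k2 1))) f
    | 0 => tl_basis F (@tl_id_rel n)
    end
  | 0 => tl_basis F (@tl_id_rel n)
  end.

(* f_n + [c]/[d] (f_k (x) 1^(n-k)) (1^a (x) cap^(m) cup^(m)) (f_k (x) 1^(n-k)),
   with n = a + 2m *)
Definition corrected_jw (k a m c d : nat) : tl_alg F n :=
  jones_wenzl n + (qnum t c / qnum t d) *:
    mul (mul (jones_wenzl k) (tl_basis F (tl_nest_rel a m))) (jones_wenzl k).

End JonesWenzl.

(* The value at q of a rational function, computed on its reduced form since
   the representative picked by repr may have a spurious zero at q in its
   denominator. *)
Definition rat_eval (K : fieldType) (q : K) (x : {fraction {poly K}}) : K :=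
  let r : {ratio {poly K}} := repr x in
  let g := gcdp (frac r).1 (frac r).2 in
  ((frac r).1 %/ g).[q] / ((frac r).2 %/ g).[q].

Definition tl_eval (K : fieldType) (q : K) n
    (f : tl_alg {fraction {poly K}} n) : tl_alg K n :=
  [ffun D : tl_diagram n => rat_eval q (f D)].

Section RestrictedQuantumGroup.
Variables (K : fieldType) (p : nat) (q : K).

(* A module over the restricted quantum group is given by the action of the
   generators E, F, K and of K^-1; its homomorphisms are the linear maps that
   commute with them. The defining relations of the algebra, which hold for the
   modules below, play no role in this and are not part of the data. *)
Record uq_action (V : lmodType K) := UqAction {
  actE : V -> V; actF : V -> V; actK : V -> V; actKV : V -> V }.

Definition uq_hom (V W : lmodType K) (A : uq_action V) (B : uq_action W)
    (f : {linear V -> W}) : Prop :=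
  [/\ forall v, f (actE A v) = actE B (f v),
      forall v, f (actF A v) = actF B (f v) &
      forall v, f (actK A v) = actK B (f v)].

(* X^(x) z in the basis of tensors of the nu's: a word has true in the positions
   carrying nu_1 and false in those carrying nu_0. *)
Definition tpow (z : nat) : lmodType K := {ffun z.-tuple bool -> K^o}.

(* The basis tensor, and the coordinate along it, of a word given as a sequence;
   both are 0 when the length is not z. *)
Definition rho z (s : seq bool) : tpow z :=
  [ffun w : z.-tuple bool => (tval w == s)%:R].
Definition coord z (v : tpow z) (s : seq bool) : K :=
  \sum_(w : z.-tuple bool | tval w == s) v w.

(* X_{n,z} *)
Definition in_weight z (n : nat) (v : tpow z) : Prop :=
  forall w, v w != 0 -> count id w = n.

(* f (x) g. The numbers of strands m and n are m1 + m2 and n1 + n2, but they are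
   kept as independent parameters so that no transport along an equation between
   natural numbers is needed. *)
Definition tens m1 n1 m2 n2 m n (f : tpow m1 -> tpow n1)
    (g : tpow m2 -> tpow n2) : tpow m -> tpow n :=
  lext (fun w : m.-tuple bool => [ffun w' : n.-tuple bool =>
    coord (f (rho m1 (take m1 w))) (take n1 w') *
    coord (g (rho m2 (drop m1 w))) (drop n1 w')] : tpow n).

Arguments tens {m1 n1 m2 n2 m n}.

Definition X_action : uq_action (tpow 1) := UqAction
  (lext (fun w : 1.-tuple bool => if thead w then rho 1 [:: false] else 0))
  (lext (fun w : 1.-tuple bool => if thead w then 0 else rho 1 [:: true]))
  (lext (fun w : 1.-tuple bool => (if thead w then q^-1 else q) *: rho 1 w))
  (lext (fun w : 1.-tuple bool => (if thead w then q else q^-1) *: rho 1 w)).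

(* Through the coproduct, X^(x) (z+1) being X (x) X^(x) z; the ground field
   X^(x) 0 is acted upon through the counit. *)
Fixpoint tpow_action (z : nat) : uq_action (tpow z) :=
  match z with
  | 0 => UqAction (fun=> 0) (fun=> 0) id id
  | z'.+1 =>
    let A := X_action in let B := tpow_action z' in
    UqAction
      (fun v => tens (actE A) (actK B) v + tens (m1 := 1) id (actE B) v)
      (fun v => tens (actF A) (@id (tpow z')) v + tens (actKV A) (actF B) v)
      (tens (actK A) (actK B))
      (tens (actKV A) (actKV B))
  end.

Definition cup_coef (a b : bool) : K :=
  match a, b with false, true => - q | true, false => 1 | _, _ => 0 end.
Definition cap_coef (a b : bool) : K :=
  match a, b with true, false => q^-1 | false, true => -1 | _, _ => 0 end.

Definition ncup (m : nat) : tpow (2 * m) -> tpow 0 :=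
  lext (fun w : (2 * m).-tuple bool =>
    (\prod_(k < m) cup_coef (nth false w k) (nth false w ((2 * m).-1 - k)))
      *: rho 0 [::]).
Definition ncap (m : nat) : tpow 0 -> tpow (2 * m) :=
  lext (fun _ : 0.-tuple bool => [ffun w : (2 * m).-tuple bool =>
    \prod_(k < m) cap_coef (nth false w k) (nth false w ((2 * m).-1 - k))]
      : tpow (2 * m)).

(* The matrix of a diagram, for the algebra morphism that maps the generators
   of the Temperley-Lieb algebra to 1^a (x) cap cup (x) 1^b. Straightening a
   zigzag (cup (x) 1)(1 (x) cap) gives -1, so a diagram is not simply the
   product of its arcs: an arc whose left endpoint is in position j has to be
   weighted by (-1)^j, which turns all zigzags into identities and cancels out
   in 1^a (x) cap cup (x) 1^b. *)
Definition tl_coef n (D : tl_diagram n) (w' w : n.-tuple bool) : K :=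
  \prod_(x : tl_pt n)
    match x, D x with
    | inl j, inl k => if (j < k)%N then
        (-1) ^+ j * cap_coef (tnth w' j) (tnth w' k) else 1
    | inr j, inr k => if (j < k)%N then
        (-1) ^+ j * cup_coef (tnth w j) (tnth w k) else 1
    | inl j, inr k => (tnth w' j == tnth w k)%:R
    | inr _, inl _ => 1
    end.

Definition tl_act n (f : tl_alg K n) : tpow n -> tpow n :=
  lext (fun w : n.-tuple bool =>
    [ffun w' => \sum_(D : tl_diagram n) f D * tl_coef D w' w] : tpow n).

(* The exponent is k (2p - 1) - (k^2 - k)/2 - (i_1 + ... + i_k), with positions
   counted from 1. *)
Definition ab_coef (w : (2 * p - 1).-tuple bool) : K :=
  let k := count id w in
  q ^ ((k * (2 * p - 1))%N%:Z - 'C(k, 2)%:Z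
       - (\sum_(j < 2 * p - 1 | tnth w j) j.+1)%N%:Z).

Definition alpha : tpow (2 * p - 1) -> tpow (2 * p - 1) :=
  lext (fun w : (2 * p - 1).-tuple bool =>
    let k := count id w in
    if (k.+1 <= p)%N then
      (ab_coef w * qfact q k) *:
        iter (p - k - 1) (actE (tpow_action (2 * p - 1)))
             (rho (2 * p - 1) (nseq (2 * p - 1) true))
    else 0).

Definition beta : tpow (2 * p - 1) -> tpow (2 * p - 1) :=
  lext (fun w : (2 * p - 1).-tuple bool =>
    let k := count id w in
    if (p <= k)%N then
      (ab_coef w * qfact q (2 * p - 1 - k)) *:
        iter (k - p) (actF (tpow_action (2 * p - 1)))
             (rho (2 * p - 1) (nseq (2 * p - 1) false))
    else 0).

(* The indices of a_k, b_k (k < s), x_j, y_j (j < p - s), in this order. *)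
Definition proj_idx (s : nat) : finType :=
  (('I_s + 'I_s) + ('I_(p - s) + 'I_(p - s)))%type.

Definition proj_mod (s : nat) : lmodType K := {ffun proj_idx s -> K^o}.

(* Basis vectors, with the convention that they are 0 when the index is too
   large. *)
Definition pa s (k : nat) : proj_mod s :=
  [ffun e : proj_idx s =>
     (if e is inl (inl j) then (j == k :> nat)%:R else 0) : K].
Definition pb s (k : nat) : proj_mod s :=
  [ffun e : proj_idx s =>
     (if e is inl (inr j) then (j == k :> nat)%:R else 0) : K].
Definition px s (k : nat) : proj_mod s :=
  [ffun e : proj_idx s =>
     (if e is inr (inl j) then (j == k :> nat)%:R else 0) : K].
Definition py s (k : nat) : proj_mod s :=
  [ffun e : proj_idx s =>
     (if e is inr (inr j) then (j == k :> nat)%:R else 0) : K].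

Section ProjectiveAction.
Variables (neg : bool) (s : nat).
Let sg : K := (-1) ^+ neg.

Definition proj_wt (e : proj_idx s) : K :=
  match e with
  | inl (inl k) | inl (inr k) => sg * q ^ (s%:Z - 1 - (2 * k)%N%:Z)
  | inr (inl j) | inr (inr j) => - sg * q ^ ((p - s)%N%:Z - 1 - (2 * j)%N%:Z)
  end.

(* P^+_s for neg = false and P^-_s for neg = true *)
Definition proj_action : uq_action (proj_mod s) := UqAction
  (lext (fun e : proj_idx s =>
     match e with
     | inl (inl k) => (sg * qnum q k * qnum q (s - k)) *: pa s k.-1
     | inl (inr k) =>
         if k == 0 :> nat then px s (p - s - 1)
         else (sg * qnum q k * qnum q (s - k)) *: pb s k.-1 + pa s k.-1
     | inr (inl j) => (- sg * qnum q j * qnum q (p - s - j)) *: px s j.-1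
     | inr (inr j) =>
         if j == 0 :> nat then pa s (s - 1)
         else (- sg * qnum q j * qnum q (p - s - j)) *: py s j.-1
     end))
  (lext (fun e : proj_idx s =>
     match e with
     | inl (inl k) => pa s k.+1
     | inl (inr k) => if (k < s - 1)%N then pb s k.+1 else py s 0
     | inr (inl j) => if (j < p - s - 1)%N then px s j.+1 else pa s 0
     | inr (inr j) => py s j.+1
     end))
  (fun v => [ffun e => proj_wt e * v e] : proj_mod s)
  (fun v => [ffun e => (proj_wt e)^-1 * v e] : proj_mod s).

End ProjectiveAction.

Section Homomorphisms.
Variable i : nat.

Definition theta1 : proj_mod i -> proj_mod (p - i) :=
  lext (fun e : proj_idx i => match e with
    | inl (inr m) => px (p - i) m | inr (inr n) => pa (p - i) n | _ => 0 end).
Definition theta2 : proj_mod i -> proj_mod (p - i) :=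
  lext (fun e : proj_idx i => match e with
    | inl (inr m) => py (p - i) m | inr (inl n) => pa (p - i) n | _ => 0 end).
Definition Gamma1 : proj_mod (p - i) -> proj_mod i :=
  lext (fun e : proj_idx (p - i) => match e with
    | inl (inr n) => px i n | inr (inr m) => pa i m | _ => 0 end).
Definition Gamma2 : proj_mod (p - i) -> proj_mod i :=
  lext (fun e : proj_idx (p - i) => match e with
    | inl (inr n) => py i n | inr (inl m) => pa i m | _ => 0 end).

Let t : {fraction {poly K}} := FracField.tofrac 'X.

Definition idem_plus : tpow (2 * p - i - 1) -> tpow (2 * p - i - 1) :=
  tl_act (tl_eval q
    (corrected_jw t (2 * p - i - 1) (p - 1) (i - 1) (p - i) i p)).

Definition idem_minus : tpow (2 * p + i - 1) -> tpow (2 * p + i - 1) :=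
  tl_act (tl_eval q
    (corrected_jw t (2 * p + i - 1) (2 * p - 1) (2 * p - i - 1) i
       (2 * p - i) (2 * p))).

(* inc and prj identify P^+_i with the image of idem_plus, compatibly with the
   weight spaces. *)
Record plus_summand (inc : {linear proj_mod i -> tpow (2 * p - i - 1)})
    (prj : {linear tpow (2 * p - i - 1) -> proj_mod i}) : Prop := PlusSummand {
  plus_inc_hom : uq_hom (proj_action false i) (tpow_action _) inc;
  plus_prj_hom : uq_hom (tpow_action _) (proj_action false i) prj;
  plus_prj_inc : forall u, prj (inc u) = u;
  plus_inc_prj : forall v, inc (prj v) = idem_plus v;
  plus_wt_x : forall n, (n < p - i)%N -> in_weight n (inc (px i n));
  plus_wt_a : forall m, (m < i)%N -> in_weight (p - i + m) (inc (pa i m));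
  plus_wt_b : forall m, (m < i)%N -> in_weight (p - i + m) (inc (pb i m));
  plus_wt_y : forall n, (n < p - i)%N -> in_weight (p + n) (inc (py i n)) }.

(* A copy of P^-_{p-i} whose weights start at d. *)
Record minus_copy (d : nat)
    (inc : {linear proj_mod (p - i) -> tpow (2 * p + i - 1)})
    (prj : {linear tpow (2 * p + i - 1) -> proj_mod (p - i)}) : Prop :=
    MinusCopy {
  minus_inc_hom : uq_hom (proj_action true (p - i)) (tpow_action _) inc;
  minus_prj_hom : uq_hom (tpow_action _) (proj_action true (p - i)) prj;
  minus_prj_inc : forall u, prj (inc u) = u;
  minus_wt_x : forall m, (m < i)%N -> in_weight (d + m) (inc (px (p - i) m));
  minus_wt_a : forall n, (n < p - i)%N ->
    in_weight (d + i + n) (inc (pa (p - i) n));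
  minus_wt_b : forall n, (n < p - i)%N ->
    in_weight (d + i + n) (inc (pb (p - i) n));
  minus_wt_y : forall m, (m < i)%N ->
    in_weight (d + p + m) (inc (py (p - i) m)) }.

(* The image of idem_minus is the direct sum of the lower and upper copies. *)
Record minus_summands
    (incl incu : {linear proj_mod (p - i) -> tpow (2 * p + i - 1)})
    (prjl prju : {linear tpow (2 * p + i - 1) -> proj_mod (p - i)}) : Prop :=
    MinusSummands {
  minus_lower : minus_copy 0 incl prjl;
  minus_upper : minus_copy p incu prju;
  minus_prjl_incu : forall u, prjl (incu u) = 0;
  minus_prju_incl : forall u, prju (incl u) = 0;
  minus_split : forall v, incl (prjl v) + incu (prju v) = idem_minus v }.

(* (T (x) 1^i)(1^(2p-i-1) (x) cap^(i)) *)
Definition cap_then (T : tpow (2 * p - 1) -> tpow (2 * p - 1)) :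
    tpow (2 * p - i - 1) -> tpow (2 * p + i - 1) :=
  (tens T (@id (tpow i)) : tpow (2 * p + i - 1) -> tpow (2 * p + i - 1))
  \o (tens (@id (tpow (2 * p - i - 1))) (@ncap i)).

(* (1^(2p-i-1) (x) cup^(i))(T (x) 1^i) *)
Definition then_cup (T : tpow (2 * p - 1) -> tpow (2 * p - 1)) :
    tpow (2 * p + i - 1) -> tpow (2 * p - i - 1) :=
  (tens (@id (tpow (2 * p - i - 1))) (@ncup i))
  \o (tens T (@id (tpow i)) : tpow (2 * p + i - 1) -> tpow (2 * p + i - 1)).

End Homomorphisms.
End RestrictedQuantumGroup.

Arguments alpha {K} p q.
Arguments beta {K} p q.
Arguments theta1 K p i : clear implicits.
Arguments theta2 K p i : clear implicits.
Arguments Gamma1 K p i : clear implicits.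
Arguments Gamma2 K p i : clear implicits.
Arguments cap_then {K p} q i T.
Arguments then_cup {K p} q i T.

(* Main.v *)
(** A Temperley-Lieb diagram acts on tensor powers by a product of local factors;
    stacking two diagrams contracts arcs pairwise on a line, which preserves
    planarity, so the action is multiplicative up to loops. For generic t the
    Jones-Wenzl element f_k therefore acts as the explicit projection with entries
    t^-inv(a) t^-inv(b) / [k choose |a|] onto t-symmetric vectors. In the corrected
    element defining the idempotent e- on 2p+i-1 strands the pole at t = q cancels,
    so its entries at q can be computed: e- is a symmetric matrix and its columns
    are q-symmetric in the first 2p-1 letters.

    Each of the maps alpha, beta, beta alpha, alpha beta has entries
    tau(|a|, |b|) q^-inv(a) q^-inv(b) and commutes with E, F, K. If T is the
    corresponding operator capped off, (e- - 1) T is q-symmetric in the first 2p-1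
    letters, while its pairing with q-symmetric vectors is a sum over diagrams
    other than the identity, each of which contributes 0: either it has a cup or
    cap on two neighbouring q-symmetric strands, or only an arc at positions
    (2p-1, 2p), where the contribution is a multiple of a vanishing Gaussian
    binomial. As the relevant Gaussian binomials on 2p-1 letters do not vanish,
    e- T = T. Similarly T e+ = T, and dually for the operators closed by cups.

    So T induces homomorphisms from P+_i to the two copies of P-_{p-i}. Since b_0
    generates P+_i and its image must lie in the span of x_0 and y_0 by its K-weight,
    these are combinations of theta_1 and theta_2, and the weights of T b_0, T x_0
    and T y_0 leave one of the four coefficients. *)
From HB Require Import structures.
Require Import Defs.
From mathcomp Require Import all_boot all_order all_algebra.
From mathcomp Require Import reals trigo complex.
From mathcomp Require Import zify ring.

Set Implicit Arguments.
Unset Strict Implicit.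
Unset Printing Implicit Defensive.
Import GRing.Theory.
Local Open Scope ring_scope.

(** * Words, inversions and Gaussian binomials *)

(** Matrices are indexed by plain [seq bool], constrained only by size, so that words can be cut and
    concatenated without transport between tuple types. The idempotents are defined by evaluating
    coefficients in the diagram basis, whereas only matrix entries are computable. Passing from
    regular entries to regular coefficients is a separate argument: a triangular system ordered by
    the total length of the arcs of a diagram. The pole to be cancelled is simple because the
    characteristic is 0. The idempotent on 2p-i-1 strands is easier: the operators are q-symmetric
    in all its letters, so every diagram but the identity is killed whatever its coefficient, and
    the identity has coefficient 1. E is the transpose of F up to K and a scalar, and cups are
    transposes of caps up to a power of q. Commutation with E and absorption for cups are thereby
    reduced to F and to caps. *)

Fixpoint words (n : nat) : seq (seq bool) :=
  if n is m.+1 then map (cons false) (words m) ++ map (cons true) (words m)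
  else [:: [::]].

Lemma mem_words n s : (s \in words n) = (size s == n).
Proof.
elim: n s => [|n IHn] [|b s] //=; rewrite mem_cat.
  by apply/norP; split; apply/negP => /mapP[].
have E c : (b :: s \in map (cons c) (words n)) = (b == c) && (size s == n).
  rewrite -IHn; apply/mapP/andP => [[t ht [-> ->]]|[/eqP-> hs]] //.
  by exists s.
by rewrite !E eqSS; clear E; case: b; rewrite ?orbF.
Qed.

Lemma uniq_words n : uniq (words n).
Proof.
elim: n => //= n IHn; have inj (b : bool) : injective (cons b) by move=> ? ? [].
rewrite cat_uniq !(map_inj_uniq (inj _)) IHn andbT /=.
by apply/hasPn => s /mapP[t _ ->]; apply/negP => /mapP[].
Qed.

Lemma words_size n s : s \in words n -> size s = n.
Proof. by rewrite mem_words => /eqP. Qed.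

Section WordSums.
Variable V : nmodType.
Implicit Type f : seq bool -> V.

Lemma big_words0 f : \sum_(s <- words 0) f s = f [::].
Proof. exact: big_seq1. Qed.

Lemma big_wordsS n f :
  \sum_(s <- words n.+1) f s =
  \sum_(s <- words n) f (false :: s) + \sum_(s <- words n) f (true :: s).
Proof. by rewrite /= big_cat !big_map. Qed.

Lemma big_words1 f : \sum_(s <- words 1) f s = f [:: false] + f [:: true].
Proof. by rewrite big_wordsS !big_words0. Qed.

Lemma big_words_cat m n f :
  \sum_(s <- words (m + n)) f s =
  \sum_(a <- words m) \sum_(b <- words n) f (a ++ b).
Proof.
elim: m f => [|m IHm] f; first by rewrite big_words0.
by rewrite addSn 2!big_wordsS !IHm.
Qed.

Lemma eq_big_words n f g : (forall s, size s = n -> f s = g s) ->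
  \sum_(s <- words n) f s = \sum_(s <- words n) g s.
Proof. by move=> e; apply: eq_big_seq => s /words_size /e. Qed.

Lemma big_words0P n f : (forall s, size s = n -> f s = 0) ->
  \sum_(s <- words n) f s = 0.
Proof. by move=> e; rewrite (eq_big_words e) big1. Qed.

Lemma big_words_tuple n f :
  \sum_(w : n.-tuple bool) f (tval w) = \sum_(s <- words n) f s.
Proof.
rewrite -(big_map (fun w : n.-tuple bool => tval w) xpredT f).
apply: perm_big; apply: uniq_perm; rewrite ?uniq_words //.
  by rewrite map_inj_uniq ?index_enum_uniq //; apply: val_inj.
move=> s; rewrite mem_words; apply/mapP/eqP => [[w _ ->]|hs].
  exact: size_tuple.
by exists (tcast hs (in_tuple s)); rewrite ?mem_index_enum ?val_tcast.
Qed.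

Lemma big_words_delta n f a : size a = n ->
  \sum_(s <- words n) (if s == a then f s else 0) = f a.
Proof.
move=> ha; rewrite (big_rem a) ?mem_words ?ha //= eqxx big1_seq ?addr0 //.
move=> s /andP[_]; rewrite (rem_filter _ (uniq_words n)) mem_filter /=.
by case/andP=> /negPf->.
Qed.

End WordSums.

(** Nested caps and cups pair mirrored positions with opposite letters, so on [2m] strands they are
    supported on the words [u ++ bar u]. *)
Definition bar (s : seq bool) := rev (map negb s).

Lemma size_bar s : size (bar s) = size s.
Proof. by rewrite size_rev size_map. Qed.

Lemma barK : involutive bar.
Proof.
by move=> s; rewrite /bar map_rev revK -map_comp map_id_in // => b _ /=; rewrite negbK.
Qed.

Lemma bar_cat s t : bar (s ++ t) = bar t ++ bar s.
Proof. by rewrite /bar map_cat rev_cat. Qed.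

Lemma bar_cons b s : bar (b :: s) = bar s ++ [:: ~~ b].
Proof. by rewrite -cat1s bar_cat. Qed.

Lemma count_bar s : count id (bar s) = count negb s.
Proof. by rewrite /bar count_rev count_map. Qed.

Lemma countn_bar s : count negb (bar s) = count id s.
Proof. by rewrite -{2}(barK s) count_bar. Qed.

Lemma count_negb s : (count negb s = size s - count id s)%N.
Proof. by rewrite -(count_predC id s) addKn; apply: eq_count. Qed.

Lemma count_le s : (count id s <= size s)%N. Proof. exact: count_size. Qed.

(** Counts the pairs with [false] before [true]; this is the exponent of [q^-1] in the divided
    powers of F applied to a power of nu_0, see [iter_F]. *)
Fixpoint inv (s : seq bool) : nat :=
  if s is b :: s' then ((if b then 0 else count id s') + inv s')%N else 0.

Lemma inv_cat s t :
  inv (s ++ t) = (inv s + inv t + count negb s * count id t)%N.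
Proof. by elim: s => [|[] s /= ->]; rewrite ?count_cat ?addn0 //=; lia. Qed.

Lemma inv_bar s : inv (bar s) = inv s.
Proof.
elim: s => [|b s IHs] //; rewrite bar_cons inv_cat IHs countn_bar /=.
by case: b; rewrite /= ?muln0 ?muln1 ?addn0 // addnC.
Qed.

Lemma inv_nseq m k : inv (nseq m true ++ nseq k false) = 0%N.
Proof.
have inv1 j : inv (nseq j true) = 0%N by elim: j.
have inv0 j : inv (nseq j false) = 0%N.
  by elim: j => //= j ->; rewrite count_nseq /= mul0n.
by rewrite inv_cat inv1 inv0 !count_nseq.
Qed.

(* [gbin x z m] is the Gaussian binomial coefficient with base [x]. *)
Fixpoint gbin (K : pzRingType) (x : K) (z m : nat) : K :=
  match z, m with
  | _, 0 => 1
  | 0, _.+1 => 0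
  | z'.+1, m'.+1 => gbin x z' m' + x ^+ m * gbin x z' m
  end.

Section Gaussian.
Variables (K : comPzRingType) (x : K).
Local Notation gb := (gbin x).

Lemma gbin0 z : gb z 0 = 1. Proof. by case: z. Qed.

Lemma gbinS z m : gb z.+1 m.+1 = gb z m + x ^+ m.+1 * gb z m.+1.
Proof. by []. Qed.

Lemma gbin_small z m : (z < m)%N -> gb z m = 0.
Proof.
elim: z m => [|z IHz] [|m] //=; rewrite ltnS => hm.
by rewrite !IHz // ?mulr0 ?addr0 //; lia.
Qed.

Lemma gbinn z : gb z z = 1.
Proof. by elim: z => // z IHz; rewrite gbinS IHz gbin_small // mulr0 addr0. Qed.

(** Stated without division, so that the identities survive at roots of unity. They are proved
    together: the second at [z] follows from the first at [z], and the first at [z + 1] from both at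
    [z]. *)
Let gbin_step z : (forall m, (m <= z)%N ->
    (1 - x ^+ m.+1) * gb z m.+1 = (1 - x ^+ (z - m)) * gb z m) /\
  (forall m, (m <= z)%N ->
    (1 - x ^+ m.+1) * gb z.+1 m.+1 = (1 - x ^+ z.+1) * gb z m).
Proof.
have second z' : (forall m, (m <= z')%N ->
    (1 - x ^+ m.+1) * gb z' m.+1 = (1 - x ^+ (z' - m)) * gb z' m) ->
  (forall m, (m <= z')%N ->
    (1 - x ^+ m.+1) * gb z'.+1 m.+1 = (1 - x ^+ z'.+1) * gb z' m).
  move=> h m hm; rewrite gbinS mulrDr mulrCA h //.
  rewrite (_ : z'.+1 = (m.+1 + (z' - m))%N) ?exprD; last by lia.
  by ring.
elim: z => [|z [IH1 IH2]].
  have h : forall m, (m <= 0)%N ->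
    (1 - x ^+ m.+1) * gb 0 m.+1 = (1 - x ^+ (0 - m)) * gb 0 m.
    by move=> m; rewrite leqn0 => /eqP->; rewrite /= subrr mulr0 mul0r.
  by split=> //; apply: second.
have h : forall m, (m <= z.+1)%N ->
    (1 - x ^+ m.+1) * gb z.+1 m.+1 = (1 - x ^+ (z.+1 - m)) * gb z.+1 m.
  move=> [|m] hm; first by rewrite IH2 // !gbin0 subn0.
  have [hmz|hmz] := leqP m.+1 z; last first.
    have -> : m = z by lia.
    by rewrite gbin_small // subnn expr0 subrr mulr0 mul0r.
  rewrite IH2 // subSS [gb z.+1 m.+1]gbinS mulrDr.
  rewrite -(IH1 m) ?(ltnW hmz) //.
  rewrite (_ : z.+1 = (m.+1 + (z - m))%N) ?exprD; last by lia.
  by ring.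
by split=> //; apply: second.
Qed.

Lemma gbin_succ z m : (m <= z)%N ->
  (1 - x ^+ m.+1) * gb z m.+1 = (1 - x ^+ (z - m)) * gb z m.
Proof. by have [h _] := gbin_step z; apply: h. Qed.

Lemma gbin_succ2 z m : (m <= z)%N ->
  (1 - x ^+ m.+1) * gb z.+1 m.+1 = (1 - x ^+ z.+1) * gb z m.
Proof. by have [_ h] := gbin_step z; apply: h. Qed.

Lemma gbin_succ1 z m : (m <= z)%N ->
  (1 - x ^+ (z.+1 - m)) * gb z.+1 m = (1 - x ^+ z.+1) * gb z m.
Proof. by move=> hm; rewrite -gbin_succ ?gbin_succ2 // leqW. Qed.

End Gaussian.

Arguments gbin : simpl never.

Section QWeights.
Variables (K : fieldType) (q : K).

(** Coefficients of the q-symmetric vectors: replacing neighbouring letters [true; false] by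
    [false; true] costs a factor [q^-1], which is the relation that every cup on two neighbouring
    strands annihilates. *)
Definition sy (s : seq bool) : K := q^-1 ^+ inv s.

Lemma syE s : sy s = q^-1 ^+ inv s. Proof. by []. Qed.

Lemma sy_cat s t :
  sy (s ++ t) = sy s * sy t * q^-1 ^+ (count negb s * count id t).
Proof. by rewrite /sy inv_cat !exprD. Qed.

Lemma sy_bar s : sy (bar s) = sy s. Proof. by rewrite /sy inv_bar. Qed.

Lemma sy_cons b s : sy (b :: s) = (if b then 1 else q^-1 ^+ count id s) * sy s.
Proof. by case: b; rewrite /sy /= ?add0n ?mul1r // exprD. Qed.

Lemma sy1 b : sy [:: b] = 1. Proof. by case: b. Qed.

Lemma sy_neq0 s : q != 0 -> sy s != 0.
Proof. by move=> q0; rewrite expf_neq0 ?invr_neq0. Qed.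

(** The squared norm of the q-symmetric vector of weight [m]. Splitting off the first letter gives
    Pascal's rule with base [q^-2]. *)
Lemma sum_sy2 z m :
  \sum_(s <- words z) (if count id s == m then sy s ^+ 2 else 0) =
  gbin (q^-1 ^+ 2) z m.
Proof.
elim: z m => [|z IHz] m.
  by rewrite big_words0; case: m => [|m] //=; rewrite /sy /gbin /= expr0 expr1n.
have S0 k : \sum_(s <- words z)
    (if count id s == k then sy (false :: s) ^+ 2 else 0) =
    q^-1 ^+ 2 ^+ k * gbin (q^-1 ^+ 2) z k.
  rewrite -IHz mulr_sumr; apply: eq_bigr => s _.
  case: eqP => [<-|]; rewrite ?mulr0 //.
  by rewrite sy_cons exprMn exprAC.
rewrite big_wordsS; case: m => [|m] /=.
  under eq_bigr => s _ do rewrite add0n.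
  by rewrite S0 big1 ?addr0 ?expr0 ?mul1r ?gbin0 // => s _; rewrite add1n.
under eq_bigr => s _ do rewrite add0n.
rewrite S0 addrC gbinS -(IHz m); congr (_ + _).
Qed.

End QWeights.

(** * Planar matchings and their contractions *)

Section Line.
Variables (V : finType) (pos : V -> nat).
Hypothesis pos_inj : injective pos.

Definition plt a b := (pos a < pos b)%N.

(* The parity of the number of crossings of the chords a-a' and b-b' of the
   upper half plane; it is additive in each chord, which is what makes the
   planarity of a contraction immediate. *)
Definition crossing a a' b b' := plt a b (+) plt a' b (+) plt a b' (+) plt a' b'.

(** [A] marks the points still on the line. Contracted points stay in [V], matched with each other
    and exempt from planarity, so that the type of points never changes. *)
Record planar (A : pred V) (M : V -> V) : Prop := Planar {
  planarK : involutive M;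
  planar_fpf : forall v, M v != v;
  planar_stable : forall v, A (M v) = A v;
  planar_cross : forall a b, A a -> A b -> b != a -> b != M a ->
    crossing a (M a) b (M b) = false }.

Lemma ltC a b : a != b -> plt b a = ~~ plt a b.
Proof. by move=> ne; rewrite /plt -leqNgt ltn_neqAle (inj_eq pos_inj) eq_sym ne. Qed.

Lemma crossingC a a' b b' : a != b -> a' != b -> a != b' -> a' != b' ->
  crossing b b' a a' = crossing a a' b b'.
Proof.
move=> h1 h2 h3 h4; rewrite /crossing !(ltC h1, ltC h2, ltC h3, ltC h4).
by case: (plt a b); case: (plt a' b); case: (plt a b'); case: (plt a' b').
Qed.

(** Gluing [x] to [y] joins their partners by an arc; [x] and [y] are left matched with each other,
    so the contracted pair survives as a loop. *)
Definition contract x y (M : V -> V) z :=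
  if z == x then y else if z == y then x
  else if z == M x then M y else if z == M y then M x else M z.

Section Contract.
Variables (A : pred V) (M : V -> V) (x y : V).
Hypotheses (plM : planar A M) (ne_xy : x != y).

Let MK := planarK plM.
Let Mf := planar_fpf plM.

Lemma contract_matched : M x = y -> contract x y M =1 M.
Proof.
move=> Mx z; rewrite /contract Mx; have My : M y = x by rewrite -Mx MK.
rewrite My; have [->|zx] := eqVneq z x; first by rewrite Mx.
by have [->|zy] := eqVneq z y; first by rewrite My.
Qed.

Hypothesis unm : M x != y.

Lemma unm_sym : M y != x.
Proof. by apply: contra unm => /eqP <-; rewrite MK. Qed.

Lemma unm_neq : M x != M y.
Proof. by rewrite (inj_eq (can_inj MK)). Qed.

Lemma contract_x : contract x y M x = y.
Proof. by rewrite /contract eqxx. Qed.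

Lemma contract_y : contract x y M y = x.
Proof. by rewrite /contract eqxx eq_sym (negPf ne_xy). Qed.

Lemma contract_u : contract x y M (M x) = M y.
Proof. by rewrite /contract (negPf (Mf x)) (negPf unm) eqxx. Qed.

Lemma contract_v : contract x y M (M y) = M x.
Proof.
rewrite /contract (negPf (Mf y)) (negPf unm_sym) eqxx.
by rewrite eq_sym (negPf unm_neq).
Qed.

Lemma contract_other z : z != x -> z != y -> z != M x -> z != M y ->
  contract x y M z = M z.
Proof. by rewrite /contract; do 4 move/negPf->. Qed.

Lemma contract_spec z : [\/ z = x, z = y, z = M x | z = M y] \/
  [/\ z != x, z != y, z != M x & z != M y].
Proof.
case: (eqVneq z x) => [->|h1]; first by left; constructor 1.
case: (eqVneq z y) => [->|h2]; first by left; constructor 2.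
case: (eqVneq z (M x)) => [->|h3]; first by left; constructor 3.
case: (eqVneq z (M y)) => [->|h4]; first by left; constructor 4.
by right.
Qed.

Lemma neqM a b : a != M b -> M a != b.
Proof. by apply: contra => /eqP <-; rewrite MK. Qed.

End Contract.

(** No active point lies between [x] and [y], so every other point compares with [x] as with [y].
    The crossing parity of the new arc with a chord is then the sum of those of the two old arcs,
    which are both 0. *)
Lemma contract_planar A M x y : planar A M -> A x -> A y -> x != y ->
  (forall b, A b -> b != x -> b != y -> plt x b = plt y b) ->
  planar [pred v | [&& A v, v != x & v != y]] (contract x y M).
Proof.
move=> plM Ax Ay ne adj; have [MK Mf Ms Mc] := plM.
have inj := can_inj MK.
have [Mx|unm] := eqVneq (M x) y.
  have E := contract_matched plM Mx; have My : M y = x by rewrite -Mx MK.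
  split=> [v|v|v|a b /and3P[Aa ax ay] /and3P[Ab bx by'] nba]; rewrite !E ?MK //=.
  - rewrite Ms; congr (_ && _); rewrite andbC; congr (_ && _).
      by rewrite -{1}Mx (inj_eq inj).
    by rewrite -{1}My (inj_eq inj).
  - exact: Mc.
have Mn := unm_neq plM ne; have unm' := unm_sym plM unm.
have Cx := contract_x M x y; have Cy := contract_y M ne.
have Cu := contract_u plM unm; have Cv := contract_v plM ne unm.
have Co := @contract_other M x y.
split.
- move=> z; have [[]->|[h1 h2 h3 h4]] := contract_spec M x y z.
  + by rewrite Cx Cy.
  + by rewrite Cy Cx.
  + by rewrite Cu Cv.
  + by rewrite Cv Cu.
  by rewrite [contract x y M z]Co // Co ?MK // ?(inj_eq inj) ?(neqM plM).
- move=> z; have [[]->|[h1 h2 h3 h4]] := contract_spec M x y z.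
  + by rewrite Cx eq_sym.
  + by rewrite Cy.
  + by rewrite Cu eq_sym.
  + by rewrite Cv.
  by rewrite Co.
- move=> z /=; have [[]->|[h1 h2 h3 h4]] := contract_spec M x y z.
  + by rewrite Cx !eqxx !andbF.
  + by rewrite Cy !eqxx !andbF.
  + by rewrite Cu !Ms Ax Ay unm unm' !Mf.
  + by rewrite Cv !Ms Ax Ay unm unm' !Mf.
  rewrite Co // Ms h1 h2 !(neqM plM) //.
move=> a b /and3P[Aa ax ay] /and3P[Ab bx by'].
have key c : A c -> c != x -> c != y -> c != M x -> c != M y ->
    crossing (M x) (M y) c (M c) = false.
  move=> Ac cx cy cu cv.
  have X := Mc x c Ax Ac cx cu; have Y := Mc y c Ay Ac cy cv.
  have AMc : A (M c) by rewrite Ms.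
  have a1 := adj c Ac cx cy.
  have a2 : plt x (M c) = plt y (M c) by apply: adj; rewrite ?(neqM plM).
  move: X Y; rewrite /crossing a1 a2; case: (plt y c); case: (plt (M x) c);
  by case: (plt y (M c)); case: (plt (M x) (M c)); case: (plt (M y) c);
    case: (plt (M y) (M c)).
have key' c : A c -> c != x -> c != y -> c != M x -> c != M y ->
    crossing (M y) (M x) c (M c) = false.
  move=> Ac cx cy cu cv; rewrite -(key c) // /crossing.
  by rewrite [plt (M y) c (+) _]addbC -!addbA; congr (_ (+) (_ (+) _)); rewrite addbC.
have fl c d : A c -> c != x -> c != y -> c != M x -> c != M y ->
   (d == M x) || (d == M y) -> crossing c (M c) d (contract x y M d) = false.
  move=> Ac cx cy cu cv; have Mcu : M c != M x by rewrite (inj_eq inj).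
  have Mcv : M c != M y by rewrite (inj_eq inj).
  case/orP=> /eqP->; rewrite ?Cu ?Cv crossingC ?[M x == _]eq_sym
    ?[M y == _]eq_sym //; [exact: key | exact: key'].
have [[] E|[h1 h2 h3 h4]] := contract_spec M x y a.
- by rewrite E eqxx in ax.
- by rewrite E eqxx in ay.
- rewrite E Cu => bu bv; rewrite Co //; exact: key.
- rewrite E Cv => bu bv; rewrite Co //; exact: key'.
have [[] E|[k1 k2 k3 k4]] := contract_spec M x y b.
- by rewrite E eqxx in bx.
- by rewrite E eqxx in by'.
- by rewrite E Co // => _ _; apply: fl; rewrite ?eqxx.
- by rewrite E Co // => _ _; apply: fl; rewrite ?eqxx ?orbT.
by rewrite !Co //; apply: Mc.
Qed.

End Line.

(** * Multiplicativity of the action of diagrams *)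

Section ArcWeights.
Variables (F : fieldType) (t : F).
Hypothesis t0 : t != 0.

(** Weight of an arc whose left end carries [b1] and whose right end carries [b2]. After the change
    of gauge in [tl_coefE] it is the same for caps, cups and through strands. *)
Definition kap (b1 b2 : bool) : F :=
  match b1, b2 with true, false => t^-1 | false, true => 1 | _, _ => 0 end.

Definition aw (l b1 b2 : bool) : F := if l then kap b1 b2 else kap b2 b1.

(** With [x] immediately to the left of [y], the excluded orientation is an arc going right from [x]
    and one going left from [y]; these would cross. *)
Lemma zigzag cu cv lu lv : ~~ (lu && ~~ lv) ->
  aw lu true cu * aw lv false cv + t * (aw lu false cu * aw lv true cv) =
  aw (lu (+) lv) cu cv.
Proof.
by case: cu; case: cv; case: lu; case: lv; rewrite /aw //= => _; field.
Qed.

Variables (V : finType) (pos : V -> nat).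
Hypothesis pos_inj : injective pos.
Local Notation lt := (plt pos).

Definition wprod (M : V -> V) (P : pred V) (c : V -> bool) : F :=
  \prod_(a | P a && lt a (M a)) kap (c a) (c (M a)).

Lemma wprod_split M (P : pred V) c x : involutive M -> (forall v, M v != v) ->
  P x -> P (M x) ->
  wprod M P c = aw (lt x (M x)) (c x) (c (M x)) *
    wprod M [pred a | [&& P a, a != x & a != M x]] c.
Proof.
move=> MK Mf Px PMx; rewrite /wprod.
have lx := ltC pos_inj (Mf x); rewrite lx.
have [l|l] := boolP (lt (M x) x).
  rewrite (bigD1 (M x)) /=; last by rewrite MK PMx.
  rewrite MK; congr (_ * _); apply: eq_bigl => a.
  have [->|_] := eqVneq a (M x); first by rewrite !andbF.
  have [->|_] := eqVneq a x; last by rewrite !andbT.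
  by rewrite lx l !andbF.
rewrite (bigD1 x) /=; last by rewrite Px lx l.
congr (_ * _); apply: eq_bigl => a.
have [->|_] := eqVneq a x; first by rewrite !andbF.
have [->|_] := eqVneq a (M x); last by rewrite !andbT.
by rewrite MK (negPf l) !andbF.
Qed.

Lemma eq_wprod M M' (P P' : pred V) c c' : P =1 P' ->
  (forall a, P a -> M a = M' a) ->
  (forall a, P a -> c a = c' a /\ c (M a) = c' (M a)) ->
  wprod M P c = wprod M' P' c'.
Proof.
move=> eP eM ec; rewrite /wprod; apply: eq_big => [a|a /andP[Pa _]].
  by rewrite -eP; case Pa: (P a) => //=; rewrite eM.
by rewrite -eM //; have [-> ->] := ec a Pa.
Qed.

(* The local move: the bits at the glued points x and y are opposite, and
   summing over them straightens the two arcs ending at x and y. *)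
Lemma wprod_contract (A : pred V) M x y (c0 c1 : V -> bool) :
  planar pos A M -> A x -> A y -> x != y -> M x != y -> lt x y ->
  (forall b, A b -> b != x -> b != y -> lt x b = lt y b) ->
  c0 x -> ~~ c0 y -> ~~ c1 x -> c1 y ->
  (forall a, a != x -> a != y -> c1 a = c0 a) ->
  wprod (contract x y M) predT c0 + t * wprod (contract x y M) predT c1 =
  (t + t^-1) * (wprod M predT c0 + t * wprod M predT c1).
Proof.
move=> plM Ax Ay ne unm lxy adj c0x c0y c1x c1y ec.
have plM' := contract_planar pos_inj plM Ax Ay ne adj.
have [MK Mf Ms Mc] := plM; have inj := can_inj MK.
have [MK' Mf' _ _] := plM'.
have unm' := unm_sym plM unm; have Mn := unm_neq plM ne.
have Cx := contract_x M x y; have Cu := contract_u plM unm.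
have h1 := Mf x; have h2 := Mf y.
pose R := [pred a | [&& a != x, a != y, a != M x & a != M y]].
have split1 c : wprod M predT c = aw (lt x (M x)) (c x) (c (M x)) *
    (aw (lt y (M y)) (c y) (c (M y)) * wprod M R c).
  rewrite (@wprod_split _ _ c x) // (@wprod_split _ _ c y) //=; last first.
  - by rewrite unm' eq_sym.
  - by rewrite eq_sym ne eq_sym.
  congr (_ * (_ * _)); apply: eq_wprod => // a /=.
  by case: (a != x); case: (a != y); case: (a != M x).
have split2 c : wprod (contract x y M) predT c = aw true (c x) (c y) *
    (aw (lt (M x) (M y)) (c (M x)) (c (M y)) * wprod M R c).
  rewrite (@wprod_split _ _ c x) // Cx lxy.
  rewrite (@wprod_split _ _ c (M x)) ?Cu //=; last 2 first.
  - by rewrite h1 unm.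
  - by rewrite unm' h2.
  congr (_ * (_ * _)); apply: eq_wprod => // a /=.
    by case: (a != x); case: (a != y); case: (a != M x).
  case/andP=> /andP[ax ay] /andP[au av].
  by rewrite contract_other.
have er : wprod M R c1 = wprod M R c0.
  apply: eq_wprod => // a /and4P[ax ay au av].
  by rewrite !ec // (neqM plM).
rewrite !split1 !split2 er (negPf c0y) (negPf c1x) c0x c1y.
rewrite !(ec (M x)) ?(ec (M y)) //.
(* Planarity of the two arcs at [x] and [y] determines the orientation of the joined arc. *)
have E : lt (M x) (M y) = lt x (M x) (+) lt y (M y).
  have := Mc x y Ax Ay; rewrite eq_sym ne eq_sym unm => /(_ isT isT).
  rewrite /crossing lxy (ltC pos_inj (_ : y != M x)) 1?eq_sym //.
  rewrite -(adj (M x)) ?Ms // (adj (M y)) ?Ms //.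
  by case: (lt x (M x)); case: (lt y (M y)); case: (lt (M x) (M y)).
rewrite E.
rewrite -zigzag /aw /=; last first.
  apply/negP => /andP[lu lv]; have := E; rewrite lu (negPf lv) /= => l4.
  move: lu lv; rewrite (adj (M x)) ?Ms // => /ltn_trans /(_ l4) l5.
  by rewrite /plt l5.
set a1 := (if _ then _ else _); set a2 := (if _ then _ else _).
set a3 := (if _ then _ else _); set a4 := (if _ then _ else _).
by ring.
Qed.

End ArcWeights.

(** * Connected components of the glued graph under a contraction *)

Section GraphStep.
Variables (V : finType) (M : V -> V) (x y : V) (g g' : rel V).
Hypotheses (MK : involutive M) (Mf : forall v, M v != v) (ne : x != y).
Hypotheses (unm : M x != y).
Hypotheses (gs : symmetric g) (gs' : symmetric g').
Hypotheses (gx' : forall a, g' x a = false) (gy' : forall a, g' y a = false).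
Hypothesis gE : forall a b, g a b = [|| g' a b, (a == x) && (b == y) |
  (a == y) && (b == x)].

Let e : rel V := fun a b => (M a == b) || g a b.
Let e' : rel V := fun a b => (contract x y M a == b) || g' a b.
Let plM : planar (fun _ : V => 0%N) pred0 M.
Proof. by split. Qed.
Let Cx := contract_x M x y.
Let Cy := contract_y M ne.
Let Cu := contract_u plM unm.
Let Cv := contract_v plM ne unm.
Let unm' := unm_sym plM unm.
Let Mn := unm_neq plM ne.

Let e_sym : symmetric e.
Proof. by move=> a b; rewrite /e gs (can2_eq MK MK) eq_sym. Qed.

Let CK : involutive (contract x y M).
Proof.
move=> z; have [[]->|[h1 h2 h3 h4]] := contract_spec M x y z.
- by rewrite Cx Cy.
- by rewrite Cy Cx.
- by rewrite Cu Cv.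
- by rewrite Cv Cu.
rewrite [contract x y M z]contract_other //.
by rewrite contract_other ?MK // ?(inj_eq (can_inj MK)) // (neqM plM).
Qed.

Let e'_sym : symmetric e'.
Proof. by move=> a b; rewrite /e' gs' (can2_eq CK CK) eq_sym. Qed.

Let off := [pred a | (a != x) && (a != y)].

Let off_closed : closed e' off.
Proof.
apply: intro_closed; first exact: sym_connect_sym.
move=> a b eab; rewrite !inE => /andP[ax ay]; case/orP: eab => [/eqP<-|].
  have h1 := Mf x; have h2 := Mf y.
  have [[] E|[k1 k2 k3 k4]] := contract_spec M x y a.
  - by rewrite E eqxx in ax.
  - by rewrite E eqxx in ay.
  - by rewrite E Cu unm' h2.
  - by rewrite E Cv unm h1.
  by rewrite contract_other // !(neqM plM).
rewrite gs' => gba; apply/andP; split; apply: contraTneq gba => ->.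
  by rewrite gx'.
by rewrite gy'.
Qed.

(** A retraction onto the points other than [x] and [y]. It carries edges of the old graph to paths
    of the contracted one, which gives one inclusion in [connect_step]. *)
Let pr z := if z == x then M x else if z == y then M y else z.

Let pr_off z : z \in off -> pr z = z.
Proof. by rewrite inE /pr => /andP[/negPf-> /negPf->]. Qed.

Let connect_pr a b : connect e a b -> connect e' (pr a) (pr b).
Proof.
case/connectP => s; elim: s a => [|c s IHs] a /=; first by move=> _ ->; exact: connect0.
case/andP=> eac /IHs h /h {h}; apply: connect_trans.
have Muv : connect e' (M x) (M y) by apply: connect1; rewrite /e' Cu eqxx.
have Mvu : connect e' (M y) (M x) by apply: connect1; rewrite /e' Cv eqxx.
have px : pr x = M x by rewrite /pr eqxx.
have py : pr y = M y by rewrite /pr eqxx eq_sym (negPf ne).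
have pu : pr (M x) = M x by rewrite pr_off // inE Mf.
have pv : pr (M y) = M y by rewrite pr_off // inE Mf andbT.
case/orP: eac => [/eqP<-|].
  have [[]->|[h1 h2 h3 h4]] := contract_spec M x y a.
  - by rewrite pu px.
  - by rewrite pv py.
  - by rewrite MK pu px.
  - by rewrite MK pv py.
  apply: connect1; rewrite pr_off ?inE ?h1 // pr_off; last first.
    by rewrite inE !(neqM plM).
  by rewrite /e' contract_other ?eqxx.
rewrite gE => /or3P[gac|/andP[/eqP-> /eqP->]|/andP[/eqP-> /eqP->]].
- have oa : a \in off.
    by rewrite inE; apply/andP; split; apply: contraTneq gac => ->;
      rewrite ?gx' ?gy'.
  have oc : c \in off.
    by rewrite inE; apply/andP; split; apply: contraTneq gac => ->;
      rewrite gs' ?gx' ?gy'.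
  by rewrite !pr_off //; apply: connect1; rewrite /e' gac orbT.
- by rewrite px py.
- by rewrite px py.
Qed.

Let e_xy : connect e x y.
Proof. by apply: connect1; rewrite /e gE !eqxx /= !orbT. Qed.
Let e_xu : connect e x (M x). Proof. by apply: connect1; rewrite /e eqxx. Qed.
Let e_yv : connect e y (M y). Proof. by apply: connect1; rewrite /e eqxx. Qed.
Let cs : connect_sym e. Proof. exact: sym_connect_sym. Qed.
Let cs' : connect_sym e'. Proof. exact: sym_connect_sym. Qed.

Let e_yx : connect e y x. Proof. by rewrite cs. Qed.

Lemma connect_step a b : a \in off -> b \in off -> connect e a b = connect e' a b.
Proof.
move=> oa ob; apply/idP/idP => [/connect_pr|]; first by rewrite !pr_off.
move: a b {oa ob}; apply: connect_sub => a b /orP[/eqP<-|gab]; last first.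
  by apply: connect1; rewrite /e gE gab orbT.
have [[]->|[h1 h2 h3 h4]] := contract_spec M x y a.
- by rewrite Cx.
- by rewrite Cy cs.
- rewrite Cu; apply: connect_trans e_yv; apply: connect_trans e_xy.
  by rewrite cs.
- rewrite Cv; apply: connect_trans e_xu; apply: connect_trans e_yx.
  by rewrite cs.
by rewrite contract_other //; apply: connect1; rewrite /e eqxx.
Qed.

(* The contracted graph has one more closed component, namely {x, y}. *)
Lemma n_comp_step (A : pred V) : (forall a, A a -> a \in off) ->
  n_comp e' [pred v | [forall a, A a ==> ~~ connect e' a v]] =
  (n_comp e [pred v | [forall a, A a ==> ~~ connect e a v]]).+1.
Proof.
(* Both component counts are referred by [adjunction_n_comp] to the same relation [r] on the points
   other than [x] and [y]. *)
move=> Aoff; pose T := {z | z \in off}; pose h : T -> V := val.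
pose P' := [pred v | [forall a, A a ==> ~~ connect e' a v]].
pose P := [pred v | [forall a, A a ==> ~~ connect e a v]].
rewrite -/P -/P'.
pose r : rel T := fun a b => connect e (h a) (h b).
have r_sym : connect_sym r.
  by apply: sym_connect_sym => a b; rewrite /r cs.
have r_c a b : connect r a b = connect e (h a) (h b).
  apply/idP/idP => [/connectP[s]|?]; last exact: connect1.
  elim: s a => [|c s IHs] a /=; first by move=> _ ->; exact: connect0.
  by case/andP=> rac /IHs k /k; apply: connect_trans.
have adj1 : rel_adjunction h e r P.
  split=> [u _|a b _]; last exact: r_c.
  have [ou|] := boolP (u \in off); first by exists (Sub u ou); exact: connect0.
  rewrite inE negb_and !negbK => ou.
  have ox : M x \in off by rewrite inE Mf.
  exists (Sub (M x) ox); case: (eqVneq u x) ou => [->|_] //= /eqP->.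
  exact: connect_trans e_yx e_xu.
pose P1 := [pred v | (v \in P') && (v \in off)].
have adj2 : rel_adjunction h e' r P1.
  split=> [u /andP[_ ou]|a b _]; first by exists (Sub u ou); exact: connect0.
  by rewrite r_c connect_step ?(valP a, valP b).
have clP (f : rel V) : connect_sym f ->
   closed f [pred v | [forall a, A a ==> ~~ connect f a v]].
  move=> fs; apply: intro_closed => // a b fab; rewrite !inE => /forallP hP.
  apply/forallP => z; apply/implyP => Az; have := hP z; rewrite Az /=.
  by apply: contra => /connect_trans; apply; rewrite fs connect1.
have clP1 : closed e' P1.
  move=> a b eab; rewrite !inE; congr (_ && _); last exact: off_closed.
  exact: (clP e' cs').
have E1 : n_comp e P = n_comp e' P1.
  rewrite (adjunction_n_comp h cs r_sym _ adj1) //; last exact: clP.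
  rewrite (adjunction_n_comp h cs' r_sym _ adj2) //.
  apply: eq_n_comp_r => a; have oa : h a \in off := valP a.
  rewrite !inE [_ && (h a \in off)]andbC oa /=; apply: eq_forallb => z.
  by case Az: (A z) => //=; rewrite (connect_step (Aoff _ Az) oa).
have Ex : connect e' x =i [pred v | v \notin off].
  move=> v; apply/idP/idP => [|].
    by rewrite inE -topredE /= => /(closed_connect off_closed) <-; rewrite inE eqxx.
  rewrite !inE negb_and !negbK => /orP[]/eqP->; first exact: connect0.
  by apply: connect1; rewrite /e' Cx eqxx.
have E2 : n_comp e' P' = (n_comp e' (connect e' x) + n_comp e' P1)%N.
  rewrite /n_comp_mem addnC -(cardID off); congr (_ + _)%N; apply: eq_card => v.
    by rewrite !inE -!andbA.
  have -> : (v \in predI (roots e') (mem (connect e' x))) =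
    roots e' v && (v \notin off) by rewrite inE /= Ex.
  have -> : (v \in [predD predI (roots e') (mem P') & off]) =
    (v \notin off) && (roots e' v && (v \in P')) by rewrite inE.
  have [|oxy] := boolP (v \in off); rewrite ?andbF //=.
  suff -> : v \in P' by [].
  rewrite inE; apply/forallP => a; apply/implyP => /Aoff oa.
  by apply: contra oxy => /(closed_connect off_closed) <-.
by rewrite E2 n_comp_connect // E1.
Qed.

End GraphStep.

(** * Diagrams as planar matchings of the boundary circle *)

Lemma tl_pos_inj n : injective (@tl_pos n).
Proof.
move=> [j|j] [k|k] /= e; have hj := ltn_ord j; have hk := ltn_ord k;
  try (by exfalso; lia); congr (_ _); apply: val_inj => /=; lia.
Qed.

Lemma tl_pos_lt n (x : tl_pt n) : (tl_pos x < 2 * n)%N.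
Proof. by case: x => j /=; have hj := ltn_ord j; lia. Qed.

Lemma tl_pos_surj n m : (m < 2 * n)%N -> exists x : tl_pt n, tl_pos x = m.
Proof.
move=> hm; have [h|h] := ltnP m n; first by exists (inl (Ordinal h)).
have h' : ((2 * n).-1 - m < n)%N by lia.
by exists (inr (Ordinal h')) => /=; lia.
Qed.

Definition tl_planar n (M : tl_pt n -> tl_pt n) := planar (@tl_pos n) predT M.

Lemma diagram_planar n (D : tl_diagram n) : tl_planar D.
Proof.
have /andP[/forallP h1 /forallP h2] := valP D.
have DK : involutive D by move=> x; have /andP[_ /eqP] := h1 x.
split=> // [x|a b _ _ ab ba]; first by have /andP[] := h1 x.
have nc x y : ~~ [&& (tl_pos x < tl_pos y)%N,
     (tl_pos y < tl_pos (D x))%N & (tl_pos (D x) < tl_pos (D y))%N].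
  by have /forallP := h2 x; apply.
have ne (x y : tl_pt n) : x != y -> tl_pos x != tl_pos y.
  by apply: contra => /eqP /tl_pos_inj ->.
have := ne _ _ ab; have := ne _ _ ba.
have := ne (D b) (D a); rewrite (inj_eq (can_inj DK)) => /(_ ab).
have := ne (D b) a; rewrite (can2_eq DK DK) => /(_ ba).
have := nc a b; have := nc (D a) b; have := nc a (D b); have := nc (D a) (D b).
have := nc b a; have := nc (D b) a; have := nc b (D a); have := nc (D b) (D a).
rewrite /crossing /plt !DK.
move: (tl_pos a) (tl_pos b) (tl_pos (D a)) (tl_pos (D b)) => A B A' B'.
by case: ltngtP => // ?; case: ltngtP => // ?; case: ltngtP => // ?;
  case: ltngtP => //= ?; case: ltngtP => //= ?; case: ltngtP => //= ?; lia.
Qed.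

Lemma planar_noncrossing n (M : tl_pt n -> tl_pt n) : tl_planar M ->
  noncrossing_matching [ffun x => M x].
Proof.
case=> MK Mf _ Mc; apply/andP; split; apply/forallP => x.
  by rewrite !ffunE Mf MK eqxx.
apply/forallP => y; rewrite !ffunE; apply/negP => /and3P[h1 h2 h3].
have yx : y != x by apply: contraTneq h1 => ->; rewrite ltnn.
have yMx : y != M x by apply: contraTneq h2 => ->; rewrite ltnn.
have := Mc x y isT isT yx yMx; rewrite /crossing /plt h1 h3.
by rewrite (ltn_trans h1 (ltn_trans h2 h3)) ltnNge (ltnW h2).
Qed.

Lemma big_pairs (R : Type) (idx : R) (op : Monoid.com_law idx) (V : finType)
    (pos : V -> nat) M (f : V -> R) :
  injective pos -> involutive M -> (forall v, M v != v) ->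
  \big[op/idx]_v f v = \big[op/idx]_(v | plt pos v (M v)) op (f v) (f (M v)).
Proof.
move=> pi MK Mf; rewrite (bigID (fun v => plt pos v (M v))) big_split /=.
congr (op _ _); rewrite (reindex_inj (can_inj MK)); apply: eq_bigl => v.
by rewrite MK (ltC pi (Mf v)).
Qed.

Lemma even_stable (V : finType) (pos : V -> nat) M (B : {set V}) :
  injective pos -> involutive M -> (forall v, M v != v) ->
  (forall v, (M v \in B) = (v \in B)) -> ~~ odd #|B|.
Proof.
move=> pi MK Mf MB; rewrite -(cardsID [set v | plt pos v (M v)] B).
set B1 := _ :&: _; set B2 := _ :\: _; suff -> : B2 = M @^-1: B1.
  by rewrite on_card_preimset ?addnn ?odd_double //; apply: onW_bij; exists M.
apply/setP => v; rewrite !inE MB MK andbC; congr (_ && _).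
by rewrite (ltC pi (Mf v)) negbK.
Qed.

(** The points strictly between two matched points are matched among themselves, hence even in
    number. This lets the signs [(-1)^j] be moved from arcs to single letters. *)
Lemma tl_parity n (M : tl_pt n -> tl_pt n) x : tl_planar M ->
  odd (tl_pos (M x)) = ~~ odd (tl_pos x).
Proof.
move=> plM; have [MK Mf _ Mc] := plM; have pi := @tl_pos_inj n.
wlog h : x / plt (@tl_pos n) x (M x).
  move=> W; have [/W //|h] := boolP (plt (@tl_pos n) x (M x)).
  have := W (M x); rewrite MK (ltC pi (_ : x != M x)) 1?eq_sym //.
  by move=> /(_ h) ->; rewrite negbK.
pose B := [set b | plt (@tl_pos n) x b && plt (@tl_pos n) b (M x)].
have eB : ~~ odd #|B|.
  apply: (even_stable pi MK Mf) => v; rewrite !inE.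
  have [->|vx] := eqVneq v x; first by rewrite /plt !ltnn andbF.
  have [->|vMx] := eqVneq v (M x); first by rewrite MK /plt !ltnn andbF.
  have := Mc x v isT isT vx vMx; rewrite /crossing.
  rewrite (ltC pi (_ : M v != M x)) ?(inj_eq (can_inj MK)) //.
  rewrite (ltC pi vMx); move: h vx vMx; rewrite /plt.
  case: (ltnP _ (tl_pos v)); case: (ltnP (tl_pos v)); case: (ltnP _ (tl_pos (M v)));
  case: (ltnP (tl_pos (M v))) => //= *; exfalso; lia.
have cB : #|B| = (tl_pos (M x) - (tl_pos x).+1)%N.
  rewrite -[RHS](size_iota (tl_pos x).+1) cardE -(size_map (@tl_pos n)).
  apply: perm_size; apply: uniq_perm; rewrite ?iota_uniq //.
    by rewrite map_inj_uniq ?enum_uniq //; exact: tl_pos_inj.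
  move=> m; rewrite mem_iota; apply/mapP/idP => [[b]|hm].
    by rewrite mem_enum inE /plt => /andP[h1 h2] ->; lia.
  have mx := tl_pos_lt (M x).
  have [|b bm] := @tl_pos_surj n m; first by move: h; rewrite /plt; lia.
  by exists b => //; rewrite mem_enum inE /plt bm; lia.
by move: eB h; rewrite cB /plt; lia.
Qed.

(** * Matrix entries as products over arcs *)

Section Gauge.
Variables (F : fieldType) (t : F) (n : nat).
Hypothesis t0 : t != 0.
Implicit Types w : 'I_n -> bool.

(** Input letters are negated, so that through strands also join opposite bits and can have the
    weight [kap]. *)
Definition bit w' w (x : tl_pt n) : bool :=
  match x with inl j => w' j | inr j => ~~ w j end.

Definition sgn w : F := \prod_(j < n) (if w j then (-1) ^+ j else 1).
Definition tpw w : F := \prod_(j < n) (if w j then t else 1).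

Lemma sgnK w : sgn w * sgn w = 1.
Proof.
rewrite -big_split big1 //= => j _; case: (w j); rewrite ?mulr1 //.
by rewrite -expr2 sqrr_sign.
Qed.

(** Diagonal factors make all arcs alike: by [tl_parity] the sign of an arc can be carried by its
    ends with letter [true], and [tpw] on the inputs absorbs the remaining powers of [t]. *)
Lemma tl_coefE (D : tl_diagram n) (w' w : n.-tuple bool) :
  tl_coef t D w' w = sgn (tnth w') * sgn (tnth w) * tpw (tnth w) *
    wprod t (@tl_pos n) D predT (bit (tnth w') (tnth w)).
Proof.
have plD := diagram_planar D; have [DK Df _ _] := plD.
have pi := @tl_pos_inj n.
pose g (x : tl_pt n) : F := match x with
  | inl j => if tnth w' j then (-1) ^+ j else 1
  | inr j => (if tnth w j then (-1) ^+ j else 1) * (if tnth w j then t else 1)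
  end.
have -> : sgn (tnth w') * sgn (tnth w) * tpw (tnth w) = \prod_x g x.
  by rewrite big_sumType /= big_split mulrA.
rewrite (big_pairs _ g pi DK Df) /wprod -big_split /= /tl_coef.
rewrite (big_pairs _ _ pi DK Df) /=; apply: eq_bigr => x hx.
have := DK x; have := tl_parity x plD; move: hx; rewrite /plt.
case: x => j; [case: (D (inl j)) | case: (D (inr j))] => k /= hx hp DD;
  have hj := ltn_ord j; have hk := ltn_ord k; rewrite ?DD.
- rewrite hx ltnNge (ltnW hx) /= mulr1.
  have E : (-1) ^+ k = - (-1) ^+ j :> F.
    by rewrite -(signr_odd _ k) -(signr_odd _ j) hp; case: (odd j); rewrite /= ?opprK.
  case: (tnth w' j); case: (tnth w' k); rewrite /= ?E; ring.
- have E : (-1) ^+ k = (-1) ^+ j :> F.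
    rewrite -(signr_odd _ k) -(signr_odd _ j); congr (_ ^+ _); congr nat_of_bool.
    by move: hp; lia.
  have E2 : (-1) ^+ j * (-1) ^+ j = 1 :> F by rewrite -expr2 sqrr_sign.
  case: (tnth w' j); case: (tnth w k); rewrite /= ?E; try ring.
  by rewrite mulr1 mulrA E2 mul1r mulfV.
- by exfalso; lia.
- have hx' : (k < j)%N by lia.
  have E : (-1) ^+ j = - (-1) ^+ k :> F.
    rewrite -(signr_odd _ k) -(signr_odd _ j).
    have -> : odd j = ~~ odd k by lia.
    by case: (odd k); rewrite /= ?opprK.
  rewrite hx' ltnNge (ltnW hx') /= mul1r.
  case: (tnth w j); case: (tnth w k); rewrite /= ?E; try ring.
  by field.
Qed.

End Gauge.

(** * Stacking two diagrams *)

Section Gluing.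
Variables (F : fieldType) (t : F) (n : nat).
Hypothesis t0 : t != 0.
Hypothesis d0 : t + t^-1 != 0.
Variables D1 D2 : tl_diagram n.
Local Notation V := (tl_pt n + tl_pt n)%type.
Let delta := t + t^-1.

(* D1 and D2 are placed side by side on a line: the inputs of D1 come in
   decreasing order just before the outputs of D2, so that the points to be
   glued are contracted one pair at a time from the middle outwards. *)
Let gpos (v : V) : nat :=
  match v with inl x => tl_pos x | inr x => (2 * n + tl_pos x)%N end.
Let gx (k : 'I_n) : V := inl (inr k).
Let gy (k : 'I_n) : V := inr (inl k).
Let M0 (v : V) : V := match v with inl x => inl (D1 x) | inr x => inr (D2 x) end.
(** The points not yet contracted after [k] steps; for [k = n] these are the outer points. *)
Let act (k : nat) (v : V) : bool :=
  match v with inl (inr j) | inr (inl j) => (k <= j)%N | _ => true end.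
Let glue (k : nat) : rel V := fun u v =>
  match u, v with
  | inl (inr j), inr (inl l) => (j == l) && (k <= j)%N
  | inr (inl j), inl (inr l) => (j == l) && (k <= j)%N
  | _, _ => false
  end.
Let edge k (M : V -> V) : rel V := fun u v => (M u == v) || glue k u v.
Let closedc (e : rel V) := [pred v | [forall a, act n a ==> ~~ connect e a v]].

Let gcol (w' w m : 'I_n -> bool) (v : V) : bool :=
  match v with inl x => bit w' m x | inr x => bit m w x end.

(** The middle word is summed with the weight [tpw] that [tl_coefE] puts on the inputs of [D1], so
    for [M0] this is the product of the two matrices up to gauge. *)
Let Z (M : V -> V) w' w : F :=
  \sum_(m : {ffun 'I_n -> bool}) tpw t m * wprod t gpos M predT (gcol w' w m).

Let gpos_inj : injective gpos.
Proof.
move=> [x|x] [y|y] /= e.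
- by congr inl; apply: tl_pos_inj.
- by have := tl_pos_lt x; lia.
- by have := tl_pos_lt y; lia.
- by congr inr; apply: tl_pos_inj; lia.
Qed.

Let gx_inj : injective gx. Proof. by move=> i j []. Qed.
Let gy_inj : injective gy. Proof. by move=> i j []. Qed.

Let planar0 : planar gpos (act 0) M0.
Proof.
have [K1 f1 _ c1] := diagram_planar D1; have [K2 f2 _ c2] := diagram_planar D2.
split=> [[x|x]|[x|x]|v|] /=; rewrite ?K1 ?K2 //.
- exact: f1.
- exact: f2.
- by case: v => -[x|x] /=; [case: (D1 _) | case: (D1 _) | case: (D2 _) | case: (D2 _)].
move=> [x|x] [y|y] _ _ /= n1 n2.
- exact: c1.
- have X (a b : tl_pt n) : plt gpos (inl a) (inr b).
    by rewrite /plt /=; have := tl_pos_lt a; lia.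
  by rewrite /crossing !X.
- have X (a b : tl_pt n) : plt gpos (inr a) (inl b) = false.
    by rewrite /plt /=; have := tl_pos_lt b; lia.
  by rewrite /crossing !X.
- have X (a b : tl_pt n) : plt gpos (inr a) (inr b) = plt (@tl_pos n) a b.
    by rewrite /plt /= ltn_add2l.
  by rewrite /crossing !X; apply: c2.
Qed.

Let actS k (hk : (k < n)%N) v :
  act k.+1 v = [&& act k v, v != gx (Ordinal hk) & v != gy (Ordinal hk)].
Proof.
have ne (j : 'I_n) : (j != Ordinal hk) = (j != k :> nat) by [].
by case: v => -[j|j] //=; rewrite /gx /gy /eq_op /= -?/(eq_op _ _) ?andbT;
  rewrite -[in RHS]ne ?ne ltn_neqAle eq_sym andbC.
Qed.

Let adj k (hk : (k < n)%N) v : act k v -> v != gx (Ordinal hk) ->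
  v != gy (Ordinal hk) -> plt gpos (gx (Ordinal hk)) v = plt gpos (gy (Ordinal hk)) v.
Proof.
move=> a1 n1 n2; have : act k.+1 v by rewrite actS a1 n1 n2.
case: v {a1 n1 n2} => -[j|j] /= hj; rewrite /plt /=; have := ltn_ord j; lia.
Qed.

Lemma split_sum (V' : nmodType) (f : {ffun 'I_n -> bool} -> V') k :
  \sum_m f m = \sum_(m : {ffun 'I_n -> bool} | ~~ m k)
    (f m + f [ffun j => (j == k) || m j]).
Proof.
rewrite (bigID (fun m : {ffun 'I_n -> bool} => m k)) /= addrC big_split /=.
congr (_ + _).
rewrite (reindex_onto (fun m : {ffun 'I_n -> bool} => [ffun j => (j == k) || m j])
  (fun m : {ffun 'I_n -> bool} => [ffun j => (j != k) && m j])) /=; last first.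
  by move=> m mk; apply/ffunP => j; rewrite !ffunE; case: eqVneq => [->|].
apply: eq_bigl => m; rewrite ffunE eqxx /=.
apply/eqP/idP => [<-|mk]; first by rewrite ffunE eqxx.
by apply/ffunP => j; rewrite !ffunE; case: eqVneq => [->|] //=; rewrite (negPf mk).
Qed.

(** The factor [delta] is the value of the loop left behind at the contracted pair. *)
Let Z_step k (hk : (k < n)%N) M w' w : planar gpos (act k) M ->
  M (gx (Ordinal hk)) != gy (Ordinal hk) ->
  Z (contract (gx (Ordinal hk)) (gy (Ordinal hk)) M) w' w = delta * Z M w' w.
Proof.
move=> plM unm; set kk := Ordinal hk in unm *.
rewrite /Z !(split_sum _ kk) mulr_sumr; apply: eq_bigr => m mk.
set m1 : {ffun _} := [ffun j => _].
have m1k : m1 kk by rewrite ffunE eqxx.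
have m1j j : j != kk -> m1 j = m j by rewrite ffunE => /negPf->.
have -> : tpw t m1 = t * tpw t m.
  rewrite /tpw (bigD1 kk) //= m1k [in RHS](bigD1 kk) //= (negPf mk) mul1r.
  by congr (_ * _); apply: eq_bigr => j /m1j ->.
have := @wprod_contract F t t0 V gpos gpos_inj (act k) M (gx kk) (gy kk)
  (gcol w' w m) (gcol w' w m1) plM.
move=> /(_ (leqnn _) (leqnn _) isT unm); rewrite /= mk m1k /=.
move=> H; rewrite -!mulrA ![tpw t m * _]mulrC mulrA -mulrDl H ?mulrDl.
- by rewrite -/delta; ring.
- by rewrite /plt /=; lia.
- exact: adj.
- by [].
- by [].
- by [].
- by [].
case=> -[j|j] //= ne1 ne2; rewrite m1j //; apply: contra ne1 => /eqP-> //.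
Qed.

Let outer_closedE : tl_loops D1 D2 = n_comp (edge 0 M0) (closedc (edge 0 M0)).
Proof.
rewrite /tl_loops; have E : tl_glue D1 D2 =2 edge 0 M0.
  by case=> -[x|x] [[y|y]|[y|y]]; rewrite /tl_glue /edge /= ?andbT ?orbF.
have Ec := eq_connect E; rewrite (eq_n_comp Ec); apply: eq_n_comp_r => v.
rewrite !inE; apply/forallP/forallP => h.
  case=> -[j|j] /=; rewrite ?implyTb.
  - by have := h (inl j); rewrite Ec.
  - by rewrite leqNgt ltn_ord.
  - by rewrite leqNgt ltn_ord.
  - by have := h (inr j); rewrite Ec.
move=> [j|j]; rewrite Ec; first exact: (h (inl (inl j))).
exact: (h (inr (inr j))).
Qed.

Let glue_sym k : symmetric (glue k).
Proof.
by case=> -[i|i] [[j|j]|[j|j]] //=; rewrite eq_sym; case: eqP => // ->.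
Qed.

Let glueS k (hk : (k < n)%N) u v : glue k u v =
  [|| glue k.+1 u v, (u == gx (Ordinal hk)) && (v == gy (Ordinal hk))
   | (u == gy (Ordinal hk)) && (v == gx (Ordinal hk))].
Proof.
have E (i j : nat) : (i == j) && (k <= i)%N =
    (i == j) && (k < i)%N || (i == k) && (j == k) by lia.
case: u v => -[i|i] [[j|j]|[j|j]] //; rewrite /= ?andbF //.
- by rewrite orbF; exact: E i j.
- exact: E i j.
Qed.

Let closed_off k (hk : (k < n)%N) v : act n v ->
  v \in [pred a | (a != gx (Ordinal hk)) && (a != gy (Ordinal hk))].
Proof.
by case: v => -[j|j] //= h; have := ltn_ord j; rewrite ltnNge h.
Qed.

(** [U] counts the contractions that joined two different arcs: each multiplies [Z] by [delta] and
    leaves one more closed component. A pair that is already matched is a loop of the original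
    graph, and nothing changes. *)
Let contraction k : (k <= n)%N -> exists M U,
  [/\ planar gpos (act k) M, forall j : 'I_n, (j < k)%N -> M (gx j) = gy j,
      forall w' w, Z M w' w = delta ^+ U * Z M0 w' w,
      n_comp (edge k M) (closedc (edge k M)) = (U + tl_loops D1 D2)%N &
      forall a b, act n a -> act n b ->
        connect (edge k M) a b = connect (edge 0 M0) a b].
Proof.
elim: k => [|k IHk] hk.
  by exists M0, 0%N; split=> // w' w; rewrite expr0 mul1r.
have [M [U [plM Mg hZ hn hc]]] := IHk (ltnW hk).
set kk := Ordinal hk; have [MK Mf _ _] := plM.
have plM' : planar gpos (act k.+1) (contract (gx kk) (gy kk) M).
  have := @contract_planar V gpos gpos_inj (act k) M (gx kk) (gy kk) plM
    (leqnn k) (leqnn k) isT (@adj k hk).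
  case=> a1 a2 a3 a4; split=> // [v|a b Aa Ab].
    by rewrite !actS; apply: a3.
  by apply: a4; rewrite -/(is_true _) /= -actS.
have Mg' (j : 'I_n) : (j < k.+1)%N -> contract (gx kk) (gy kk) M (gx j) = gy j.
  move=> hj; have [->|ne] := eqVneq j kk; first by rewrite contract_x.
  have hjk : (j < k)%N.
    by rewrite ltn_neqAle -ltnS hj andbT; apply: contra ne => /eqP e; apply/eqP/val_inj.
  have e := Mg j hjk; rewrite contract_other ?e //.
  - by rewrite eq_sym (neqM plM) // e.
  - by rewrite eq_sym (neqM plM) // e (inj_eq gy_inj) eq_sym.
have [mat|unm] := eqVneq (M (gx kk)) (gy kk).
  have E := contract_matched plM mat.
  have My : M (gy kk) = gx kk by rewrite -mat MK.
  have Ee : edge k.+1 M =2 edge k M.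
    move=> u v; rewrite /edge (glueS hk); case g: (glue k.+1 u v); rewrite ?orbT //=.
    case: (eqVneq u (gx kk)) => [->|_] /=.
      by rewrite mat eq_sym orbF; case: (v == gy kk).
    case: (eqVneq u (gy kk)) => [->|_] /=; last by rewrite orbF.
    by rewrite My eq_sym; case: (v == gx kk).
  have Ec := eq_connect Ee.
  exists M, U; split=> //.
  - case: plM' => a1 a2 a3 a4; split=> // [v|a b Aa Ab n1 n2].
      by rewrite -E.
    by have := a4 a b Aa Ab; rewrite !E; apply.
  - by move=> j /Mg'; rewrite E.
  - rewrite -hn (eq_n_comp Ec); apply: eq_n_comp_r => v; rewrite !inE.
    by apply: eq_forallb => a; rewrite Ec.
  - by move=> a b ha hb; rewrite Ec hc.
have step := @connect_step V M (gx kk) (gy kk) (glue k) (glue k.+1) MK Mf isT unm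
  (glue_sym k) (glue_sym k.+1).
have hgx a : glue k.+1 (gx kk) a = false by case: a => -[j|j] //=; rewrite ltnn andbF.
have hgy a : glue k.+1 (gy kk) a = false by case: a => -[j|j] //=; rewrite ltnn andbF.
have {}step := step hgx hgy (@glueS k hk).
have nstep := @n_comp_step V M (gx kk) (gy kk) (glue k) (glue k.+1) MK Mf isT unm
  (glue_sym k) (glue_sym k.+1) hgx hgy (@glueS k hk) (act n) (@closed_off k hk).
exists (contract (gx kk) (gy kk) M), U.+1; split=> //.
- by move=> w' w; rewrite Z_step // hZ exprS mulrA.
- by rewrite [LHS]nstep addSn -hn.
- by move=> a b ha hb; rewrite -hc //; apply/esym/step; apply: closed_off.
Qed.

Let back (v : V) : tl_pt n := match v with inl x | inr x => x end.
Let outerK v : act n v -> tl_outer (back v) = v.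
Proof. by case: v => -[j|j] //= h; have := ltn_ord j; rewrite ltnNge h. Qed.
Let act_outer x : act n (tl_outer x). Proof. by case: x. Qed.

Lemma tl_composition : exists D : tl_diagram n,
  (forall x y, tl_comp_rel D1 D2 x y = (y == D x)) /\
  forall w' w : 'I_n -> bool,
    \sum_(m : {ffun 'I_n -> bool}) tpw t m *
       (wprod t (@tl_pos n) D1 predT (bit w' m) *
        wprod t (@tl_pos n) D2 predT (bit m w)) =
    delta ^+ tl_loops D1 D2 * wprod t (@tl_pos n) D predT (bit w' w).
Proof.
have [M [U [plM Mg hZ hn hc]]] := contraction (leqnn n).
have [MK Mf Ms Mc] := plM.
pose d x := back (M (tl_outer x)).
have dE x : tl_outer (d x) = M (tl_outer x) by rewrite outerK // Ms act_outer.
have outI : injective (@tl_outer n) by move=> [x|x] [y|y] //= [->].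
have ltO x y : plt gpos (tl_outer x) (tl_outer y) = plt (@tl_pos n) x y.
  by case: x y => j [] l; rewrite /plt /=; have := ltn_ord j; have := ltn_ord l; lia.
have pld : tl_planar d.
  split=> // [x|x|a b _ _ n1 n2].
  - by apply: outI; rewrite !dE MK.
  - by apply: contra (Mf (tl_outer x)) => /eqP e; rewrite -dE e.
  have := Mc _ _ (act_outer a) (act_outer b); rewrite (inj_eq outI) -dE (inj_eq outI).
  by rewrite /crossing -!dE !ltO; apply.
pose D := TLDiagram (planar_noncrossing pld).
have DE x : D x = d x by rewrite /D /= ffunE.
have conn a b : connect (edge n M) a b = (b == a) || (b == M a).
  have gl u v : glue n u v = false.
    by case: u v => -[i|i] [[j|j]|[j|j]] //=; rewrite leqNgt ltn_ord andbF.
  apply/idP/idP => [/connectP[s]|/orP[]/eqP->]; last 2 first.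
  - exact: connect0.
  - by apply: connect1; rewrite /edge eqxx.
  elim: s a => [|c s IHs] a /=; first by move=> _ ->; rewrite eqxx.
  rewrite {1}/edge gl orbF => /andP[/eqP <- hp] hb.
  by have := IHs _ hp hb; rewrite MK orbC.
exists D; split=> [x y|w' w].
  have E : tl_glue D1 D2 =2 edge 0 M0.
    by case=> -[z|z] [[u|u]|[u|u]]; rewrite /tl_glue /edge /= ?andbT ?orbF.
  rewrite /tl_comp_rel (eq_connect E) -hc // conn !(inj_eq outI) -dE (inj_eq outI) DE.
  rewrite [y == x]eq_sym; case: eqVneq => //= <-; apply/esym/negP => /eqP e.
  by have := planar_fpf pld x; rewrite -e eqxx.
have Z0 : Z M0 w' w = \sum_(m : {ffun 'I_n -> bool}) tpw t m *
       (wprod t (@tl_pos n) D1 predT (bit w' m) *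
        wprod t (@tl_pos n) D2 predT (bit m w)).
  apply: eq_bigr => m _; congr (_ * _); rewrite /wprod /= big_sumType /=.
  congr (_ * _); apply: eq_bigl => a //.
  by rewrite /plt /= ltn_add2l.
have My (j : 'I_n) : M (gy j) = gx j by rewrite -Mg // MK.
(* All glued pairs are now loops, each summing to [t + t^-1], and they factor out of the weight of
   the outer diagram. *)
have Zn : Z M w' w = delta ^+ n * wprod t (@tl_pos n) D predT (bit w' w).
  have W m : wprod t gpos M predT (gcol w' w m) =
      (\prod_(j < n) kap t (~~ m j) (m j)) * wprod t (@tl_pos n) D predT (bit w' w).
    rewrite /wprod /= !big_sumType /=.
    have e1 (j : 'I_n) : plt gpos (inl (inr j)) (M (inl (inr j))).
      by rewrite -/(gx j) Mg // /plt /=; have := ltn_ord j; lia.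
    have e2 (j : 'I_n) : plt gpos (inr (inl j)) (M (inr (inl j))) = false.
      by rewrite -/(gy j) My // /plt /=; have := ltn_ord j; lia.
    rewrite [X in _ * (X * _)]big_pred0; last exact: e2.
    rewrite mul1r [X in (_ * X) * _](eq_big xpredT (fun j => kap t (~~ m j) (m j))) //;
      last by move=> j _; rewrite -/(gx j) Mg.
    rewrite mulrAC mulrC; congr (_ * (_ * _)); apply: eq_big => j.
    - by rewrite -[inl (inl j)]/(tl_outer (inl j)) -dE -DE ltO.
    - by move=> _; rewrite -[inl (inl j)]/(tl_outer (inl j)) -dE -DE; case: (D _).
    - by rewrite -[inr (inr j)]/(tl_outer (inr j)) -dE -DE ltO.
    - by move=> _; rewrite -[inr (inr j)]/(tl_outer (inr j)) -dE -DE; case: (D _).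
  rewrite /Z; under eq_bigr => m _ do rewrite W mulrA.
  rewrite -mulr_suml; congr (_ * _).
  under eq_bigr => m _ do rewrite /tpw -big_split /=.
  rewrite -(bigA_distr_bigA (fun (j : 'I_n) b => (if b then t else 1) * kap t (~~ b) b)) /=.
  rewrite (eq_bigr (fun _ => delta)); first by rewrite prodr_const card_ord.
  by move=> j _; rewrite big_bool /= mulr1 mul1r.
(* The closed components of the final graph are the [n] loops at the glued pairs, so the stacked
   diagrams have [n - U] loops; dividing by [delta ^+ U] then gives the claim. *)
have nU : n = (U + tl_loops D1 D2)%N.
  rewrite -hn; pose r : rel 'I_n := fun i j => i == j.
  have rc i j : connect r i j = (i == j).
    apply/idP/eqP => [/connectP[s]|->]; last exact: connect0.
    by elim: s i => [|c s IHs] i /=; [move=> _ -> | case/andP=> /eqP <-; apply: IHs].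
  have rs : connect_sym r by move=> i j; rewrite !rc eq_sym.
  have es : connect_sym (edge n M).
    move=> a b; rewrite !conn eq_sym; congr (_ || _).
    by rewrite [RHS]eq_sym (can2_eq MK MK).
  have cl v : (v \in closedc (edge n M)) = ~~ act n v.
    rewrite inE; apply/forallP/idP => [h|h a].
      by apply: contraT; rewrite negbK => av; have := h v; rewrite av connect0.
    apply/implyP => aa; rewrite conn; apply: contra h => /orP[]/eqP-> //.
    by rewrite Ms.
  have adjn : rel_adjunction gx (edge n M) r (closedc (edge n M)).
    split=> [u|i j _]; last first.
      by rewrite rc conn; apply/eqP/orP => [->|[/eqP[->]|]] //;
        [left; rewrite eqxx | rewrite Mg].
    rewrite -/(mem _ u) cl; case: u => -[j|j] //= _; exists j; rewrite conn ?eqxx //.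
    by rewrite -[inr _]/(gy j) My eqxx orbT.
  have clc : closed (edge n M) (closedc (edge n M)).
    move=> a b eab; rewrite !cl; congr (~~ _).
    by have := connect1 eab; rewrite conn => /orP[]/eqP->; rewrite ?Ms.
  rewrite (adjunction_n_comp gx es rs clc adjn) /n_comp_mem.
  rewrite -[LHS]card_ord; apply: eq_card => j; rewrite !inE /=.
  have -> : roots r j.
    by rewrite /roots /=; have := connect_root r j; rewrite rc => /eqP <-.
  have := cl (gx j); rewrite inE /= => ->.
  by rewrite /= leqNgt ltn_ord.
have := hZ w' w; rewrite Zn {1}nU exprD -mulrA => H.
by rewrite -Z0; apply: (mulfI (expf_neq0 U d0)); rewrite -H.
Qed.

End Gluing.

(** * Arcs of diagrams *)

Section PlanarArcs.
Variables (n : nat).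
Implicit Types (M : tl_pt n -> tl_pt n) (x y : tl_pt n).

Definition out x : bool := if x is inl _ then true else false.
Definition flip x : tl_pt n := match x with inl j => inr j | inr j => inl j end.

Lemma flipK : involutive flip. Proof. by case. Qed.

Lemma flip_planar M : tl_planar M -> tl_planar (flip \o M \o flip).
Proof.
case=> MK Mf _ Mc; have pi := @tl_pos_inj n; have fi := can_inj flipK.
have ltf x y : x != y -> plt (@tl_pos n) (flip x) (flip y) = ~~ plt (@tl_pos n) x y.
  move=> ne; rewrite -(ltC pi ne) /plt.
  by case: x y {ne} => i [] j /=; have := ltn_ord i; have := ltn_ord j; lia.
split=> // [x|x|a b _ _ n1 n2] /=.
- by rewrite flipK MK flipK.
- by rewrite -(inj_eq fi) flipK.
have E x : flip x = x -> False by case: x.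
have [a' aE] : exists a', a = flip a' by exists (flip a); rewrite flipK.
have [b' bE] : exists b', b = flip b' by exists (flip b); rewrite flipK.
move: n1 n2; rewrite aE bE /= !flipK !(inj_eq fi) => n1 n2.
have := Mc a' b' isT isT n1 n2; rewrite /crossing.
have m1 : a' != M b' by rewrite eq_sym -(inj_eq (can_inj MK)) MK.
have m2 : M a' != M b' by rewrite (inj_eq (can_inj MK)) eq_sym.
rewrite eq_sym in n1; rewrite eq_sym in n2.
rewrite (ltf _ _ n1) (ltf _ _ n2) (ltf _ _ m1) (ltf _ _ m2).
by case: (plt _ _ _); case: (plt _ _ _); case: (plt _ _ _); case: (plt _ _ _).
Qed.

(** Unless the arc already joins neighbours, planarity forces the point next to [x] to open a
    shorter arc underneath it. *)
Lemma inner_arc M x : tl_planar M -> (tl_pos x < tl_pos (M x))%N ->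
  exists y, [/\ (tl_pos x <= tl_pos y)%N, tl_pos (M y) = (tl_pos y).+1
    & (tl_pos (M y) <= tl_pos (M x))%N].
Proof.
move=> plM; have [MK Mf _ Mc] := plM; have pi := @tl_pos_inj n.
move: {2}(tl_pos (M x) - tl_pos x)%N (leqnn (tl_pos (M x) - tl_pos x)) => d.
elim: d x => [|d IHd] x hd hx; first by exfalso; lia.
have [e|ne] := eqVneq (tl_pos (M x)) (tl_pos x).+1; first by exists x; rewrite e.
have [|y yE] := @tl_pos_surj n (tl_pos x).+1.
  by have := tl_pos_lt (M x); lia.
have yx : y != x by apply: contraTneq (leqnn (tl_pos y)) => {2}->; rewrite yE ltnn.
have yMx : y != M x by apply: contra ne => /eqP <-; rewrite yE.
have yMy := ltC pi (Mf y).
have := Mc x y isT isT yx yMx; rewrite /crossing /plt yE ltnSn /=.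
have -> : (tl_pos (M x) < (tl_pos x).+1)%N = false by lia.
have /negPf ne2 : tl_pos (M y) != tl_pos (M x).
  by rewrite (inj_eq pi) (inj_eq (can_inj MK)).
have /negPf ne3 : tl_pos (M y) != tl_pos x.
  by rewrite (inj_eq pi) -(inj_eq (can_inj MK)) MK.
move=> h; have h1 : (tl_pos y < tl_pos (M y) < tl_pos (M x))%N.
  have /eqP ne4 : tl_pos (M y) != tl_pos y by rewrite (inj_eq pi).
  move: h ne2 ne3; case: (ltnP (tl_pos x)) => /= h1; case: (ltnP (tl_pos (M x))) => //= h2;
    by move: ne4; lia.
have [|| z [z1 z2 z3]] := IHd y; [by lia | by lia |].
by exists z; split=> //; lia.
Qed.

(** By induction the strands further left are straight, so output [j] and input [j] go to positions
    at least [j]; if both were larger, the two strands would cross. *)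
Lemma straight M h : tl_planar M ->
  (forall j : 'I_n, (j < h)%N -> ~~ out (M (inl j)) && out (M (inr j))) ->
  forall j : 'I_n, (j < h)%N -> M (inl j) = inr j.
Proof.
move=> plM hM j; have [MK Mf _ Mc] := plM.
have [m] := ubnP (val j); elim: m j => // m IHm j hm hj.
have := hM j hj; case e1: (M (inl j)) => [|k]; case e2: (M (inr j)) => [l|] //= _.
have low (i : 'I_n) : (i < j)%N -> M (inl i) = inr i.
  by move=> ij; apply: IHm; [exact: leq_trans ij _ | exact: ltn_trans ij _].
have kj : (j <= k)%N.
  rewrite leqNgt; apply/negP => kj; have := low k kj; rewrite -e1 => /(can_inj MK) [e].
  by rewrite e ltnn in kj.
have lj : (j <= l)%N.
  rewrite leqNgt; apply/negP => lj; have := low l lj; rewrite -e2 MK => -[e].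
  by rewrite e ltnn in lj.
have [jl|ne'] := eqVneq j l.
  by move: e1 e2; rewrite jl => e1 e2; rewrite -e1 -e2 MK.
have := Mc (inl j) (inr j) isT isT isT; rewrite e1 e2 => H.
have kj' : (inr j : tl_pt n) != inr k.
  by rewrite -e1 -(inj_eq (can_inj MK)) e2 MK eq_sym.
have := H kj'; rewrite /crossing /plt /=.
have := ltn_ord j; have := ltn_ord k; have := ltn_ord l.
have : (j < l)%N by rewrite ltn_neqAle lj andbT; apply: contra ne' => /eqP/val_inj->.
have : (j < k)%N.
  by rewrite ltn_neqAle kj andbT; apply: contra kj' => /eqP/val_inj->.
by lia.
Qed.

(** The outputs then inject into the inputs, hence biject with them, and no arc between inputs is
    left. *)
Lemma no_cup_id M : tl_planar M -> (forall j, ~~ out (M (inl j))) ->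
  forall j, M (inl j) = inr j.
Proof.
move=> plM hM; have [MK Mf _ Mc] := plM.
pose f (j : 'I_n) : 'I_n := if M (inl j) is inr k then k else j.
have fE j : M (inl j) = inr (f j) by have := hM j; rewrite /f; case: (M _).
have fi : injective f.
  by move=> i j e; have := fE i; rewrite e -fE => /(can_inj MK) [].
move=> j; apply: (straight (h := n) plM) => // i _; rewrite hM /=.
by have [g _ fg] := injF_bij fi; rewrite -(fg i) -fE MK.
Qed.

Lemma adjacent_out M : tl_planar M -> ~ (forall j, M (inl j) = inr j) ->
  exists j k : 'I_n, k = j.+1 :> nat /\ M (inl j) = inl k.
Proof.
move=> plM nid.
have [/forallP h|] := boolP [forall j, ~~ out (M (inl j))].
  by case: nid; apply: no_cup_id.
rewrite negb_forall => /existsP[j]; rewrite negbK.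
case e: (M (inl j)) => [k|] // _; have [MK _ _ _] := plM.
wlog h : j k e / (j < k)%N.
  move=> W; case: (ltngtP j k) => [|h|/val_inj h].
  - exact: W e.
  - by apply: (W k j) h; rewrite -e MK.
  - by have := planar_fpf plM (inl j); rewrite e h eqxx.
have [|y [h1 h2 h3]] := @inner_arc M (inl j) plM; first by rewrite e.
move: h1 h2 h3; rewrite e; case E: (M y) => [l|l] /=; last first.
  by have := ltn_ord l; have := ltn_ord k; lia.
case: y E => [i|i] E /= h1 h2 h3; last first.
  by have := ltn_ord i; have := ltn_ord k; lia.
by exists i, l.
Qed.

Lemma adjacent_in M : tl_planar M -> ~ (forall j, M (inl j) = inr j) ->
  exists j k : 'I_n, k = j.+1 :> nat /\ M (inr j) = inr k.
Proof.
move=> plM nid; have [MK _ _ _] := plM.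
have [|j [k [e h]]] := adjacent_out (flip_planar plM).
  move=> h; apply: nid => j; have := h j; rewrite /= => /(congr1 flip).
  by rewrite flipK /= => e; rewrite -e MK.
by exists j, k; split=> //; move: h => /= /(congr1 flip); rewrite flipK.
Qed.

End PlanarArcs.

(** * Matrices of diagrams *)

Lemma nth_mid (a c : seq bool) b1 b2 b3 b4 l : l != size a -> l != (size a).+1 ->
  nth false (a ++ [:: b1; b2] ++ c) l = nth false (a ++ [:: b3; b4] ++ c) l.
Proof.
move=> n1 n2; rewrite !nth_cat; case: ltnP => // h.
have : (l - size a >= 2)%N by lia.
by case: (l - size a)%N => [|[|m]].
Qed.

Lemma nth_mid0 (a c : seq bool) b1 b2 : nth false (a ++ [:: b1; b2] ++ c) (size a) = b1.
Proof. by rewrite nth_cat ltnn subnn. Qed.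

Lemma nth_mid1 (a c : seq bool) b1 b2 : nth false (a ++ [:: b1; b2] ++ c) (size a).+1 = b2.
Proof. by rewrite nth_cat ltnNge leqnSn subSnn. Qed.

Section DiagramMatrices.
Variables (F : fieldType) (t : F) (n : nat).
Implicit Types (D : tl_diagram n) (s : seq bool).

Definition ptbit s' s (z : tl_pt n) : bool :=
  match z with inl j => nth false s' j | inr j => nth false s j end.

Definition ptfac D (z : tl_pt n) (b1 b2 : bool) : F :=
  match z, D z with
  | inl j, inl k => if (j < k)%N then (-1) ^+ j * cap_coef t b1 b2 else 1
  | inr j, inr k => if (j < k)%N then (-1) ^+ j * cup_coef t b1 b2 else 1
  | inl _, inr _ => (b1 == b2)%:R
  | inr _, inl _ => 1
  end.

Definition dmat D s' s : F :=
  \prod_z ptfac D z (ptbit s' s z) (ptbit s' s (D z)).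

Lemma dmat_tuple D (w' w : n.-tuple bool) : tl_coef t D w' w = dmat D w' w.
Proof.
apply: eq_bigr => z _; rewrite /ptfac.
by case: z => j; case: (D _) => k; rewrite /= ?(tnth_nth false).
Qed.

Definition tlmat (f : tl_alg F n) s' s : F := \sum_D f D * dmat D s' s.

Lemma tlmatD f g s' s : tlmat (f + g) s' s = tlmat f s' s + tlmat g s' s.
Proof.
by rewrite /tlmat -big_split /=; apply: eq_bigr => D _; rewrite ffunE mulrDl.
Qed.

Lemma tlmatZ c f s' s : tlmat (c *: f) s' s = c * tlmat f s' s.
Proof.
by rewrite /tlmat mulr_sumr; apply: eq_bigr => D _; rewrite ffunE mulrA.
Qed.

Lemma tlmatB f g s' s : tlmat (f - g) s' s = tlmat f s' s - tlmat g s' s.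
Proof. by rewrite tlmatD -scaleN1r tlmatZ mulN1r. Qed.

Lemma tl_basisE (r : rel (tl_pt n)) D (D' : tl_diagram n) :
  (forall x y, r x y = (y == D x)) -> tl_basis F r D' = (D' == D)%:R.
Proof.
move=> rE; rewrite ffunE; congr (nat_of_bool _)%:R; apply/forallP/eqP => [h|-> x].
  by apply/val_inj/ffunP => x; apply/eqP; rewrite -rE.
by rewrite rE.
Qed.

Lemma tlmat_basis (r : rel (tl_pt n)) D s' s :
  (forall x y, r x y = (y == D x)) -> tlmat (tl_basis F r) s' s = dmat D s' s.
Proof.
move=> rE; rewrite /tlmat (bigD1 D) //= (tl_basisE _ rE) eqxx mul1r.
rewrite big1 ?addr0 // => D' /negPf ne.
by rewrite (tl_basisE _ rE) ne mul0r.
Qed.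

Section Multiplicativity.
Hypotheses (t0 : t != 0) (d0 : t + t^-1 != 0).

Lemma dmat_mul D1 D2 : exists D,
  (forall x y, tl_comp_rel D1 D2 x y = (y == D x)) /\
  forall s' s, size s' = n -> size s = n ->
    \sum_(m <- words n) dmat D1 s' m * dmat D2 m s =
    (t + t^-1) ^+ tl_loops D1 D2 * dmat D s' s.
Proof.
have [D [DE hD]] := tl_composition t0 d0 D1 D2; exists D; split=> // s' s hs' hs.
pose w' : n.-tuple bool := tcast hs' (in_tuple s').
pose w : n.-tuple bool := tcast hs (in_tuple s).
have -> : s' = w' by rewrite val_tcast.
have -> : s = w by rewrite val_tcast.
rewrite -big_words_tuple; under eq_bigr => m _ do rewrite -!dmat_tuple !tl_coefE //.
rewrite -dmat_tuple tl_coefE // mulrCA -hD.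
rewrite (reindex (fun m : {ffun 'I_n -> bool} => [tuple m j | j < n])) /=; last first.
  exists (fun m : n.-tuple bool => [ffun j => tnth m j]) => m _.
    by apply/ffunP => j; rewrite ffunE tnth_mktuple.
  by apply: eq_from_tnth => j; rewrite tnth_mktuple ffunE.
rewrite mulr_sumr; apply: eq_bigr => m _.
have e1 : tpw t (tnth [tuple m j | j < n]) = tpw t m.
  by apply: eq_bigr => j _; rewrite tnth_mktuple.
have e2 : sgn F (tnth [tuple m j | j < n]) = sgn F m.
  by apply: eq_bigr => j _; rewrite tnth_mktuple.
rewrite e1 e2.
rewrite (@eq_wprod F t _ _ D1 D1 predT predT _ (bit (tnth w') m)) //; last first.
  by move=> x _; split; [case: x | case: (D1 x)] => j //=; rewrite tnth_mktuple.
rewrite (@eq_wprod F t _ _ D2 D2 predT predT _ (bit m (tnth w))) //; last first.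
  by move=> x _; split; [case: x | case: (D2 x)] => j //=; rewrite tnth_mktuple.
set W1 := wprod _ _ D1 _ _; set W2 := wprod _ _ D2 _ _.
have S := sgnK F m.
transitivity (sgn F (tnth w') * sgn F (tnth w) * tpw t (tnth w) *
   (tpw t m * (W1 * W2)) * (sgn F m * sgn F m)); first by ring.
by rewrite S mulr1.
Qed.

Lemma tlmat_mul f g s' s : size s' = n -> size s = n ->
  tlmat (tl_mul (t + t^-1) f g) s' s =
  \sum_(m <- words n) tlmat f s' m * tlmat g m s.
Proof.
move=> hs' hs; rewrite /tlmat /tl_mul.
under eq_bigr => D _ do rewrite sum_ffunE mulr_suml.
rewrite exchange_big /=.
under [RHS]eq_bigr => m _ do rewrite mulr_suml.
rewrite [RHS]exchange_big /=; apply: eq_bigr => D1 _.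
under eq_bigr => D _ do rewrite sum_ffunE mulr_suml.
rewrite exchange_big /=.
under [RHS]eq_bigr => m _ do rewrite mulr_sumr.
rewrite [RHS]exchange_big /=; apply: eq_bigr => D2 _.
have [D [DE hD]] := dmat_mul D1 D2.
rewrite (bigD1 D) //= big1 => [|D' /negPf ne]; last first.
  by rewrite ffunE (tl_basisE _ DE) ne scaler0 mul0r.
rewrite addr0 ffunE (tl_basisE _ DE) eqxx.
rewrite [_ *: _](@mulr1 F) -mulrA -hD // mulr_sumr.
by apply: eq_bigr => m _; ring.
Qed.

End Multiplicativity.

Lemma eq_ptfac (P : pred (tl_pt n)) D s1' s1 s2' s2 :
  (forall z, P z -> ptbit s1' s1 z = ptbit s2' s2 z) ->
  (forall z, P z -> P (D z)) ->
  \prod_(z | P z) ptfac D z (ptbit s1' s1 z) (ptbit s1' s1 (D z)) =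
  \prod_(z | P z) ptfac D z (ptbit s2' s2 z) (ptbit s2' s2 (D z)).
Proof. by move=> e1 e2; apply: eq_bigr => z Pz; rewrite !e1 ?e2. Qed.

Lemma diagram_offP D z1 z2 z : D z1 = z2 -> (z != z1) && (z != z2) ->
  (D z != z1) && (D z != z2).
Proof.
have [DK _ _ _] := diagram_planar D; move=> e /andP[n1 n2].
have e' : D z2 = z1 by rewrite -e DK.
apply/andP; split; [apply: contra n2 | apply: contra n1] => /eqP h;
  by apply/eqP/(can_inj DK); rewrite h ?e ?e'.
Qed.

Section Arc.
Variables (D : tl_diagram n) (j k : 'I_n).
Hypothesis jk : k = j.+1 :> nat.

Let splitw : words n = words (j + (2 + (n - j - 2))).
Proof. by congr words; have := ltn_ord k; lia. Qed.

Lemma dmat_arc_out a c b1 b2 s : D (inl j) = inl k -> size a = j ->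
  dmat D (a ++ [:: b1; b2] ++ c) s = (-1) ^+ j * cap_coef t b1 b2 *
    \prod_(z | (z != inl j) && (z != inl k))
      ptfac D z (ptbit (a ++ [:: false; false] ++ c) s z)
                (ptbit (a ++ [:: false; false] ++ c) s (D z)).
Proof.
move=> e ha; have [DK Df _ _] := diagram_planar D.
have ne : (inl k : tl_pt n) != inl j by rewrite -e.
have hk : nat_of_ord k = (size a).+1 by rewrite jk ha.
rewrite /dmat (bigD1 (inl j)) //= (bigD1 (inl k)) //= mulrA; congr (_ * _).
  rewrite /ptfac -e DK e /= jk ltnSn ltnNge leqnSn mulr1.
  by rewrite -ha nth_mid0 nth_mid1.
apply: eq_ptfac.
- move=> z /andP[n1 n2]; case: z n1 n2 => [l|l] //= n1 n2; apply: nth_mid.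
    by apply: contra n1 => /eqP h; apply/eqP; congr inl; apply: val_inj; rewrite /= h.
  by apply: contra n2 => /eqP h; apply/eqP; congr inl; apply: val_inj; rewrite /= h hk.
- by move=> z; apply: diagram_offP.
Qed.

Lemma dmat_arc_in a c b1 b2 s : D (inr j) = inr k -> size a = j ->
  dmat D s (a ++ [:: b1; b2] ++ c) = (-1) ^+ j * cup_coef t b1 b2 *
    \prod_(z | (z != inr j) && (z != inr k))
      ptfac D z (ptbit s (a ++ [:: false; false] ++ c) z)
                (ptbit s (a ++ [:: false; false] ++ c) (D z)).
Proof.
move=> e ha; have [DK Df _ _] := diagram_planar D.
have ne : (inr k : tl_pt n) != inr j by rewrite -e.
have hk : nat_of_ord k = (size a).+1 by rewrite jk ha.
rewrite /dmat (bigD1 (inr j)) //= (bigD1 (inr k)) //= mulrA; congr (_ * _).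
  rewrite /ptfac -e DK e /= jk ltnSn ltnNge leqnSn mulr1.
  by rewrite -ha nth_mid0 nth_mid1.
apply: eq_ptfac.
- move=> z /andP[n1 n2]; case: z n1 n2 => [l|l] //= n1 n2; apply: nth_mid.
    by apply: contra n1 => /eqP h; apply/eqP; congr inr; apply: val_inj; rewrite /= h.
  by apply: contra n2 => /eqP h; apply/eqP; congr inr; apply: val_inj; rewrite /= h hk.
- by move=> z; apply: diagram_offP.
Qed.

(** The two letter pairs allowed by the arc have coefficients [t^-1] and [-1], and the q-symmetry of
    [phi] at these letters makes them cancel. *)
Lemma kill_out (phi : seq bool -> F) s : D (inl j) = inl k ->
  (forall a c, size a = j -> (j + (2 + size c))%N = n ->
     phi (a ++ [:: false; true] ++ c) = t^-1 * phi (a ++ [:: true; false] ++ c)) ->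
  \sum_(s' <- words n) phi s' * dmat D s' s = 0.
Proof.
move=> e h; rewrite splitw big_words_cat; apply: big_words0P => a ha.
rewrite big_words_cat exchange_big; apply: big_words0P => c hc.
rewrite !big_wordsS !big_words0 !dmat_arc_out //= h //; first by ring.
by rewrite hc; have := ltn_ord k; lia.
Qed.

Lemma kill_in (phi : seq bool -> F) s' : t != 0 -> D (inr j) = inr k ->
  (forall a c, size a = j -> (j + (2 + size c))%N = n ->
     phi (a ++ [:: false; true] ++ c) = t^-1 * phi (a ++ [:: true; false] ++ c)) ->
  \sum_(s <- words n) dmat D s' s * phi s = 0.
Proof.
move=> t0 e h; rewrite splitw big_words_cat; apply: big_words0P => a ha.
rewrite big_words_cat exchange_big; apply: big_words0P => c hc.
rewrite !big_wordsS !big_words0 !dmat_arc_in //= h //; first by field.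
by rewrite hc; have := ltn_ord k; lia.
Qed.

End Arc.

End DiagramMatrices.

Section NestDiagram.
Variables (n a m : nat).
Hypothesis han : (a + 2 * m <= n)%N.
Let ins (j : nat) := (a <= j < a + 2 * m)%N.

Definition nestf (x : tl_pt n) : tl_pt n :=
  match x with
  | inl j => if ins j then inl (insubd j ((2 * a + 2 * m).-1 - j)%N) else inr j
  | inr j => if ins j then inr (insubd j ((2 * a + 2 * m).-1 - j)%N) else inl j
  end.

Let insE (j : 'I_n) : ins j ->
  val (insubd j ((2 * a + 2 * m).-1 - j)%N) = ((2 * a + 2 * m).-1 - j)%N.
Proof. by rewrite val_insubd /ins => h; case: ifP => //; lia. Qed.

Lemma nestfK : involutive nestf.
Proof.
move=> [j|j] /=; case: ifP => h /=; rewrite ?h // insE //.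
  rewrite (_ : ins _); last by move: h; rewrite /ins; lia.
  by congr inl; apply: val_inj; rewrite /= val_insubd insE //; move: h; rewrite /ins;
    have := ltn_ord j; case: ifP; lia.
rewrite (_ : ins _); last by move: h; rewrite /ins; lia.
by congr inr; apply: val_inj; rewrite /= val_insubd insE //; move: h; rewrite /ins;
  have := ltn_ord j; case: ifP; lia.
Qed.

Lemma nestf_planar : tl_planar nestf.
Proof.
have pi := @tl_pos_inj n.
have ps x : tl_pos (nestf x) = let P := tl_pos x in
   if (a <= P < a + 2 * m)%N then ((2 * a + 2 * m).-1 - P)%N
   else if (2 * n - a - 2 * m <= P < 2 * n - a)%N
     then (4 * n - 2 * a - 2 * m - 1 - P)%N else ((2 * n).-1 - P)%N.
  case: x => j /=; have := ltn_ord j; case: ifP => h /=; rewrite ?insE //;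
    move: h; rewrite /ins; repeat case: ifP; lia.
split=> [|x|//|x y _ _ n1 n2]; first exact: nestfK.
  rewrite -(inj_eq pi) ps /=; have := tl_pos_lt x.
  by repeat case: ifP; lia.
have := n1; have := n2; rewrite -!(inj_eq pi) /crossing /plt !ps /=.
have := tl_pos_lt x; have := tl_pos_lt y.
move: (tl_pos x) (tl_pos y) => P P' hP hP'.
by repeat case: ifP; lia.
Qed.

Definition nest_diagram : tl_diagram n := TLDiagram (planar_noncrossing nestf_planar).

Lemma nest_diagramE x : nest_diagram x = nestf x.
Proof. by rewrite /nest_diagram /= ffunE. Qed.

Lemma tl_nest_relE x y : tl_nest_rel a m x y = (y == nest_diagram x).
Proof.
rewrite nest_diagramE; case: x y => j [] k /=; rewrite -/(ins j); case: ifP => h //=.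
- transitivity (k == insubd j ((2 * a + 2 * m).-1 - j)%N) => //.
  by rewrite -val_eqE insE //; move: h; rewrite /ins /=; lia.
- exact: eq_sym.
- exact: eq_sym.
- transitivity (k == insubd j ((2 * a + 2 * m).-1 - j)%N) => //.
  by rewrite -val_eqE insE //; move: h; rewrite /ins /=; lia.
Qed.

End NestDiagram.

Section CapCup.
Variables (F : fieldType) (t : F).

Definition capc (u : seq bool) : F := \prod_(b <- u) (if b then t^-1 else -1).
Definition cupc (u : seq bool) : F := \prod_(b <- u) (if b then 1 else - t).

Lemma cupcE u : t != 0 -> cupc u = t ^+ size u * capc u.
Proof.
move=> t0; rewrite /cupc /capc; elim: u => [|b u IHu]; rewrite ?big_nil ?mulr1 //.
rewrite !big_cons IHu /= exprS mulrACA; congr (_ * _).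
by case: b; rewrite ?divff // mulrN1.
Qed.

Lemma prod_eqb k (u v : seq bool) : size u = k -> size v = k ->
  \prod_(0 <= j < k) (nth false u j == nth false v j)%:R = (u == v)%:R :> F.
Proof.
elim: k u v => [|k IHk] [|b u] [|c v] //= => [_ _|[hu] [hv]]; first by rewrite big_nil.
by rewrite big_nat_recl //= IHk // -natrM mulnb eqseq_cons.
Qed.

Let prod_cc m (f : bool -> bool -> F) (g : bool -> F) (u y : seq bool) :
  (forall b1 b2, f b1 b2 = g b1 * (b2 == ~~ b1)%:R) -> size u = m -> size y = m ->
  \prod_(k < m) f (nth false (u ++ y) k) (nth false (u ++ y) ((2 * m).-1 - k)) =
  if y == bar u then \prod_(b <- u) g b else 0.
Proof.
move=> fE hu hy; rewrite -(big_mkord xpredT (fun k =>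
  f (nth false (u ++ y) k) (nth false (u ++ y) ((2 * m).-1 - k)))).
have -> : (y == bar u) = (rev y == map negb u).
  by rewrite -(inj_eq (can_inj revK)) /bar revK.
rewrite (_ : (if _ then _ else 0) =
   (\prod_(b <- u) g b) * (rev y == map negb u)%:R); last first.
  by case: ifP; rewrite ?mulr1 ?mulr0.
rewrite -(@prod_eqb m) ?size_rev ?size_map // (big_nth false) hu -big_split /=.
apply: eq_big_nat => k /andP[_ hk]; rewrite fE nth_cat hu hk.
rewrite nth_cat hu ltnNge (_ : (m <= _)%N) /=; last by lia.
rewrite (nth_map false) ?hu // nth_rev ?hy //; congr (_ * (nth _ _ _ == _)%:R).
by lia.
Qed.

Lemma ncap_cat m u y : size u = m -> size y = m ->
  \prod_(k < m) cap_coef t (nth false (u ++ y) k)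
     (nth false (u ++ y) ((2 * m).-1 - k)) = if y == bar u then capc u else 0.
Proof. by apply: prod_cc => -[] []; rewrite /= ?mulr1 ?mulr0. Qed.

Lemma ncup_cat m u y : size u = m -> size y = m ->
  \prod_(k < m) cup_coef t (nth false (u ++ y) k)
     (nth false (u ++ y) ((2 * m).-1 - k)) = if y == bar u then cupc u else 0.
Proof. by apply: prod_cc => -[] []; rewrite /= ?mulr1 ?mulr0. Qed.

End CapCup.

Section NestMatrix.
Variables (F : fieldType) (t : F) (n a m : nat).
Hypothesis han : (a + 2 * m <= n)%N.

Lemma dmat_nest a1 m1 r1 a2 m2 r2 : size a1 = a -> size a2 = a ->
  size m1 = (2 * m)%N -> size m2 = (2 * m)%N ->
  size r1 = (n - (a + 2 * m))%N -> size r2 = (n - (a + 2 * m))%N ->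
  dmat t (nest_diagram han) (a1 ++ m1 ++ r1) (a2 ++ m2 ++ r2) =
  (a1 == a2)%:R * (r1 == r2)%:R *
  ((\prod_(k < m) cap_coef t (nth false m1 k) (nth false m1 ((2 * m).-1 - k))) *
   (\prod_(k < m) cup_coef t (nth false m2 k) (nth false m2 ((2 * m).-1 - k)))).
Proof.
move=> ha1 ha2 hm1 hm2 hr1 hr2; set s1 := a1 ++ _; set s2 := a2 ++ _.
pose inn j := (a <= j < a + 2 * m)%N.
pose arc (f : bool -> bool -> F) s j : F := if (j < a + m)%N then
  (-1) ^+ j * f (nth false s j) (nth false s ((2 * a + 2 * m).-1 - j)) else 1.
pose fL (j : nat) : F := if inn j then arc (cap_coef t) s1 j
  else (nth false s1 j == nth false s2 j)%:R.
pose fR (j : nat) : F := if inn j then arc (cup_coef t) s2 j else 1.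
have iE (j : 'I_n) : inn j ->
  val (insubd j ((2 * a + 2 * m).-1 - j)%N) = ((2 * a + 2 * m).-1 - j)%N.
  by rewrite val_insubd /inn => h; case: ifP => //; have := ltn_ord j; lia.
have jk (j : 'I_n) : inn j -> (j < (2 * a + 2 * m).-1 - j)%N = (j < a + m)%N.
  by rewrite /inn; lia.
have -> : dmat t (nest_diagram han) s1 s2 =
    \prod_(0 <= j < n) fL j * \prod_(0 <= j < n) fR j.
  rewrite !big_mkord /dmat big_sumType; congr (_ * _); apply: eq_bigr => j _.
    rewrite /ptfac !nest_diagramE /fL /nestf -/(inn j); case: ifP => h //=.
    by rewrite (iE j h) jk // /arc; case: ifP.
  rewrite /ptfac !nest_diagramE /fR /nestf -/(inn j); case: ifP => h //=.
  by rewrite (iE j h) jk // /arc; case: ifP.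
have split3 (f : nat -> F) : \prod_(0 <= j < n) f j =
    \prod_(0 <= j < a) f j * (\prod_(0 <= k < m) f (k + a)%N *
     (\prod_(m <= k < 2 * m) f (k + a)%N *
      \prod_(0 <= k < n - (a + 2 * m)) f (k + (a + 2 * m))%N)).
  rewrite (big_cat_nat (n := a)) //=; last by lia.
  congr (_ * _); rewrite (big_cat_nat (n := (a + 2 * m)%N)) //=; last by lia.
  rewrite mulrA; congr (_ * _).
    rewrite -{1}[a]add0n big_addn addKn.
    by rewrite (big_cat_nat (n := m)) //=; lia.
  by rewrite -{1}[(a + 2 * m)%N]add0n big_addn.
have n1 j : (j < a)%N -> nth false s1 j = nth false a1 j.
  by move=> h; rewrite nth_cat ha1 h.
have n2 j : (j < a)%N -> nth false s2 j = nth false a2 j.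
  by move=> h; rewrite nth_cat ha2 h.
have m1E j : (j < 2 * m)%N -> nth false s1 (j + a) = nth false m1 j.
  by move=> h; rewrite nth_cat ha1 ltnNge leq_addl /= addnK nth_cat hm1 h.
have m2E j : (j < 2 * m)%N -> nth false s2 (j + a) = nth false m2 j.
  by move=> h; rewrite nth_cat ha2 ltnNge leq_addl /= addnK nth_cat hm2 h.
have r1E j : nth false s1 (j + (a + 2 * m)) = nth false r1 j.
  rewrite /s1 catA nth_cat size_cat ha1 hm1 ltnNge leq_addl /=; congr nth; lia.
have r2E j : nth false s2 (j + (a + 2 * m)) = nth false r2 j.
  rewrite /s2 catA nth_cat size_cat ha2 hm2 ltnNge leq_addl /=; congr nth; lia.
rewrite !split3.
have -> : \prod_(0 <= j < a) fL j = (a1 == a2)%:R.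
  rewrite -(@prod_eqb F a) //; apply: eq_big_nat => j /andP[_ hj].
  by rewrite /fL /inn leqNgt hj /= n1 // n2.
have -> : \prod_(0 <= k < n - (a + 2 * m)) fL (k + (a + 2 * m))%N = (r1 == r2)%:R.
  rewrite -(@prod_eqb F (n - (a + 2 * m))) //; apply: eq_big_nat => j _.
  by rewrite /fL /inn [X in _ && X]ltnNge leq_addl andbF r1E r2E.
have -> : \prod_(0 <= j < a) fR j = 1.
  rewrite big_nat big1 // => j /andP[_ hj].
  by rewrite /fR /inn leqNgt hj.
have -> : \prod_(0 <= k < n - (a + 2 * m)) fR (k + (a + 2 * m))%N = 1.
  rewrite big1 // => j _.
  by rewrite /fR /inn [X in _ && X]ltnNge leq_addl andbF.
have -> : \prod_(m <= k < 2 * m) fL (k + a)%N = 1.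
  rewrite big_nat big1 // => j /andP[h1 h2].
  rewrite /fL (_ : inn _); last by rewrite /inn; lia.
  by rewrite /arc (_ : (_ < _)%N = false) //; lia.
have -> : \prod_(m <= k < 2 * m) fR (k + a)%N = 1.
  rewrite big_nat big1 // => j /andP[h1 h2].
  rewrite /fR (_ : inn _); last by rewrite /inn; lia.
  by rewrite /arc (_ : (_ < _)%N = false) //; lia.
rewrite !mul1r !mulr1 -(big_mkord xpredT (fun k =>
  cap_coef t (nth false m1 k) (nth false m1 ((2 * m).-1 - k)))).
rewrite -(big_mkord xpredT (fun k =>
  cup_coef t (nth false m2 k) (nth false m2 ((2 * m).-1 - k)))).
transitivity ((a1 == a2)%:R * (r1 == r2)%:R *
   (\prod_(0 <= k < m) fL (k + a)%N * \prod_(0 <= k < m) fR (k + a)%N)); first by ring.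
congr (_ * _); rewrite -!big_split /=; apply: eq_big_nat => k /andP[_ hk].
rewrite /fL /fR (_ : inn (k + a)%N); last by rewrite /inn; lia.
rewrite /arc (_ : (k + a < a + m)%N); last by lia.
have -> : ((2 * a + 2 * m).-1 - (k + a) = (2 * m).-1 - k + a)%N by lia.
rewrite !m1E ?m2E //; try lia.
(* The [k]-th cap and the [k]-th cup carry the same sign, so the signs cancel. *)
by rewrite mulrACA -expr2 sqrr_sign mul1r.
Qed.

Lemma tlmat_nest s' s :
  tlmat t (tl_basis F (@tl_nest_rel n a m)) s' s = dmat t (nest_diagram han) s' s.
Proof. by apply: tlmat_basis => x y; rewrite tl_nest_relE. Qed.

End NestMatrix.

Section IdDiagram.
Variables (F : fieldType) (t : F) (n : nat).

Let h0 : (0 + 2 * 0 <= n)%N. Proof. by []. Qed.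
Definition id_diagram : tl_diagram n := nest_diagram h0.

Lemma id_diagramE x : id_diagram x = flip x.
Proof. by rewrite nest_diagramE; case: x. Qed.

Lemma tlmat_id s' s : size s' = n -> size s = n ->
  tlmat t (tl_basis F (@tl_id_rel n)) s' s = (s' == s)%:R.
Proof.
move=> hs' hs; rewrite (@tlmat_basis F t n _ id_diagram); last first.
  by move=> x y; rewrite id_diagramE; case: x y => j [] k //=; rewrite eq_sym.
rewrite (@dmat_nest F t n 0 0 h0 [::] [::] s' [::] [::] s) ?subn0 //.
by rewrite eqxx !big_ord0 !mul1r mulr1.
Qed.

Lemma id_diagramP (D : tl_diagram n) : D != id_diagram ->
  ~ (forall j, D (inl j) = inr j).
Proof.
have [DK _ _ _] := diagram_planar D.
move=> ne h; case/eqP: ne; apply/val_inj/ffunP => x; rewrite -[RHS]/(id_diagram x).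
by rewrite id_diagramE; case: x => j /=; rewrite -?h ?DK.
Qed.

Lemma dmat_id s' s : size s' = n -> size s = n ->
  dmat t id_diagram s' s = (s' == s)%:R.
Proof.
move=> h1 h2; rewrite -tlmat_id // (@tlmat_basis F t n _ id_diagram) // => x y.
by rewrite id_diagramE; case: x y => j [] k //=; rewrite eq_sym.
Qed.

End IdDiagram.

(** * Generic Jones-Wenzl projections *)

Section JonesWenzlMatrix.
Variables (F : fieldType) (t : F).
Hypotheses (t0 : t != 0) (d0 : t + t^-1 != 0).
Local Notation x := (t^-1 ^+ 2).
Hypothesis gen : forall k, (0 < k)%N -> 1 - x ^+ k != 0.
Local Notation gb := (gbin x).
Local Notation sy := (sy t).
Variable n : nat.

(* The orthogonal projection onto the q-symmetric vectors. *)
Definition symproj k (a b : seq bool) : F :=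
  if count id a == count id b then sy a * sy b / gb k (count id a) else 0.

Lemma gbin_neq0 z m : (m <= z)%N -> gb z m != 0.
Proof.
elim: m => [|m IHm] hm; first by rewrite gbin0 oner_neq0.
apply: contraTneq (IHm (ltnW hm)) => h; rewrite negbK.
have := gbin_succ x (ltnW hm); rewrite h mulr0 => /esym/eqP.
by rewrite mulf_eq0 (negPf (gen _)) ?subn_gt0.
Qed.

Section Sandwich.
Variables (f : tl_alg F n) (P : seq bool -> seq bool -> F) (a0 m : nat).
Hypothesis han : (a0 + 2 * m <= n)%N.
Hypothesis fP : forall a b r r', size a = (a0 + m)%N -> size b = (a0 + m)%N ->
  size r = (n - (a0 + m))%N -> size r' = (n - (a0 + m))%N ->
  tlmat t f (a ++ r) (b ++ r') = if r == r' then P a b else 0.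

Let words_split : words n = words ((a0 + m) + (n - (a0 + m))).
Proof. by congr words; lia. Qed.

Let sumL a r (g : seq bool -> F) : size a = (a0 + m)%N ->
  size r = (n - (a0 + m))%N ->
  \sum_(c <- words n) tlmat t f (a ++ r) c * g c =
  \sum_(c <- words (a0 + m)) P a c * g (c ++ r).
Proof.
move=> ha hr; rewrite words_split big_words_cat; apply: eq_big_words => c hc.
rewrite -(@big_words_delta _ (n - (a0 + m)) (fun s => P a c * g (c ++ s)) r) //.
apply: eq_big_words => s hs; rewrite fP // eq_sym.
by case: eqP => [->|] //; rewrite mul0r.
Qed.

Let sumR b r (g : seq bool -> F) : size b = (a0 + m)%N ->
  size r = (n - (a0 + m))%N ->
  \sum_(c <- words n) g c * tlmat t f c (b ++ r) =
  \sum_(c <- words (a0 + m)) g (c ++ r) * P c b.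
Proof.
move=> hb hr; rewrite words_split big_words_cat; apply: eq_big_words => c hc.
rewrite -(@big_words_delta _ (n - (a0 + m)) (fun s => g (c ++ s) * P c b) r) //.
apply: eq_big_words => s hs; rewrite fP //.
by case: eqP => [->|] //; rewrite mulr0.
Qed.

(** Both factors [f] act on the first [a0 + m] letters only. The cap forces the last [m] of the
    letters facing it to be [bar v], the cup forces [bar u], and a single sum over [a0] letters
    remains. *)
Lemma sandwich a v r b u r' : size a = (a0 + m)%N -> size v = m ->
  size r = (n - (a0 + 2 * m))%N -> size b = (a0 + m)%N -> size u = m ->
  size r' = (n - (a0 + 2 * m))%N ->
  tlmat t (tl_mul (t + t^-1) (tl_mul (t + t^-1) f
     (tl_basis F (tl_nest_rel a0 m))) f) (a ++ v ++ r) (b ++ u ++ r') =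
  if r == r' then capc t (bar v) * cupc t (bar u) *
     \sum_(c <- words a0) P a (c ++ bar v) * P (c ++ bar u) b else 0.
Proof.
move=> ha hv hr hb hu hr'.
have hz : size (v ++ r) = (n - (a0 + m))%N by rewrite size_cat hv hr; lia.
have hz' : size (u ++ r') = (n - (a0 + m))%N by rewrite size_cat hu hr'; lia.
have sA : size (a ++ v ++ r) = n by rewrite size_cat ha hz; lia.
have sB : size (b ++ u ++ r') = n by rewrite size_cat hb hz'; lia.
rewrite tlmat_mul // sumR //.
under eq_big_words => d hd.
  rewrite tlmat_mul //; last by rewrite size_cat hd hz'; lia.
  rewrite sumL //.
  over.
rewrite big_words_cat.
transitivity (\sum_(d0 <- words a0)
   (if r == r' then capc t (bar v) * cupc t (bar u) *
     (P a (d0 ++ bar v) * P (d0 ++ bar u) b) else 0)); last first.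
  by case: eqP => _; [rewrite mulr_sumr | rewrite big1].
apply: eq_big_words => e he.
transitivity (\sum_(d1 <- words m) if d1 == bar u then
   (if r == r' then capc t (bar v) * cupc t (bar u) *
     (P a (e ++ bar v) * P (e ++ bar u) b) else 0) else 0); last first.
  by rewrite (@big_words_delta _ m (fun _ => if r == r' then _ else _) (bar u)) ?size_bar.
apply: eq_big_words => d1 hd1; rewrite big_words_cat.
have N c0 c1 : size c0 = a0 -> size c1 = m ->
    @tlmat F t n (tl_basis F (tl_nest_rel a0 m)) ((c0 ++ c1) ++ v ++ r)
      ((e ++ d1) ++ u ++ r') =
    if (c0 == e) && (c1 == bar v) && (d1 == bar u) && (r == r')
    then capc t (bar v) * cupc t (bar u) else 0.
  move=> hc0 hc1; rewrite (tlmat_nest t han) -!catA.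
  rewrite (catA c1) (catA d1) dmat_nest ?size_cat ?hc1 ?hd1 ?hv ?hu ?mul2n ?addnn //;
    try by rewrite -mul2n.
  rewrite -!mul2n ncap_cat // ncup_cat //.
  rewrite -[v == _](inj_eq (can_inj barK)) barK [bar v == _]eq_sym.
  rewrite -[u == _](inj_eq (can_inj barK)) barK [bar u == _]eq_sym.
  case: (c0 == e); case: (r == r'); case: (c1 =P bar v) => [->|_];
    by case: (d1 =P bar u) => [->|_]; rewrite /= ?(mulr0, mul0r, mul1r).
rewrite (eq_big_words (g := fun c0 => if c0 == e then
   (if (d1 == bar u) && (r == r') then P a (c0 ++ bar v) *
     (capc t (bar v) * cupc t (bar u)) else 0) else 0)); last first.
  move=> c0 hc0; rewrite -(@big_words_delta _ m (fun c1 => if c0 == e then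
     (if (d1 == bar u) && (r == r') then P a (c0 ++ c1) *
     (capc t (bar v) * cupc t (bar u)) else 0) else 0) (bar v)) ?size_bar //.
  apply: eq_big_words => c1 hc1; rewrite N //.
  case: (c0 == e); case: (c1 == bar v); case: (d1 == bar u); case: (r == r') => //=;
    by rewrite mulr0.
rewrite (@big_words_delta _ a0) //.
case: (d1 =P bar u) => [->|] /=; last by rewrite mul0r.
by case: eqP => _; rewrite ?mul0r // mulrAC mulrC mulrA.
Qed.

End Sandwich.

(** Weights force [c] to have weight [l], and [sum_sy2] evaluates the remaining sum of squares. *)
Lemma symproj_sum a0 m l a b v u :
  size v = m -> size u = m ->
  count id a = (l + count id v)%N -> count id b = (l + count id u)%N ->
  \sum_(c <- words a0) symproj (a0 + m) a (c ++ v) * symproj (a0 + m) (c ++ u) b =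
  sy a * sy b * sy v * sy u * t^-1 ^+ ((a0 - l) * (count id v + count id u)) *
   gb a0 l / (gb (a0 + m) (count id a) * gb (a0 + m) (count id b)).
Proof.
move=> hv hu ha hb; rewrite -[gb a0 l]sum_sy2 mulr_sumr mulr_suml.
apply: eq_big_words => c hc; rewrite /symproj !count_cat ha hb.
rewrite eqn_add2r eqn_add2r eq_sym; case: eqP => [cl|]; last by rewrite !(mulr0, mul0r).
rewrite !sy_cat count_negb hc cl mulnDr exprD invfM; ring.
Qed.

Lemma symproj_sum0 a0 m a b v u :
  (forall l, ~ (count id a = l + count id v /\ count id b = l + count id u)%N) ->
  \sum_(c <- words a0) symproj (a0 + m) a (c ++ v) * symproj (a0 + m) (c ++ u) b = 0.
Proof.
move=> h; rewrite big1 // => c _; rewrite /symproj !count_cat.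
case: eqP => [e1|]; last by rewrite mul0r.
case: eqP => [e2|]; last by rewrite mulr0.
by case: (h (count id c)); rewrite e1 -e2.
Qed.

Lemma t_neq_tV : t - t^-1 != 0.
Proof.
have h1 := gen (ltn0Sn 0).
by apply: contra h1 => /eqP h; rewrite expr1 expr2 -{1}(divff t0) -mulrBl h mul0r.
Qed.

Lemma qnumE j : qnum t j = t ^+ j * (1 - x ^+ j) / (t - t^-1).
Proof.
rewrite /qnum mulrBr mulr1 -exprM mulnC exprM expr2 mulrA -exprMn divff //.
by rewrite expr1n mul1r exprVn.
Qed.

Lemma qnum_ratioD k m : (0 < k + m)%N ->
  qnum t k / qnum t (k + m) = t^-1 ^+ m * (1 - x ^+ k) / (1 - x ^+ (k + m)).
Proof.
move=> km; have h2 := gen km; have d1 := t_neq_tV.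
rewrite !qnumE [t ^+ (k + m)]exprD [t^-1 ^+ m]exprVn.
have tk : t ^+ k != 0 by rewrite expf_neq0.
have tm : t ^+ m != 0 by rewrite expf_neq0.
move: h2 tk tm d1; set A := x ^+ k; set B := x ^+ (k + m); set C := t ^+ k.
set D := t ^+ m => h2 tk tm d1.
have d2 : t * t - 1 != 0.
  have -> : t * t - 1 = (t - t^-1) * t by rewrite mulrBl mulVf.
  exact: mulf_neq0.
by field; rewrite t0 d2 h2 tk tm.
Qed.

Lemma qnum_ratio k : qnum t k / qnum t k.+1 = t^-1 * (1 - x ^+ k) / (1 - x ^+ k.+1).
Proof. by rewrite -addn1 qnum_ratioD ?addn1. Qed.

(** Wenzl's recursion is compared entry by entry according to the last letters [i] and [j].
    Absorption expresses the Gaussian binomials on [k] and [k + 2] letters through those on [k + 1]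
    letters, which leaves an identity between rational expressions in powers of [t]. *)
Let jw_step k : (k.+2 <= n)%N ->
  (forall a b r r', size a = k.+1 -> size b = k.+1 ->
    size r = (n - k.+1)%N -> size r' = (n - k.+1)%N ->
    tlmat t (jones_wenzl t n k.+1) (a ++ r) (b ++ r') =
      if r == r' then symproj k.+1 a b else 0) ->
  forall a b r r', size a = k.+2 -> size b = k.+2 ->
    size r = (n - k.+2)%N -> size r' = (n - k.+2)%N ->
    tlmat t (jones_wenzl t n k.+2) (a ++ r) (b ++ r') =
      if r == r' then symproj k.+2 a b else 0.
Proof.
move=> hk IH a b r r' ha hb hr hr'.
case/lastP: a ha => // a i; rewrite size_rcons => -[ha].
case/lastP: b hb => // b j; rewrite size_rcons => -[hb].
rewrite -!cats1 -!catA.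
have -> : jones_wenzl t n k.+2 = jones_wenzl t n k.+1 - (qnum t k.+1 / qnum t k.+2) *:
   tl_mul (t + t^-1) (tl_mul (t + t^-1) (jones_wenzl t n k.+1)
     (tl_basis F (tl_nest_rel k 1))) (jones_wenzl t n k.+1) by [].
have han : (k + 2 * 1 <= n)%N by lia.
have k1 : (k + 1 = k.+1)%N by lia.
rewrite tlmatB tlmatZ IH ?size_cat ?hr ?hr' //; try (rewrite /=; lia).
rewrite (@sandwich _ (symproj k.+1) k 1 han) ?k1 //; try (rewrite ?hr ?hr'; lia).
rewrite /= eqseq_cons.
case: (eqVneq r r') => [_|_]; last by rewrite andbF mulr0 subr0.
rewrite andbT qnum_ratio.
have h1 := gen (ltn0Sn k); have h2 := gen (ltn0Sn k.+1).
have gsum l : count id a = (l + count id [:: ~~ i])%N ->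
    count id b = (l + count id [:: ~~ j])%N ->
    \sum_(c <- words k) symproj k.+1 a (c ++ bar [:: i]) * symproj k.+1 (c ++ bar [:: j]) b =
    sy a * sy b * t^-1 ^+ ((k - l) * (~~ i + ~~ j)) *
    gb k l / (gb k.+1 (count id a) * gb k.+1 (count id b)).
  move=> e1 e2; have := @symproj_sum k 1 l a b (bar [:: i]) (bar [:: j]) erefl erefl e1 e2.
  by rewrite k1 => ->; rewrite /bar /= !addn0 !sy1 !mulr1.
have gsum0 : (forall l, ~ (count id a = l + count id (bar [:: i]) /\
      count id b = l + count id (bar [:: j]))%N) ->
    \sum_(c <- words k) symproj k.+1 a (c ++ bar [:: i]) * symproj k.+1 (c ++ bar [:: j]) b = 0.
  by move=> /(@symproj_sum0 k 1); rewrite k1.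
have hla := count_le a; have hlb := count_le b; rewrite ha in hla; rewrite hb in hlb.
have [ab|ab] := eqVneq (count id a + i)%N (count id b + j)%N; last first.
  rewrite [in RHS]/symproj !count_cat /= !addn0 (negPf ab).
  rewrite gsum0 ?mulr0 ?subr0; last first.
    by move=> l; rewrite /bar /=; move: ab; clear; case: i; case: j => /=; lia.
  case: eqP => // ij; rewrite /symproj; case: eqP => // cab.
  by move: ab; rewrite ij cab eqxx.
rewrite [in RHS]/symproj !count_cat /= !addn0 ab eqxx !sy_cat !sy1 /= !addn0 !mulr1.
have szn (c : seq bool) : size c = k.+1 -> count negb c = (k.+1 - count id c)%N.
  by move=> <-; apply: count_negb.
rewrite !szn //.
have nb := (erefl : nat_of_bool true = 1, erefl : nat_of_bool false = 0,
  erefl : nat_of_bool (~~ true) = 0, erefl : nat_of_bool (~~ false) = 1)%N.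
case: i j ab gsum gsum0 => [] [] /= ab gsum gsum0.
-
  have e : count id a = count id b by lia.
  rewrite (gsum (count id a)) ?e ?addn0 // muln0 expr0 mulr1.
  rewrite /capc /cupc /bar /= !big_cons !big_nil !mulr1.
  rewrite /symproj e eqxx ?nb muln1 addn1.
  set m := count id b in e hla hlb *.
  have g1 := gbin_neq0 hlb.
  have G1 : (1 - x ^+ m.+1) * gb k.+2 m.+1 = (1 - x ^+ k.+2) * gb k.+1 m.
    by rewrite gbin_succ2.
  have G2 : (1 - x ^+ (k.+1 - m)) * gb k.+1 m = (1 - x ^+ k.+1) * gb k m.
    have [hm|hm] := leqP m k; first by rewrite gbin_succ1.
    have -> : m = k.+1 by lia.
    by rewrite [gb k _]gbin_small // subnn expr0 subrr mul0r mulr0.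
  have h3 := gen (ltn0Sn m).
  have -> : gb k.+2 m.+1 = (1 - x ^+ k.+2) * gb k.+1 m / (1 - x ^+ m.+1).
    by rewrite -G1 mulrC mulrA mulVf // mul1r.
  have -> : gb k m = (1 - x ^+ (k.+1 - m)) * gb k.+1 m / (1 - x ^+ k.+1).
    by rewrite G2 mulrC mulrA mulVf // mul1r.
  rewrite !mulrA; have -> : sy a * t^-1 ^+ (k.+1 - m) * sy b * t^-1 ^+ (k.+1 - m) =
     sy a * sy b * x ^+ (k.+1 - m).
    by rewrite -exprM mulnC muln2 -addnn exprD; ring.
  move: h2 h3; rewrite (_ : k.+2 = (k.+1 - m) + m.+1)%N ?exprD; last by lia.
  move: h1 g1; set X := x ^+ (k.+1 - m); set Y := x ^+ m.+1; set A := gb _ _.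
  set W := x ^+ k.+1 => h1 g1 h2 h3.
  by field; rewrite t0 h1 g1 h2 h3.
- have e : count id b = (count id a).+1 by lia.
  rewrite (gsum (count id a)) ?e ?addn0 ?addn1 // ?nb ?add0n ?addn0 ?addn1 !(muln1, muln0) sub0r.
  rewrite /capc /cupc /bar /= !big_cons !big_nil ?expr0 !mulr1.
  set m := count id a in e hla hlb *; rewrite e in hlb.
  have g1 := gbin_neq0 hlb; have g2 := gbin_neq0 hla.
  have h3 := gen (ltn0Sn m).
  have G1 : (1 - x ^+ m.+1) * gb k.+2 m.+1 = (1 - x ^+ k.+2) * gb k.+1 m.
    by rewrite gbin_succ2.
  have G2 : (1 - x ^+ m.+1) * gb k.+1 m.+1 = (1 - x ^+ k.+1) * gb k m.
    by rewrite gbin_succ2 //; lia.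
  have -> : gb k.+2 m.+1 = (1 - x ^+ k.+2) * gb k.+1 m / (1 - x ^+ m.+1).
    by rewrite -G1 mulrC mulrA mulVf // mul1r.
  have -> : gb k m = (1 - x ^+ m.+1) * gb k.+1 m.+1 / (1 - x ^+ k.+1).
    by rewrite G2 mulrC mulrA mulVf // mul1r.
  rewrite (_ : k.+1 - m = (k - m).+1)%N ?[t^-1 ^+ (k - m).+1]exprS; last by lia.
  move: h1 g1 g2 h2 h3; set X := x ^+ m.+1; set A := gb _ _; set B := gb _ _.
  set W := x ^+ k.+1; set U := x ^+ k.+2; set Z := t^-1 ^+ (k - m) => h1 g1 g2 h2 h3.
  by field; rewrite t0 h1 g1 g2 h2 h3.
- have e : count id a = (count id b).+1 by lia.
  rewrite (gsum (count id b)) ?e ?addn0 ?addn1 // ?nb ?add0n ?addn0 ?addn1 !(muln1, muln0) sub0r.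
  rewrite /capc /cupc /bar /= !big_cons !big_nil ?expr0 !mulr1.
  set m := count id b in e hla hlb *; rewrite e in hla.
  have g1 := gbin_neq0 hlb; have g2 := gbin_neq0 hla.
  have h3 := gen (ltn0Sn m).
  have G1 : (1 - x ^+ m.+1) * gb k.+2 m.+1 = (1 - x ^+ k.+2) * gb k.+1 m.
    by rewrite gbin_succ2.
  have G2 : (1 - x ^+ m.+1) * gb k.+1 m.+1 = (1 - x ^+ k.+1) * gb k m.
    by rewrite gbin_succ2 //; lia.
  have -> : gb k.+2 m.+1 = (1 - x ^+ k.+2) * gb k.+1 m / (1 - x ^+ m.+1).
    by rewrite -G1 mulrC mulrA mulVf // mul1r.
  have -> : gb k m = (1 - x ^+ m.+1) * gb k.+1 m.+1 / (1 - x ^+ k.+1).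
    by rewrite G2 mulrC mulrA mulVf // mul1r.
  rewrite (_ : k.+1 - m = (k - m).+1)%N ?[t^-1 ^+ (k - m).+1]exprS; last by lia.
  move: h1 g1 g2 h2 h3; set X := x ^+ m.+1; set A := gb _ _; set B := gb _ _.
  set W := x ^+ k.+1; set U := x ^+ k.+2; set Z := t^-1 ^+ (k - m) => h1 g1 g2 h2 h3.
  by field; rewrite t0 h1 g1 g2 h2 h3.
- have e : count id a = count id b by lia.
  have -> : symproj k.+1 a b = sy a * sy b / gb k.+1 (count id b).
    by rewrite /symproj e eqxx.
  rewrite ?nb !muln0 expr0 mulr1 addn0.
  (* The cup needs a letter [true] from [a] and from [b]; if there is none, the correction term
     vanishes. *)
  case cb: (count id b) e gsum => [|m] e gsum.
    rewrite gsum0 ?mulr0 ?subr0; last by move=> l; rewrite e cb /bar /=; lia.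
    by rewrite !gbin0 mulr1.
  rewrite (gsum m) ?e ?cb ?addn1 // ?nb.
  rewrite cb in hlb.
  rewrite /capc /cupc /bar /= !big_cons !big_nil !mulr1.
  have g1 := gbin_neq0 hlb.
  have G1 : (1 - x ^+ (k.+2 - m.+1)) * gb k.+2 m.+1 = (1 - x ^+ k.+2) * gb k.+1 m.+1.
    by rewrite gbin_succ1.
  have G2 : (1 - x ^+ m.+1) * gb k.+1 m.+1 = (1 - x ^+ k.+1) * gb k m.
    by rewrite gbin_succ2 //; lia.
  have h3 : 1 - x ^+ (k.+2 - m.+1) != 0 by apply: gen; lia.
  have -> : gb k.+2 m.+1 = (1 - x ^+ k.+2) * gb k.+1 m.+1 / (1 - x ^+ (k.+2 - m.+1)).
    by rewrite -G1 mulrC mulrA mulVf // mul1r.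
  have -> : gb k m = (1 - x ^+ m.+1) * gb k.+1 m.+1 / (1 - x ^+ k.+1).
    by rewrite G2 mulrC mulrA mulVf // mul1r.
  rewrite (_ : (k - m) * 2 = 2 * (k - m))%N ?exprM; last by lia.
  rewrite (_ : k.+2 - m.+1 = (k - m).+1)%N in h3 *; last by lia.
  move: h2; rewrite (_ : k.+2 = ((k - m).+1 + m.+1)%N) ?exprD; last by lia.
  rewrite [x ^+ (k - m).+1]exprS in h3 *.
  move: h1 h3 g1; set X := x ^+ (k - m); set Y := x ^+ m.+1; set A := gb _ _.
  set W := x ^+ k.+1 => h1 h3 g1 h2.
  by move: h3 h2; set u := t^-1 => h3 h2; field; rewrite h3 g1 h2 h1.
Qed.

Lemma jw_matrix k a b r r' : (k <= n)%N -> size a = k -> size b = k ->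
  size r = (n - k)%N -> size r' = (n - k)%N ->
  tlmat t (jones_wenzl t n k) (a ++ r) (b ++ r') =
  if r == r' then symproj k a b else 0.
Proof.
elim: k a b r r' => [|[|k] IHk] a b r r' hk ha hb hr hr'.
- case: a ha => // _; case: b hb => // _.
  rewrite [LHS]tlmat_id ?hr ?hr' ?subn0 // /symproj /= mulr1 divr1.
  by case: eqP; rewrite /sy //= expr0 ?mulr1.
- rewrite [LHS]tlmat_id ?size_cat ?ha ?hb ?hr ?hr' ?subnKC //.
  case: a ha => [|c [|? ?]] // _; case: b hb => [|d [|? ?]] // _ /=.
  rewrite eqseq_cons /symproj !sy1 /=.
  have g1 : gb 1 (c + 0)%N = 1 by case: c; rewrite /gbin /= ?mulr0 ?addr0.
  rewrite g1 !mulr1 divr1 !addn0.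
  by case: (r == r'); case: c {g1}; case: d.
by apply: jw_step => // *; apply: IHk => //; exact: ltnW.
Qed.

End JonesWenzlMatrix.

Import Order.TTheory Num.Theory.

(** * Evaluation of rational coefficients at q *)

Section Evaluation.
Variables (K : fieldType) (q : K).
Local Notation F := {fraction {poly K}}.
Local Notation tofrac := (@FracField.tofrac {poly K}).
Implicit Types (x y : F) (u v : K).

(** Regularity at [q] with value [v]. Any denominator nonzero at [q] may serve as witness, which
    makes sums and products immediate, in contrast with the reduced form used by [rat_eval]. *)
Definition ev x v := exists a b : {poly K},
  [/\ b.[q] != 0, x = tofrac a / tofrac b & v = a.[q] / b.[q]].

Lemma frac_repr x : x * tofrac (frac (repr x)).2 = tofrac (frac (repr x)).1.
Proof.
rewrite -{1}[x]reprK; unlock FracField.tofrac; rewrite -[LHS]FracField.pi_mul.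
apply/eqmodP; rewrite /= FracField.equivfE /FracField.mulf.
by rewrite !numden_Ratio ?oner_eq0 ?mulr1 ?oner_neq0 ?denom_ratioP // mulrC.
Qed.

(** The reduced denominator is coprime to the reduced numerator, hence divides [b] and cannot vanish
    at [q]. *)
Lemma rat_eval_ev x v : ev x v -> rat_eval q x = v.
Proof.
case=> a [b [b0 -> ->]]; pose y : F := tofrac a / tofrac b; rewrite /rat_eval -/y.
have := frac_repr y; set n := (frac _).1; set d := (frac _).2 => E.
have dn0 : d != 0 by exact: denom_ratioP.
have bn0 : b != 0 by apply: contra b0 => /eqP->; rewrite horner0.
have nb : n * b = a * d.
  apply/eqP; rewrite -tofrac_eq !tofracM -E /y mulrAC.
  by rewrite divfK ?tofrac_eq0.
have g0 : gcdp n d != 0 by rewrite gcdp_eq0 negb_and dn0 orbT.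
have nE : n = (n %/ gcdp n d) * gcdp n d by rewrite divpK ?dvdp_gcdl.
have dE : d = (d %/ gcdp n d) * gcdp n d by rewrite divpK ?dvdp_gcdr.
have cop : coprimep (n %/ gcdp n d) (d %/ gcdp n d).
  by apply: coprimep_div_gcd; rewrite dn0 orbT.
move: nb; rewrite {1}nE {3}dE mulrAC mulrA => /(mulIf g0).
move: cop; set n' := n %/ _; set d' := d %/ _ => cop nb.
have d'n0 : d' != 0.
  by apply: contra dn0 => /eqP e; rewrite dE -/d' e mul0r.
have : d' %| n' * b by rewrite nb dvdp_mull.
rewrite Gauss_dvdpr 1?coprimep_sym // => /dvdpP[h bE].
move: b0 nb; rewrite bE hornerM mulf_eq0 negb_or => /andP[h0 d0].
rewrite mulrA => /(mulIf d'n0) <-; rewrite hornerM.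
by rewrite [h.[q] * _]mulrC -mulf_div divff // mulr1.
Qed.

Lemma ev_inj x u v : ev x u -> ev x v -> u = v.
Proof. by move=> /rat_eval_ev <- /rat_eval_ev. Qed.

Lemma ev_poly (a : {poly K}) : ev (tofrac a) a.[q].
Proof.
by exists a, 1; rewrite !hornerC oner_neq0 tofrac1 !divr1.
Qed.

Lemma ev0 : ev 0 0. Proof. by have := ev_poly 0; rewrite tofrac0 horner0. Qed.
Lemma ev1 : ev 1 1. Proof. by have := ev_poly 1; rewrite tofrac1 hornerC. Qed.

Lemma evN x u : ev x u -> ev (- x) (- u).
Proof.
case=> a [b [b0 -> ->]]; exists (- a), b; split=> //; first by rewrite tofracN mulNr.
by rewrite hornerN mulNr.
Qed.

Lemma evD x y u v : ev x u -> ev y v -> ev (x + y) (u + v).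
Proof.
case=> a [b [b0 -> ->]] [c [d [d0 -> ->]]]; exists (a * d + c * b), (b * d).
have f0 (e : {poly K}) : e.[q] != 0 -> tofrac e != 0.
  by apply: contra; rewrite tofrac_eq0 => /eqP->; rewrite horner0.
split; first by rewrite hornerM mulf_neq0.
  by rewrite tofracM tofracD !tofracM addf_div ?f0.
by rewrite hornerM hornerD !hornerM addf_div.
Qed.

Lemma evB x y u v : ev x u -> ev y v -> ev (x - y) (u - v).
Proof. by move=> h k; apply: evD => //; apply: evN. Qed.

Lemma evM x y u v : ev x u -> ev y v -> ev (x * y) (u * v).
Proof.
case=> a [b [b0 -> ->]] [c [d [d0 -> ->]]]; exists (a * c), (b * d); split.
- by rewrite hornerM mulf_neq0.
- by rewrite !tofracM mulf_div.
- by rewrite !hornerM mulf_div.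
Qed.

Lemma evV x u : u != 0 -> ev x u -> ev x^-1 u^-1.
Proof.
move=> u0 [a [b [b0 xE uE]]]; exists b, a; rewrite xE uE !invf_div; split=> //.
by apply: contra u0; rewrite uE => /eqP->; rewrite mul0r.
Qed.

Lemma evX x u k : ev x u -> ev (x ^+ k) (u ^+ k).
Proof. by move=> h; elim: k => [|k IHk]; rewrite ?expr0 ?exprS; [exact: ev1 | exact: evM]. Qed.

Lemma ev_sum (I : Type) (r : seq I) (P : pred I) (f : I -> F) (g : I -> K) :
  (forall i, P i -> ev (f i) (g i)) ->
  ev (\sum_(i <- r | P i) f i) (\sum_(i <- r | P i) g i).
Proof. by move=> h; apply: (big_ind2 ev); [exact: ev0 | move=> *; exact: evD | ]. Qed.

Lemma ev_prod (I : Type) (r : seq I) (P : pred I) (f : I -> F) (g : I -> K) :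
  (forall i, P i -> ev (f i) (g i)) ->
  ev (\prod_(i <- r | P i) f i) (\prod_(i <- r | P i) g i).
Proof. by move=> h; apply: (big_ind2 ev); [exact: ev1 | move=> *; exact: evM | ]. Qed.

Lemma ev_bool (b : bool) : ev b%:R b%:R.
Proof. by case: b; [exact: ev1 | exact: ev0]. Qed.

(* A simple pole at q is cancelled by a zero. *)
Lemma ev_pole x y u : ev x 0 -> x = y * tofrac ('X - q%:P) -> exists v, ev y v.
Proof.
case=> a [b [b0 xE /esym/eqP]]; rewrite mulf_eq0 invr_eq0 (negPf b0) orbF => a0 yE.
have /factor_theorem[c cE] : root a q by [].
exists (c.[q] / b.[q]), c, b; split=> //.
have X0 : tofrac ('X - q%:P) != 0 by rewrite tofrac_eq0 polyXsubC_eq0.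
by apply: (mulIf X0); rewrite -yE xE cE tofracM mulrAC.
Qed.

Hypothesis q0 : q != 0.
Local Notation t := (tofrac 'X).

Lemma ev_t : ev t q. Proof. by have := ev_poly 'X; rewrite hornerX. Qed.
Lemma ev_tV : ev t^-1 q^-1. Proof. exact: evV ev_t. Qed.
Lemma evN1 k : ev ((-1) ^+ k) ((-1) ^+ k). Proof. by apply/evX/evN/ev1. Qed.

Lemma ev_cap b1 b2 : ev (cap_coef t b1 b2) (cap_coef q b1 b2).
Proof. by case: b1; case: b2; [exact: ev0 | exact: ev_tV | exact/evN/ev1 | exact: ev0]. Qed.

Lemma ev_cup b1 b2 : ev (cup_coef t b1 b2) (cup_coef q b1 b2).
Proof. by case: b1; case: b2; [exact: ev0 | exact: ev1 | exact/evN/ev_t | exact: ev0]. Qed.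

Lemma ev_sy s : ev (sy t s) (sy q s). Proof. exact/evX/ev_tV. Qed.

Lemma ev_gbin z m : ev (gbin (t^-1 ^+ 2) z m) (gbin (q^-1 ^+ 2) z m).
Proof.
elim: z m => [|z IHz] [|m]; rewrite ?gbinS; try exact: ev1; first exact: ev0.
by apply: evD => //; apply: evM => //; apply/evX/evX/ev_tV.
Qed.

Lemma ev_dmat n (D : tl_diagram n) s' s : ev (dmat t D s' s) (dmat q D s' s).
Proof.
apply: ev_prod => z _; rewrite /ptfac; case: z => j; case: (D _) => k.
- case: ifP => _; last exact: ev1.
  by apply: evM; [exact: evN1 | exact: ev_cap].
- exact: ev_bool.
- exact: ev1.
- case: ifP => _; last exact: ev1.
  by apply: evM; [exact: evN1 | exact: ev_cup].
Qed.

End Evaluation.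

(** * Noncrossing matchings and their left endpoints *)

Section Openers.
Variable n : nat.
Implicit Types D : tl_diagram n.
Local Notation lt := (plt (@tl_pos n)).
Let pi := @tl_pos_inj n.

(** If the two matchings differ at [x], the shorter of the two arcs at [x] covers the left end of a
    still shorter arc on which they differ. Hence an induction on length, symmetric in the two
    matchings. *)
Lemma same_openers (M M' : tl_pt n -> tl_pt n) : tl_planar M -> tl_planar M' ->
  (forall x, lt x (M x) = lt x (M' x)) -> M =1 M'.
Proof.
have main d : forall (M M' : tl_pt n -> tl_pt n), tl_planar M -> tl_planar M' ->
  (forall x, lt x (M x) = lt x (M' x)) -> forall x, lt x (M x) ->
  (tl_pos (M x) - tl_pos x <= d)%N -> M x = M' x.
  elim: d => [|d IHd] {M M'} M M' plM plM' op x hx hd.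
    by move: hx hd; rewrite /plt; lia.
  have [MK Mf _ Mc] := plM; have [MK' Mf' _ Mc'] := plM'.
  have hx' : lt x (M' x) by rewrite -op.
  have step N N' : tl_planar N -> tl_planar N' -> (forall x, lt x (N x) = lt x (N' x)) ->
     lt x (N x) -> (tl_pos (N x) < tl_pos (N' x))%N ->
     exists z, [/\ lt z (N z), (tl_pos (N z) - tl_pos z < tl_pos (N x) - tl_pos x)%N
        & N z != N' z].
    move=> plN plN' op' h1 h2; have [NK Nf _ Nc] := plN; have [NK' Nf' _ Nc'] := plN'.
    set y := N x in h1 h2 *; set z := N' y.
    have yop : lt y (N' y) = false.
      by rewrite -op' /y NK ltC // -/y 1?eq_sym ?Nf // h1.
    have zy : lt z y by rewrite (ltC pi (_ : y != z)) ?yop // eq_sym Nf'.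
    have yx : y != x by rewrite Nf.
    have yN'x : y != N' x by apply: contraTneq h2 => <-; rewrite ltnn.
    have := Nc' x y isT isT yx yN'x; rewrite /crossing -/z.
    rewrite h1 (_ : lt (N' x) y = false); last by rewrite /plt; lia.
    have -> : lt (N' x) z = false by move: zy h2; rewrite /plt; lia.
    case xz: (lt x z) => // _.
    have zop : lt z (N z) by rewrite op' /z NK'.
    have zx : z != x by apply: contraTneq xz => ->; rewrite /plt ltnn.
    have zNx : z != N x by rewrite Nf'.
    have Nzy : N z != y by rewrite (inj_eq (can_inj NK)).
    exists z; rewrite zop /z NK' -/z Nzy; split=> //.
    have := Nc x z isT isT zx zNx; rewrite /crossing -/y xz (ltC pi zNx) zy /=.
    have : tl_pos (N z) != tl_pos y by rewrite (inj_eq pi).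
    by move: zop xz zy h1; rewrite /plt; lia.
  apply/eqP; apply: contraT => ne.
  have : tl_pos (M x) != tl_pos (M' x) by rewrite (inj_eq pi).
  rewrite neq_ltn => /orP[] h.
    have [z [z1 z2 /eqP[]]] := step M M' plM plM' op hx h.
    by apply: IHd => //; lia.
  have [z [z1 z2 /eqP[]]] := step M' M plM' plM (fun x => esym (op x)) hx' h.
  by apply: IHd => //; lia.
move=> plM plM' op x; have [h|h] := boolP (lt x (M x)).
  exact: (main _ M M' plM plM' op x h (leqnn _)).
have [MK Mf _ Mc] := plM; have [MK' Mf' _ Mc'] := plM'.
have h' : lt (M x) (M (M x)) by rewrite MK (ltC pi (_ : x != M x)) // eq_sym Mf.
have := main _ M M' plM plM' op (M x) h' (leqnn _).
by rewrite MK => e; rewrite [in RHS]e MK'.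
Qed.

(** The total length of the arcs, by which the system for the coefficients is triangular. *)
Definition area D : int := \sum_(x | lt x (D x)) ((tl_pos (D x))%:Z - (tl_pos x)%:Z).

(** Each arc of [D'] joins a left end and a right end of [D]. Positions summed with the signs given
    by [D] yield [area D]; grouped along [D'], each arc contributes at most its length, and less if
    its left end is a right end of [D]. The latter must occur, by [same_openers]. *)
Lemma area_lt D D' : (forall x, lt (D' x) (D (D' x)) = ~~ lt x (D x)) -> D' != D ->
  area D < area D'.
Proof.
move=> alt ne; have plD := diagram_planar D; have plD' := diagram_planar D'.
have [DK Df _ _] := plD; have [DK' Df' _ _] := plD'.
pose f x : int := if lt x (D x) then - (tl_pos x)%:Z else (tl_pos x)%:Z.
have E : area D = \sum_x f x.
  rewrite (big_pairs _ _ pi DK Df) /=; apply: eq_bigr => x hx.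
  have ne' : x != D x by rewrite eq_sym Df.
  by rewrite /f DK (ltC pi ne') hx addrC.
have E' : \sum_x f x = \sum_(x | lt x (D' x)) (f x + f (D' x)).
  by rewrite (big_pairs _ _ pi DK' Df').
have [h|] := boolP [forall x, lt x (D' x) ==> lt x (D x)].
  case/eqP: ne; apply/val_inj/ffunP; apply: same_openers => // x.
  have [hx|hx] := boolP (lt x (D' x)); first by have /implyP/(_ hx) := forallP h x.
  have hx' : lt (D' x) (D' (D' x)).
    by rewrite DK' (ltC pi (_ : x != D' x)) // eq_sym Df'.
  have := implyP (forallP h (D' x)) hx'.
  by rewrite alt => /negPf ->.
rewrite negb_forall => /existsP[x0]; rewrite negb_imply => /andP[x1 x2].
rewrite E E' /area (bigD1 x0) //= [X in _ < X](bigD1 x0) //=.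
have ft x : lt x (D' x) -> f x + f (D' x) <= (tl_pos (D' x))%:Z - (tl_pos x)%:Z.
  by move=> hx; rewrite /f alt; move: hx; rewrite /plt; case: ifP => _ /=; lia.
apply: ltr_leD; last by apply: ler_sum => x /andP[]; move=> /ft.
rewrite /f alt (negPf x2) /=; move: x1; rewrite /plt; move: (tl_pos x0) (tl_pos (D' x0)) => A B; clear; lia.
Qed.

End Openers.

(** * From regular matrix entries to regular coefficients *)

Section EvaluationOfCoefficients.
Variables (K : fieldType) (q : K) (n : nat).
Hypothesis q0 : q != 0.
Local Notation F := {fraction {poly K}}.
Local Notation t := (@FracField.tofrac {poly K} 'X).
Local Notation lt := (plt (@tl_pos n)).
Variable g : tl_alg F n.
Hypothesis reg : forall s' s, size s' = n -> size s = n ->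
  exists v, ev q (tlmat t g s' s) v.

Let opener (D : tl_diagram n) x := lt x (D x).
(** Together with [w] these words are adapted to [D]: with inputs read negated, every arc has [true]
    at its left end and [false] at its right end, so the entry of [D] there does not vanish. *)
Let w' (D : tl_diagram n) := [seq opener D (inl j) | j <- enum 'I_n].
Let w (D : tl_diagram n) := [seq ~~ opener D (inr j) | j <- enum 'I_n].

Let size_w' D : size (w' D) = n. Proof. by rewrite size_map size_enum_ord. Qed.
Let size_w D : size (w D) = n. Proof. by rewrite size_map size_enum_ord. Qed.

Let bitE D z : ptbit (w' D) (w D) z =
  match z with inl _ => opener D z | inr _ => ~~ opener D z end.
Proof.
by case: z => j /=; rewrite (nth_map j) ?size_enum_ord ?nth_ord_enum.
Qed.

Let diag_neq0 (T : fieldType) (r : T) D : r != 0 -> dmat r D (w' D) (w D) != 0.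
Proof.
move=> r0; apply/prodf_neq0 => z _; rewrite !bitE /ptfac /opener.
have [DK Df _ _] := diagram_planar D; have pi := @tl_pos_inj n.
have s (k : nat) : (-1) ^+ k != 0 :> T by rewrite signr_eq0.
case: z => j; case e: (D _) => [k|k]; rewrite ?oner_neq0 //.
- have ek : D (inl k) = inl j by rewrite -e DK.
  rewrite ek /plt /=; case: ltngtP => h; rewrite ?oner_neq0 //=.
  by rewrite mulf_neq0 ?invr_neq0.
- have ek : D (inr k) = inl j by rewrite -e DK.
  rewrite ek /plt /= (_ : (j < _)%N); last by have := ltn_ord j; have := ltn_ord k; lia.
  rewrite (_ : (_ < j)%N = false) ?oner_neq0 //.
  by have := ltn_ord j; have := ltn_ord k; lia.
- have ek : D (inr k) = inr j by rewrite -e DK.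
  rewrite ek /plt /=; case: ltnP => h; rewrite ?oner_neq0 //=.
  have -> : ((2 * n).-1 - j < (2 * n).-1 - k)%N = false.
    by have := ltn_ord j; have := ltn_ord k; lia.
  have -> : ((2 * n).-1 - k < (2 * n).-1 - j)%N.
    by have := ltn_ord j; have := ltn_ord k; lia.
  by rewrite /= mulr1.
Qed.

Let dmat_alt (D D' : tl_diagram n) : dmat t D' (w' D) (w D) != 0 ->
  forall x, opener D (D' x) = ~~ opener D x.
Proof.
have [DK Df _ _] := diagram_planar D'; have pi := @tl_pos_inj n.
move=> nz; have {}nz z : ptfac t D' z (ptbit (w' D) (w D) z) (ptbit (w' D) (w D) (D' z)) != 0.
  by apply: contra nz => /eqP e; rewrite /dmat (bigD1 z) //= e mul0r.
have half x : lt x (D' x) -> opener D (D' x) = ~~ opener D x.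
  move=> hx; have := nz x; have := nz (D' x); rewrite DK !bitE /ptfac.
  case: x hx => j; case e: (D' _) => [k|k]; rewrite /plt /= => hx.
  - rewrite hx => _; rewrite mulf_eq0 signr_eq0 /=.
    by case: (opener D _); case: (opener D _) => //=; rewrite eqxx.
  - by move=> _; case: (opener D _); case: (opener D _) => //=; rewrite eqxx.
  - by exfalso; have := ltn_ord j; have := ltn_ord k; lia.
  - have ek : D' (inr k) = inr j by rewrite -e DK.
    rewrite ek (_ : (k < j)%N); last by have := ltn_ord j; have := ltn_ord k; lia.
    move=> + _; rewrite mulf_eq0 signr_eq0 /=.
    by case: (opener D _); case: (opener D _) => //=; rewrite eqxx.
move=> x; have [h|h] := boolP (lt x (D' x)); first exact: half.
have := half (D' x); rewrite DK (ltC pi (_ : x != D' x)) 1?eq_sym ?Df // h.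
by move=> /(_ isT) ->; rewrite negbK.
Qed.

(** At the words adapted to [D] only [D] and diagrams of larger area have nonzero entries. So [g D]
    is determined by one entry of [g] and by coefficients known from a descending induction on the
    area, which is bounded. *)
Lemma coef_regular D : exists v, ev q (g D) v.
Proof.
have bounded (D' : tl_diagram n) : area D' <= (2 * n * #|tl_pt n|)%N%:Z.
  rewrite /area; apply: (@le_trans _ _ (\sum_(x : tl_pt n) (2 * n)%N%:Z)).
    rewrite big_mkcond; apply: ler_sum => x _; case: ifP => // _.
    by have := tl_pos_lt (D' x); lia.
  by rewrite sumr_const -mulr_natr natz -PoszM.
have [m] := ubnP `|(2 * n * #|tl_pt n|)%N%:Z - area D|%N.
elim: m D => // m IHm D hm.
have t0 : t != 0 by rewrite tofrac_eq0 polyX_eq0.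
have [v hv] := reg (size_w' D) (size_w D).
have nz := diag_neq0 D t0; have nzq := diag_neq0 D q0.
have E : g D = (tlmat t g (w' D) (w D) -
   \sum_(D' | D' != D) g D' * dmat t D' (w' D) (w D)) / dmat t D (w' D) (w D).
  by rewrite /tlmat (bigD1 D) //= addrK mulfK.
have sumreg : exists u, ev q (\sum_(D' | D' != D) g D' * dmat t D' (w' D) (w D)) u.
  apply: (big_ind (fun y => exists u, ev q y u)).
  - by exists 0; exact: ev0.
  - by move=> y1 y2 [u1 h1] [u2 h2]; exists (u1 + u2); exact: evD.
  move=> D' ne; have [->|nz'] := eqVneq (dmat t D' (w' D) (w D)) 0.
    by exists 0; rewrite mulr0; exact: ev0.
  have lt_area := area_lt (dmat_alt nz') ne.
  have [|u hu] := IHm D'.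
    by have := bounded D; have := bounded D'; move: hm lt_area; lia.
  by exists (u * dmat q D' (w' D) (w D)); apply: evM => //; exact: ev_dmat.
have [u hu] := sumreg.
exists ((v - u) / dmat q D (w' D) (w D)); rewrite E; apply: evM; first exact: evB.
by apply: evV => //; exact: ev_dmat.
Qed.

Lemma tl_eval_coef D : ev q (g D) (tl_eval q g D).
Proof. by have [v hv] := coef_regular D; rewrite ffunE (rat_eval_ev hv). Qed.

Lemma tl_eval_mat s' s : ev q (tlmat t g s' s) (tlmat q (tl_eval q g) s' s).
Proof.
by apply: ev_sum => D _; apply: evM; [exact: tl_eval_coef | exact: ev_dmat].
Qed.

End EvaluationOfCoefficients.

(** * The idempotents at a root of unity *)

Lemma dmat_zeros (F : fieldType) (t : F) n (D : tl_diagram n) : D != id_diagram n ->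
  dmat t D (nseq n false) (nseq n false) = 0.
Proof.
move=> ne; have plD := diagram_planar D.
have [j [k [jk e]]] := adjacent_out plD (id_diagramP ne).
rewrite /dmat (bigD1 (inl j)) //= /ptfac e jk ltnSn /=.
by rewrite !nth_nseq !if_same /= mulr0 mul0r.
Qed.

(** Every other diagram has a cap on two neighbouring outputs and vanishes on equal letters, so one
    entry reads off the coefficient of the identity. *)
Lemma tlmat_zeros (F : fieldType) (t : F) n (f : tl_alg F n) :
  tlmat t f (nseq n false) (nseq n false) = f (id_diagram n).
Proof.
rewrite /tlmat (bigD1 (id_diagram n)) //= dmat_id ?size_nseq // eqxx mulr1.
by rewrite big1 ?addr0 // => D ne; rewrite dmat_zeros ?mulr0.
Qed.

Section Generic.
Variable K : fieldType.
Local Notation F := {fraction {poly K}}.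
Local Notation t := (@FracField.tofrac {poly K} 'X).

Lemma gen_t0 : t != 0. Proof. by rewrite tofrac_eq0 polyX_eq0. Qed.

Lemma gen_Xn k : (0 < k)%N -> t ^+ k != 1.
Proof.
move=> k0; rewrite -tofracXn -tofrac1 tofrac_eq; apply/eqP => /(congr1 (size : {poly K} -> nat)).
by rewrite size_polyXn size_poly1; lia.
Qed.

Lemma gen_x k : (0 < k)%N -> 1 - t^-1 ^+ 2 ^+ k != 0.
Proof.
move=> k0; rewrite subr_eq0 -exprM exprVn eq_sym invr_eq1.
by apply: gen_Xn; rewrite muln_gt0.
Qed.

Lemma gen_d0 : t + t^-1 != 0.
Proof.
apply/eqP => /(congr1 ( *%R t)); rewrite mulrDr divff ?gen_t0 // mulr0.
rewrite -expr2 -tofracXn -tofrac1 -tofracD -tofrac0 => /eqP; rewrite tofrac_eq => /eqP.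
move/(congr1 (fun f : {poly K} => f`_2)); rewrite coefD coefXn coef1 coef0 addr0 /=.
by apply/eqP; rewrite oner_neq0.
Qed.

Lemma corrected_jw_matrix n k a m c d : n = (a + 2 * m)%N -> k = (a + m)%N ->
  forall s v s' u, size s = k -> size v = m -> size s' = k -> size u = m ->
  tlmat t (corrected_jw t n k a m c d) (s ++ v) (s' ++ u) =
  symproj t n (s ++ v) (s' ++ u) + qnum t c / qnum t d *
    (capc t (bar v) * cupc t (bar u) *
     \sum_(e <- words a) symproj t k s (e ++ bar v) * symproj t k (e ++ bar u) s').
Proof.
move=> hn hk s v s' u hs hv hs' hu.
have han : (a + 2 * m <= n)%N by rewrite hn.
rewrite /corrected_jw tlmatD tlmatZ; congr (_ + _ * _).
  rewrite -[s ++ v]cats0 -[s' ++ u]cats0 (jw_matrix gen_t0 gen_d0 gen_x) //; try lia.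
  - by rewrite eqxx !cats0.
  - by rewrite size_cat hs hv; lia.
  - by rewrite size_cat hs' hu; lia.
  - by rewrite subnn.
  - by rewrite subnn.
rewrite -[s ++ v]cats0 -[s' ++ u]cats0 -!catA.
rewrite (@sandwich _ t gen_t0 gen_d0 n (jones_wenzl t n k) (symproj t k) a m) ?eqxx //=;
  rewrite -?hk //; try lia.
by move=> *; apply: (jw_matrix gen_t0 gen_d0 gen_x) => //; lia.
Qed.

(** Read off at the all-[false] words, where the correction vanishes because its cap asks for [m]
    letters [true]; the generic coefficient is already the constant 1. *)
Lemma corrected_jw_id (q : K) n k a m c d : n = (a + 2 * m)%N -> k = (a + m)%N ->
  (0 < m)%N -> tl_eval q (corrected_jw t n k a m c d) (id_diagram n) = 1.
Proof.
move=> hn hk m0; rewrite ffunE -(tlmat_zeros t).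
have -> : nseq n false = nseq k false ++ nseq m false.
  by rewrite cat_nseq /ncons -iterD -/(ncons _ _ _) -/(nseq _ _) hn hk; congr nseq; lia.
rewrite corrected_jw_matrix ?size_nseq // [X in _ * (_ * X)]big1 ?mulr0 ?addr0.
  have -> : nseq k false ++ nseq m false = nseq n false.
    by rewrite cat_nseq /ncons -iterD -/(ncons _ _ _) -/(nseq _ _) hn hk; congr nseq; lia.
  have cz j : count id (nseq j false) = 0%N by rewrite count_nseq.
  have iz : inv (nseq n false) = 0%N by have := inv_nseq 0 n.
  rewrite /symproj eqxx cz /sy iz !expr0 gbin0 mulr1 divr1.
  by apply: rat_eval_ev; exact: ev1.
move=> e _; rewrite /symproj !count_cat count_bar !count_nseq /= mul0n mul1n.
by rewrite eq_sym addn_eq0 (gtn_eqF m0) andbF mul0r.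
Qed.

End Generic.

Section GaussianProducts.
Variables (R : comPzRingType) (x : R).

(** Absorption iterated [i] times, again without division, since some of the factors vanish at a
    root of unity. *)
Lemma gbin_addr i M l : (l <= M)%N ->
  (\prod_(j < i) (1 - x ^+ (l + j.+1))) * gbin x (M + i) (l + i) =
  (\prod_(j < i) (1 - x ^+ (M + j.+1))) * gbin x M l.
Proof.
move=> lM; elim: i => [|i IHi]; first by rewrite !big_ord0 !mul1r !addn0.
rewrite !big_ord_recr /= -mulrA !addnS gbin_succ2 ?leq_add2r //.
by rewrite mulrCA IHi; ring.
Qed.

Lemma gbin_subr i M l : (i + l <= M)%N ->
  (\prod_(j < i) (1 - x ^+ (M - l - j))) * gbin x M l =
  (\prod_(j < i) (1 - x ^+ (M - j))) * gbin x (M - i) l.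
Proof.
elim: i => [|i IHi] h; first by rewrite !big_ord0 !mul1r !subn0.
rewrite !big_ord_recr /= mulrAC IHi; last by lia.
rewrite -!mulrA; congr (_ * _).
have -> : (M - i = (M - i.+1).+1)%N by lia.
rewrite -gbin_succ1; last by lia.
by rewrite mulrC; congr ((1 - x ^+ _) * _); lia.
Qed.

End GaussianProducts.

(** * Gaussian binomials at a root of unity *)

Section AtRoot.
Variables (K : fieldType) (q : K) (p : nat).
Hypotheses (p2 : (2 <= p)%N) (q0 : q != 0) (qp : q ^+ p = -1).
Local Notation x := (q^-1 ^+ 2).
Hypothesis xj : forall j, (0 < j < p)%N -> 1 - x ^+ j != 0.

Lemma xp : x ^+ p = 1.
Proof. by rewrite -exprM mulnC exprM exprVn qp invrN1 sqrrN expr1n. Qed.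

Lemma x2pD j : x ^+ (2 * p + j) = x ^+ j.
Proof. by rewrite exprD mulnC exprM xp expr1n mul1r. Qed.

Lemma x_neq j : ~~ (p %| j)%N -> 1 - x ^+ j != 0.
Proof.
move=> nd; rewrite (divn_eq j p) exprD mulnC exprM xp expr1n mul1r; apply: xj.
by rewrite lt0n -/(dvdn p j) nd ltn_mod; lia.
Qed.

Lemma x0 : x != 0. Proof. by rewrite expf_neq0 ?invr_neq0. Qed.

Lemma x_opp j : (j <= 2 * p)%N -> 1 - x ^+ (2 * p - j) = - x ^- j * (1 - x ^+ j).
Proof.
move=> hj; have e : x ^+ (2 * p - j) = x ^- j.
  apply: (mulIf (expf_neq0 j x0)); rewrite -exprD subnK // mulVf ?(expf_neq0 _ x0) //.
  by have := x2pD 0; rewrite addn0 expr0.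
by rewrite e mulNr mulrBr mulr1 mulVf ?(expf_neq0 _ x0) // opprB.
Qed.

(** The recursion in [m] degenerates when it passes [p], where the factor [1 - x ^+ p] is 0. It is
    therefore run upwards from 0 for [m < p] and downwards from [2p - 1] for the others. *)
Lemma gM_neq0 m : (m <= 2 * p - 1)%N -> gbin x (2 * p - 1) m != 0.
Proof.
have low k : (k < p)%N -> gbin x (2 * p - 1) k != 0.
  elim: k => [|k IHk] hk; first by rewrite gbin0 oner_neq0.
  have := IHk (ltnW hk); apply: contra => /eqP e.
  have := gbin_succ x (_ : (k <= 2 * p - 1)%N); rewrite e mulr0 => h.
  have /esym/eqP : 0 = (1 - x ^+ (2 * p - 1 - k)) * gbin x (2 * p - 1) k by apply: h; lia.
  rewrite (_ : 2 * p - 1 - k = 2 * p - k.+1)%N ?x_opp; try lia.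
  rewrite !mulf_eq0 oppr_eq0 invr_eq0 expf_eq0 (negPf x0) andbF /=.
  by rewrite (negPf (xj _)) //; lia.
have high k : (k < p)%N -> gbin x (2 * p - 1) (2 * p - 1 - k) != 0.
  elim: k => [|k IHk] hk; first by rewrite subn0 gbinn oner_neq0.
  have := IHk (ltnW hk); apply: contra => /eqP e.
  have := gbin_succ x (_ : (2 * p - 1 - k.+1 <= 2 * p - 1)%N); rewrite e mulr0 => h.
  have {h} : (1 - x ^+ (2 * p - k.+1)) * gbin x (2 * p - 1) (2 * p - 1 - k) = 0.
    rewrite -[RHS](h _); last by lia.
    by rewrite (_ : (2 * p - 1 - k.+1).+1 = 2 * p - k.+1)%N; last (by lia);
      congr (_ * gbin _ _ _); lia.
  move/eqP; rewrite x_opp; last by lia.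
  rewrite !mulf_eq0 oppr_eq0 invr_eq0 expf_eq0 (negPf x0) andbF /=.
  by rewrite (negPf (xj _)) //; lia.
move=> hm; have [h|h] := ltnP m p; first exact: low.
by rewrite (_ : m = 2 * p - 1 - (2 * p - 1 - m))%N; [apply: high; lia | lia].
Qed.

Lemma gM_succ m : ~~ (p %| m.+1)%N -> (m < 2 * p - 1)%N ->
  gbin x (2 * p - 1) m.+1 = - x ^- m.+1 * gbin x (2 * p - 1) m.
Proof.
move=> nd hm; apply: (mulfI (x_neq nd)); rewrite gbin_succ; last exact: ltnW.
rewrite (_ : 2 * p - 1 - m = 2 * p - m.+1)%N ?x_opp; try lia.
by rewrite mulrCA !mulrA.
Qed.

(** These are the weights on which the correction of the idempotent vanishes, so that the first term
    has to be regular by itself. *)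
Lemma gN_neq0 i W : (0 < i < p)%N -> (W <= 2 * p + i - 1)%N ->
  (W < i)%N || (2 * p <= W)%N -> gbin x (2 * p + i - 1) W != 0.
Proof.
move=> hi hW hor; set N := (2 * p + i - 1)%N in hW *.
have low k : (k < i)%N -> gbin x N k != 0.
  elim: k => [|k IHk] hk; first by rewrite gbin0 oner_neq0.
  have := IHk (ltnW hk); apply: contra => /eqP e.
  have := gbin_succ x (_ : (k <= N)%N); rewrite e mulr0 => h.
  have /esym/eqP : 0 = (1 - x ^+ (N - k)) * gbin x N k by apply: h; lia.
  rewrite (_ : N - k = 2 * p + (i - k.+1))%N ?x2pD; last by lia.
  by rewrite mulf_eq0 (negPf (xj _)) //; lia.
have high k : (k < i)%N -> gbin x N (N - k) != 0.
  elim: k => [|k IHk] hk; first by rewrite subn0 gbinn oner_neq0.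
  have := IHk (ltnW hk); apply: contra => /eqP e.
  have := gbin_succ x (_ : (N - k.+1 <= N)%N); rewrite e mulr0 => h.
  have /eqP : (1 - x ^+ (2 * p + (i - k.+1))) * gbin x N (N - k) = 0.
    rewrite -[RHS](h _); last by lia.
    by congr ((1 - x ^+ _) * gbin _ _ _); lia.
  rewrite x2pD mulf_eq0 (negPf (xj _)) //; last by lia.
case/orP: hor => h; first exact: low.
by rewrite (_ : W = N - (N - W))%N; [apply: high; lia | lia].
Qed.

End AtRoot.

Ltac nlia :=
  repeat match goal with
  | H : context [@GRing.zero _] |- _ => clear H
  | H : context [@GRing.one _] |- _ => clear H
  | H : context [@ev] |- _ => clear H
  end; lia.

Lemma cross_div (T : fieldType) (a b c d e : T) : b != 0 -> c != 0 -> e != 0 ->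
  a * e = d * b * c -> a / (b * c) = d / e.
Proof.
move=> b0 c0 e0 h; apply: (mulIf e0); rewrite divfK // mulrAC h.
by field; rewrite b0 c0.
Qed.

Lemma cut_word (s : seq bool) m k : size s = (m + k)%N ->
  exists a v, [/\ s = a ++ v, size a = m & size v = k].
Proof.
move=> h; exists (take m s), (drop m s).
by rewrite cat_take_drop size_takel ?size_drop h ?leq_addr // addnC addnK.
Qed.

(** * Regularity at q of the idempotent on 2p+i-1 strands *)

Section MinusIdempotent.
Variables (K : fieldType) (q : K) (p i : nat).
Hypotheses (p2 : (2 <= p)%N) (q0 : q != 0) (qp : q ^+ p = -1).
Hypothesis char0 : forall m, (0 < m)%N -> m%:R != 0 :> K.
Local Notation x := (q^-1 ^+ 2).
Hypothesis xj : forall j, (0 < j < p)%N -> 1 - x ^+ j != 0.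
Hypothesis hi : (0 < i < p)%N.
Local Notation F := {fraction {poly K}}.
Local Notation t := (@FracField.tofrac {poly K} 'X).
Local Notation xt := (t^-1 ^+ 2).
Local Notation M := (2 * p - 1)%N.
Local Notation N := (2 * p + i - 1)%N.
Local Notation n := (2 * p - i - 1)%N.

Let ev_x : ev q xt x. Proof. exact/evX/ev_tV. Qed.
Let ev_1x k : ev q (1 - xt ^+ k) (1 - x ^+ k).
Proof. by apply: evB; [exact: ev1 | exact: evX]. Qed.

(** The zero at [q] is simple: the derivative of [X^(4p) - 1] there is [4p q^(4p-1)], which is
    nonzero in characteristic 0. *)
Lemma ev_den : exists h w,
  [/\ 1 - xt ^+ (2 * p) = h * FracField.tofrac ('X - q%:P), w != 0 & ev q h w].
Proof.
have q4p : q ^+ (4 * p) = 1.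
  by rewrite mulnC exprM qp -(signr_odd _ 4) expr0.
have /factor_theorem[c cE] : root ('X^(4 * p) - 1) q.
  by rewrite rootE !hornerE q4p subrr.
exists (t^-1 ^+ (4 * p) * FracField.tofrac c), (q^-1 ^+ (4 * p) * c.[q]); split.
- rewrite -mulrA -tofracM -cE tofracB tofracXn tofrac1 mulrBr mulr1 -exprMn.
  rewrite mulVf ?gen_t0 // expr1n -exprM; congr (_ - _ ^+ _); nlia.
- rewrite mulf_neq0 ?expf_neq0 ?invr_neq0 //.
  have := congr1 (fun f : {poly K} => (f^`()).[q]) cE.
  rewrite derivM derivB derivXn derivC derivXsubC !hornerE subrr mulr0 add0r => <-.
  by rewrite subr0 hornerMn hornerXn -mulr_natr mulf_neq0 ?expf_neq0 ?char0 //; nlia.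
- by apply: evM; [exact/evX/ev_tV | exact: ev_poly].
Qed.

Let xV j : x ^- j = q ^+ (2 * j).
Proof. by rewrite -exprM exprVn invrK. Qed.

Let mono v l : \prod_(j < v) (- x ^- (l + j.+1)) =
  (-1) ^+ v * q ^+ (2 * l * v + v * v.+1) :> K.
Proof.
elim: v => [|v IHv]; first by rewrite big_ord0 muln0 mul0n expr0 mulr1.
rewrite big_ord_recr /= IHv [(-1) ^+ v.+1]exprS xV.
rewrite (_ : 2 * l * v.+1 + v.+1 * v.+2 = 2 * l * v + v * v.+1 + 2 * (l + v.+1))%N; last by nlia.
by rewrite [q ^+ (_ + 2 * (l + v.+1))]exprD mulN1r mulNr mulrN mulrA.
Qed.

(** The cancellation of the poles. The left side is the value at [q] of [Y] multiplied by
    [1 - xt ^+ (2 * p)], all Gaussian binomials being rewritten over [2p - 1] letters. *)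
Let Yval_lhs_eq0 l v u : (l <= n)%N -> (v <= i)%N -> (u <= i)%N ->
  q^-1 ^+ ((M - l - v) * (i - v)) * q^-1 ^+ ((M - l - u) * (i - u)) *
   ((\prod_(j < i) (1 - x ^+ (l + j.+1))) /
    ((\prod_(j < i.-1) (1 - x ^+ (2 * p + j.+1))) * gbin x M l)) +
  q^-1 ^+ i * (1 - x ^+ (2 * p - i)) *
  ((-1) ^+ (i - v) * q^-1 ^+ v * ((-1) ^+ (i - u) * q ^+ (i - u)) *
    q^-1 ^+ ((n - l) * (v + u)) *
   ((\prod_(j < i) (1 - x ^+ (M - l - j))) * gbin x M l /
    \prod_(j < i) (1 - x ^+ (M - j))) /
   (gbin x M (l + v) * gbin x M (l + u))) = 0.
Proof.
move=> hl hv hu; set R := \prod_(j < i) (1 - x ^+ (l + j.+1)).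
have -> : \prod_(j < i) (1 - x ^+ (M - l - j)) =
    (-1) ^+ i * q ^+ (2 * l * i + i * i.+1) * R.
  rewrite -mono -big_split /=; apply: eq_bigr => j _; have := ltn_ord j => hj.
  by rewrite (_ : M - l - j = 2 * p - (l + j.+1))%N ?(x_opp q0 qp) //; nlia.
(* Both terms contain [R]. If it is nonzero, no multiple of [p] lies among [l+1, ..., l+i], so by
   [gM_succ] the binomials involved differ by monomials and only signs and powers of [q] remain to
   be compared. *)
have [R0|Rn] := eqVneq R 0; first by rewrite R0 !(mul0r, mulr0) addr0.
have nd j : (j < i)%N -> ~~ (p %| l + j.+1)%N.
  move=> hj; apply: contra Rn => /dvdnP[k e]; apply/eqP.
  by rewrite /R (bigD1 (Ordinal hj)) //= e mulnC exprM (xp qp) expr1n subrr mul0r.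
have gv w : (w <= i)%N -> gbin x M (l + w) =
    (-1) ^+ w * q ^+ (2 * l * w + w * w.+1) * gbin x M l.
  move=> hw; rewrite -mono; elim: w hw => [|w IHw] hw.
    by rewrite big_ord0 mul1r addn0.
  rewrite big_ord_recr /= addnS (gM_succ p2 q0 qp xj) -?addnS ?nd //; last by nlia.
  by rewrite IHw 1?ltnW //; ring.
have -> : \prod_(j < i) (1 - x ^+ (M - j)) = (-1) ^+ i * q ^+ (i * i.+1) *
   ((\prod_(j < i.-1) (1 - x ^+ (2 * p + j.+1))) * (1 - x ^+ i)).
  have := mono i 0; rewrite muln0 mul0n add0n => <-.
  transitivity ((\prod_(j < i) - x ^- (0 + j.+1)) * \prod_(j < i) (1 - x ^+ j.+1)).
    rewrite -big_split /=; apply: eq_bigr => j _; have := ltn_ord j => hj.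
    by rewrite (_ : M - j = 2 * p - j.+1)%N ?(x_opp q0 qp) //; nlia.
  congr (_ * _); have -> : i = i.-1.+1 by nlia.
  rewrite big_ord_recr /=; congr (_ * _).
  by apply: eq_bigr => j _; rewrite (x2pD qp).
set S := \prod_(j < i.-1) _.
have S0 : S != 0.
  by apply/prodf_neq0 => j _; rewrite (x2pD qp) xj //; have := ltn_ord j; nlia.
have xi0 : 1 - x ^+ i != 0 by apply: xj.
have gl0 : gbin x M l != 0 by apply: (gM_neq0 p2 q0 qp xj); nlia.
rewrite (x_opp q0 qp); last by nlia.
rewrite !gv // [q ^+ (2 * l * i + _)]exprD.
have s2 (k : nat) : (-1) ^+ k * (-1) ^+ k = 1 :> K by rewrite -expr2 sqrr_sign.
have sn0 (k : nat) : (-1) ^+ k != 0 :> K by rewrite signr_eq0.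
have qn0 (k : nat) : q ^+ k != 0 by rewrite expf_neq0.
have si w : (w <= i)%N -> (-1) ^+ (i - w) = (-1) ^+ i * (-1) ^+ w :> K.
  by move=> hw; rewrite -{2}(subnK hw) exprD -mulrA s2 mulr1.
rewrite !si // xV.
move: (gbin x M l) gl0 (1 - x ^+ i) xi0 => g g0 xi xi1.
have [di hdi] : exists d, d = (2 * i)%N by exists (2 * i)%N.
rewrite -hdi.
rewrite ![q^-1 ^+ _]exprVn.
have X : q ^+ (i + v + (n - l) * (v + u) + (2 * l * v + v * v.+1) +
      (2 * l * u + u * u.+1)) =
    q ^+ ((M - l - v) * (i - v) + (M - l - u) * (i - u) + di + (i - u) + 2 * l * i).
  (* The exponents agree modulo [4p]; multiples of [4p] are added on both sides to stay within
     natural numbers. *)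
  have E : (i + v + (n - l) * (v + u) + (2 * l * v + v * v.+1) +
      (2 * l * u + u * u.+1) + p * (4 * i) = (M - l - v) * (i - v) +
      (M - l - u) * (i - u) + di + (i - u) + 2 * l * i + p * (4 * (v + u)))%N.
    rewrite hdi; have e1 : (n = l + (n - l))%N by nlia.
    have e2 : (M - l - v = n - l + (i - v))%N by nlia.
    have e3 : (M - l - u = n - l + (i - u))%N by nlia.
    have e4 : (2 * p = l + (n - l) + i + 1)%N by nlia.
    rewrite e2 e3; move: (n - l)%N e4 => m e4.
    have [v' hv'] : exists v', i = (v + v')%N by exists (i - v)%N; nlia.
    have [u' hu'] : exists u', i = (u + u')%N by exists (i - u)%N; nlia.
    have -> : (i - v = v')%N by nlia.
    have -> : (i - u = u')%N by nlia.
    have h k : (p * (4 * k) = 2 * (2 * p) * k)%N by nlia.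
    rewrite !h e4 -[v.+1]addn1 -[u.+1]addn1; apply/eqP; rewrite -eqz_nat !(PoszD, PoszM); apply/eqP.
    have -> : Posz v' = Posz i - Posz v by nlia.
    have -> : Posz u' = Posz i - Posz u by nlia.
    ring.
  have q4 k : q ^+ (p * (4 * k)) = 1.
    by rewrite exprM qp exprM -(signr_odd _ 4) expr0 expr1n.
  by have := congr1 (fun k => q ^+ k) E; rewrite /= !exprD !q4 !mulr1.
move: X; rewrite !exprD.
move: (sn0 i) (sn0 v) (sn0 u) (s2 i).
move: ((-1) ^+ i) ((-1) ^+ v) ((-1) ^+ u) => si1 sv su si0 sv0 su0 ss.
move: (qn0 ((M - l - v) * (i - v)))%N (qn0 ((M - l - u) * (i - u)))%N (qn0 i) (qn0 v)
  (qn0 ((n - l) * (v + u)))%N (qn0 (2 * l * v))%N (qn0 (v * v.+1))%N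
  (qn0 (2 * l * u))%N (qn0 (u * u.+1))%N (qn0 di)%N (qn0 (i - u))%N
  (qn0 (2 * l * i))%N (qn0 (i * i.+1))%N.
move: (q ^+ ((M - l - v) * (i - v))) (q ^+ ((M - l - u) * (i - u))) (q ^+ i) (q ^+ v)
  (q ^+ ((n - l) * (v + u))) (q ^+ (2 * l * v)) (q ^+ (v * v.+1))
  (q ^+ (2 * l * u)) (q ^+ (u * u.+1)) (q ^+ di) (q ^+ (i - u))
  (q ^+ (2 * l * i)) (q ^+ (i * i.+1)).
move=> a1 a2 b1 b2 b3 b4 b5 b6 b7 c1 c2 c3 c4 ha1 ha2 hb1 hb2 hb3 hb4 hb5 hb6 hb7.
move=> hc1 hc2 hc3 hc4 X.
transitivity (R / (S * g) * ((a1 * a2)^-1 -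
   (si1 * si1) * (c1 * c2 * c3) / (b1 * b2 * b3 * (b4 * b5) * (b6 * b7)))).
  field; by rewrite ha1 ha2 hb1 hb2 hb3 hb4 hb5 hb6 hb7 hc4 S0 g0 xi1 si0 sv0 su0.
rewrite ss X mul1r (_ : _ - _ = 0) ?mulr0 //.
by field; rewrite ha1 ha2 hc1 hc2 hc3.
Qed.

Local Notation gt := (gbin xt).

(** An entry of the corrected element divided by its four factors [sy]. Here [v] and [u] stand for
    the numbers of letters [true] in [bar v] and [bar u], and [l + i] is the total weight. *)
Let Y l v u : F :=
  t^-1 ^+ ((M - l - v) * (i - v)) * t^-1 ^+ ((M - l - u) * (i - u)) / gt N (l + i) +
  qnum t (2 * p - i) / qnum t (2 * p) *
  ((-1) ^+ (i - v) * t^-1 ^+ v * ((-1) ^+ (i - u) * t ^+ (i - u)) *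
    t^-1 ^+ ((n - l) * (v + u)) * gt n l / (gt M (l + v) * gt M (l + u))).

Let Y_regular l v u : (l <= n)%N -> (v <= i)%N -> (u <= i)%N ->
  exists w, ev q (Y l v u) w.
Proof.
move=> hl hv hu; have gx := @gen_x K; have [h [w [hE w0 hw]]] := ev_den.
have D0 : 1 - xt ^+ (2 * p) != 0 by apply: gx; nlia.
have h0 : h != 0 by apply: contra D0 => /eqP e; rewrite hE e mul0r.
pose R := \prod_(j < i) (1 - xt ^+ (l + j.+1)).
pose S := \prod_(j < i.-1) (1 - xt ^+ (2 * p + j.+1)).
pose R' := \prod_(j < i) (1 - xt ^+ (M - l - j)).
pose S' := \prod_(j < i) (1 - xt ^+ (M - j)).
(* [G] equals [Y l v u * (1 - xt ^+ (2 * p))], with the binomials on [N] and [n] letters expressed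
   by those on [M] letters, which do not vanish at [q]. Its value at [q] is 0, so dividing by the
   simple zero keeps it regular. *)
pose G := t^-1 ^+ ((M - l - v) * (i - v)) * t^-1 ^+ ((M - l - u) * (i - u)) *
   (R / (S * gt M l)) + t^-1 ^+ i * (1 - xt ^+ (2 * p - i)) *
  ((-1) ^+ (i - v) * t^-1 ^+ v * ((-1) ^+ (i - u) * t ^+ (i - u)) *
    t^-1 ^+ ((n - l) * (v + u)) * (R' * gt M l / S') / (gt M (l + v) * gt M (l + u))).
have R0 : R != 0 by apply/prodf_neq0 => j _; apply: gx; nlia.
have S0 : S != 0 by apply/prodf_neq0 => j _; apply: gx; nlia.
have S'0 : S' != 0 by apply/prodf_neq0 => j _; apply: gx; have := ltn_ord j; nlia.
have gMl : gt M l != 0 by apply: (gbin_neq0 gx); nlia.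
have gMv : gt M (l + v) != 0 by apply: (gbin_neq0 gx); nlia.
have gMu : gt M (l + u) != 0 by apply: (gbin_neq0 gx); nlia.
have gNl : gt N (l + i) != 0 by apply: (gbin_neq0 gx); nlia.
have E1 : R / (S * gt M l) = (1 - xt ^+ (2 * p)) / gt N (l + i).
  have := gbin_addr xt i (_ : (l <= M)%N); rewrite (_ : M + i = N)%N; last by nlia.
  move=> /(_ ltac:(nlia)); rewrite -/R.
  have -> : \prod_(j < i) (1 - xt ^+ (M + j.+1)) = (1 - xt ^+ (2 * p)) * S.
    rewrite [in LHS](_ : i = i.-1.+1); last by nlia.
    rewrite big_ord_recl /= (_ : M + 1 = 2 * p)%N; last by nlia.
    by congr (_ * _); apply: eq_bigr => j _; congr (1 - _ ^+ _); rewrite /bump /=; nlia.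
  exact: (cross_div S0 gMl gNl).
have E2 : gt n l = R' * gt M l / S'.
  have := @gbin_subr _ xt i M l; rewrite (_ : M - i = n)%N; last by nlia.
  by move=> /(_ ltac:(nlia)); rewrite -/R' -/S' => ->; rewrite mulrAC (divff S'0) mul1r.
have GE : G = Y l v u * (1 - xt ^+ (2 * p)).
  have := @qnum_ratioD _ t (gen_t0 K) gx (2 * p - i) i.
  rewrite subnK; last by nlia.
  move=> /(_ ltac:(nlia)) => c; rewrite /G /Y c E1 E2.
  move: (1 - xt ^+ (2 * p)) D0 => D D0.
  rewrite mulrDl; congr (_ + _); first by rewrite mulrA mulrAC.
  by rewrite [in RHS]mulrAC divfK.
have evG : ev q G 0.
  rewrite -(Yval_lhs_eq0 hl hv hu).
  have evg m : ev q (gt M m) (gbin x M m) by apply: ev_gbin.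
  have nz m : (m <= M)%N -> gbin x M m != 0 by apply: (gM_neq0 p2 q0 qp xj).
  have evt k : ev q (t^-1 ^+ k) (q^-1 ^+ k) by apply/evX/ev_tV.
  apply: evD; apply: evM.
  - by apply: evM.
  - apply: evM; first by apply: ev_prod => j _; apply: ev_1x.
    apply: evV; last first.
      by apply: evM => //; apply: ev_prod => j _; apply: ev_1x.
    rewrite mulf_neq0 ?nz //; last by nlia.
    apply/prodf_neq0 => j _; rewrite (x2pD qp) xj //; have := ltn_ord j; nlia.
  - by apply: evM => //; apply: ev_1x.
  - apply: evM; last first.
      apply: evV; first by rewrite mulf_neq0 ?nz //; nlia.
      exact: evM.
    apply: evM.
      apply: evM => //; apply: evM; apply: evM => //; try exact: evN1.
      exact/evX/ev_t.
    apply: evM.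
      by apply: evM => //; apply: ev_prod => j _; apply: ev_1x.
    apply: evV; last by apply: ev_prod => j _; apply: ev_1x.
    apply/prodf_neq0 => j _.
    rewrite (_ : M - j = 2 * p - j.+1)%N; last by nlia.
    rewrite (x_opp q0 qp); last by have := ltn_ord j; nlia.
    rewrite mulf_neq0 ?oppr_eq0 ?invr_eq0 ?(expf_neq0 _ (x0 q0)) //.
    by apply: xj; have := ltn_ord j; nlia.
apply: (@ev_pole _ _ (G / h) _ 0).
  by have := evM evG (evV w0 hw); rewrite mul0r.
rewrite GE. rewrite hE. rewrite [h * _]mulrC. rewrite mulrA. rewrite (mulfK h0). by [].
Qed.

Lemma capcE (T : fieldType) (r : T) u :
  capc r u = (-1) ^+ count negb u * r^-1 ^+ count id u.
Proof.
rewrite /capc; elim: u => [|b u IHu]; first by rewrite big_nil mulr1.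
rewrite big_cons IHu /=; case: b; rewrite /= ?add0n ?add1n exprS; first by rewrite mulrCA.
by rewrite mulrA.
Qed.

Lemma cupcE' (T : fieldType) (r : T) u :
  cupc r u = (-1) ^+ count negb u * r ^+ count negb u.
Proof.
rewrite /cupc; elim: u => [|b u IHu]; first by rewrite big_nil mulr1.
rewrite big_cons IHu /=; case: b; rewrite /= ?add0n ?add1n ?mul1r //.
by rewrite !exprS; ring.
Qed.

Local Notation em := (corrected_jw t N M n i (2 * p - i) (2 * p)).

Let hN : N = (n + 2 * i)%N. Proof. by nlia. Qed.
Let hM : M = (n + i)%N. Proof. by nlia. Qed.

Lemma minus_matrixE a v b u : size a = M -> size v = i -> size b = M -> size u = i ->
  tlmat t em (a ++ v) (b ++ u) = symproj t N (a ++ v) (b ++ u) +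
  qnum t (2 * p - i) / qnum t (2 * p) * (capc t (bar v) * cupc t (bar u) *
    \sum_(e <- words n) symproj t M a (e ++ bar v) * symproj t M (e ++ bar u) b).
Proof. exact: corrected_jw_matrix. Qed.

(** For weights below [i] or at least [2p] the correction vanishes and [gN_neq0] applies; in between
    the two poles cancel by [Y_regular]. *)
Lemma minus_regular s' s : size s' = N -> size s = N ->
  exists w, ev q (tlmat t em s' s) w.
Proof.
have cutN (s1 : seq bool) : size s1 = N -> exists a v, [/\ s1 = a ++ v, size a = M & size v = i].
  by move=> h; apply: cut_word; rewrite h; move: p2; clear; lia.
move=> /cutN[a [v [-> ha hv]]] /cutN[b [u [-> hb hu]]]; rewrite minus_matrixE //.
have cv := count_le v; have cu := count_le u; have ca := count_le a; have cb := count_le b.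
have hbv : size (bar v) = i by rewrite size_bar.
have hbu : size (bar u) = i by rewrite size_bar.
have cbv : (count id (bar v) = i - count id v)%N by rewrite count_bar count_negb hv.
have cbu : (count id (bar u) = i - count id u)%N by rewrite count_bar count_negb hu.
have sum0 : (forall l, ~ (count id a = l + count id (bar v) /\
     count id b = l + count id (bar u))%N) ->
    \sum_(e <- words n) symproj t M a (e ++ bar v) * symproj t M (e ++ bar u) b = 0.
  by move=> h; rewrite hM; exact: symproj_sum0.
have [W|W] := eqVneq (count id (a ++ v)) (count id (b ++ u)); last first.
  rewrite {1}/symproj (negPf W) sum0 ?mulr0 ?addr0; first by exists 0; exact: ev0.
  move=> l []; rewrite cbv cbu; move: W; rewrite !count_cat; nlia.
rewrite !count_cat in W; have [hW|hW] := boolP ((count id a + count id v < i)%N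
    || (2 * p <= count id a + count id v)%N).
  have -> : \sum_(e <- words n) symproj t M a (e ++ bar v) * symproj t M (e ++ bar u) b = 0.
    case/orP: hW => hW.
      by apply: sum0 => l [e1 e2]; move: e1; rewrite cbv; nlia.
    have [l hl] : exists l, l = (count id a + count id v - i)%N by eexists.
    have := @symproj_sum _ t n i l a b (bar v) (bar u) hbv hbu.
    rewrite -hM => -> //; [|rewrite cbv; nlia|rewrite cbu; nlia].
    by rewrite (@gbin_small _ _ n l) ?mulr0 ?mul0r //; nlia.
  rewrite !mulr0 addr0 /symproj !count_cat W eqxx.
  exists (sy q (a ++ v) * sy q (b ++ u) / gbin x N (count id b + count id u)).
  apply: evM; first by apply: evM; apply: ev_sy.
  apply: evV; last exact: ev_gbin.
  by apply: (gN_neq0 p2 q0 qp xj hi); rewrite -W //; nlia.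
have [l hl] : exists l, l = (count id a + count id v - i)%N by eexists.
have e1 : count id a = (l + count id (bar v))%N by rewrite cbv; move: hW; nlia.
have e2 : count id b = (l + count id (bar u))%N by rewrite cbu; move: hW W; nlia.
have := @symproj_sum _ t n i l a b (bar v) (bar u) hbv hbu e1 e2.
rewrite -hM => ->.
have [yv hy] := Y_regular (l := l) (v := count id (bar v)) (u := count id (bar u))
  ltac:(nlia) ltac:(nlia) ltac:(nlia).
exists (sy q a * sy q b * sy q v * sy q u * yv).
have -> : symproj t N (a ++ v) (b ++ u) = sy t a * sy t b * sy t v * sy t u *
   (t^-1 ^+ ((M - l - count id (bar v)) * (i - count id (bar v))) *
    t^-1 ^+ ((M - l - count id (bar u)) * (i - count id (bar u))) / gt N (l + i)).
  rewrite /symproj !count_cat W eqxx !sy_cat !count_negb ha hb e1 e2.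
  have -> : (i - count id (bar v) = count id v)%N by nlia.
  have -> : (i - count id (bar u) = count id u)%N by nlia.
  have -> : (l + count id (bar u) + count id u = l + i)%N by nlia.
  by rewrite !subnDA; ring.
rewrite !sy_bar capcE cupcE' !count_negb hbv hbu.
set X := (X in ev _ X _).
have -> : X = sy t a * sy t b * sy t v * sy t u * Y l (count id (bar v)) (count id (bar u)).
  rewrite /X /Y e1 e2; ring.
by do !apply: evM => //; exact: ev_sy.
Qed.

Local Notation mq := (tlmat q (tl_eval q em)).

Lemma minus_ev s' s : size s' = N -> size s = N -> ev q (tlmat t em s' s) (mq s' s).
Proof. by move=> _ _; apply: (tl_eval_mat q0 minus_regular). Qed.

(** Both generic terms depend on the first [M] letters only through their weight and a factor [sy];
    [ev_inj] carries the resulting identity to the values at [q]. *)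
Lemma minus_left a a2 v s : size a = M -> size a2 = M -> size v = i -> size s = N ->
  count id a = count id a2 -> sy q a2 * mq (a ++ v) s = sy q a * mq (a2 ++ v) s.
Proof.
move=> ha ha2 hv hs ca.
have sz (c : seq bool) : size c = M -> size (c ++ v) = N by rewrite size_cat hv => ->; nlia.
apply: (@ev_inj _ q (sy t a2 * tlmat t em (a ++ v) s)).
  by apply: evM; [exact: ev_sy | apply: minus_ev => //; exact: sz].
have -> : sy t a2 * tlmat t em (a ++ v) s = sy t a * tlmat t em (a2 ++ v) s; last first.
  by apply: evM; [exact: ev_sy | apply: minus_ev => //; exact: sz].
have [b [u [-> hb hu]]] : exists b u, [/\ s = b ++ u, size b = M & size u = i].
  by apply: cut_word; rewrite hs; move: p2; clear; lia.
rewrite !minus_matrixE // /symproj !count_cat ca !sy_cat !count_negb ha ha2 ca.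
rewrite !mulrDr; congr (_ + _); first by case: ifP => _; ring.
rewrite [LHS]mulrCA [RHS]mulrCA; congr (_ * _).
rewrite [LHS]mulrCA [RHS]mulrCA; congr (_ * _); rewrite !mulr_sumr; apply: eq_bigr => e _.
by case: ifP => _; ring.
Qed.

Lemma minus_sym s' s : size s' = N -> size s = N -> mq s' s = mq s s'.
Proof.
move=> hs' hs; apply: (@ev_inj _ q (tlmat t em s' s)); first exact: minus_ev.
have -> : tlmat t em s' s = tlmat t em s s'; last exact: minus_ev.
have cutN (s1 : seq bool) : size s1 = N -> exists a v, [/\ s1 = a ++ v, size a = M & size v = i].
  by move=> h; apply: cut_word; rewrite h; move: p2; clear; lia.
have [a [v [-> ha hv]]] := cutN _ hs'; have [b [u [-> hb hu]]] := cutN _ hs.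
have ss m c d : symproj t m c d = symproj t m d c.
  by rewrite /symproj eq_sym; case: eqP => [->|] //; rewrite (mulrC (sy t d)).
rewrite !minus_matrixE // [symproj t N _ _]ss; congr (_ + _ * _).
rewrite !cupcE ?gen_t0 // !size_bar hv hu; congr (_ * _); first by ring.
by apply: eq_bigr => e _; rewrite mulrC ss [X in _ * X]ss.
Qed.

Lemma minus_id : tl_eval q em (id_diagram N) = 1.
Proof. by apply: corrected_jw_id; [exact: hN | exact: hM | nlia]. Qed.

End MinusIdempotent.

(** * Operators commuting with E, F and K *)

Section FMatrix.
Variables (K : fieldType) (q : K).
Hypotheses (q0 : q != 0) (qq : q - q^-1 != 0).
Local Notation sy := (sy q).
Local Notation qn := (qnum q).

Lemma qnum0 : qn 0 = 0. Proof. by rewrite /qnum !expr0 invr1 subrr mul0r. Qed.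

Lemma qnumSl m : qn m.+1 = q^-1 ^+ m + q * qn m.
Proof.
apply: (mulIf qq); rewrite /qnum [in RHS]mulrDl -[q * _ * _]mulrA !(divfK qq).
rewrite exprVn !exprS invfM; have := expf_neq0 m q0; move: (q ^+ m) => a a0.
by field; rewrite q0 a0.
Qed.

Lemma qnumSr m : qn m.+1 = q ^+ m + q^-1 * qn m.
Proof.
apply: (mulIf qq); rewrite /qnum [in RHS]mulrDl -[q^-1 * _ * _]mulrA !(divfK qq).
rewrite !exprS invfM; have := expf_neq0 m q0; move: (q ^+ m) => a a0.
by field; rewrite q0 a0.
Qed.

(* The eigenvalue of K^-1 on a word. *)
Definition kq (s : seq bool) : K := \prod_(b <- s) (if b then q else q^-1).

Lemma kq_cat s s' : kq (s ++ s') = kq s * kq s'. Proof. exact: big_cat. Qed.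
Lemma kq_cons b s : kq (b :: s) = (if b then q else q^-1) * kq s.
Proof. exact: big_cons. Qed.
Lemma kq_nil : kq [::] = 1. Proof. exact: big_nil. Qed.

Lemma kq_neq0 s : kq s != 0.
Proof.
by elim: s => [|b s IHs]; rewrite ?kq_nil ?oner_neq0 // kq_cons mulf_neq0 //;
  case: b; rewrite ?invr_neq0.
Qed.

Lemma kqE s : kq s = q ^+ count id s * q^-1 ^+ count negb s.
Proof.
elim: s => [|b s IHs]; first by rewrite kq_nil mulr1.
by rewrite kq_cons IHs; case: b; rewrite /= ?add0n ?add1n exprS; ring.
Qed.

Lemma kq_bar s : kq (bar s) * kq s = 1.
Proof.
transitivity ((q * q^-1) ^+ count negb s * (q * q^-1) ^+ count id s).
  by rewrite !kqE count_bar countn_bar !exprMn; ring.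
by rewrite divff // !expr1n mulr1.
Qed.

(* The matrix of F on words, F acting through the coproduct on the first letter. *)
Fixpoint Fm (s' s : seq bool) : K :=
  match s', s with
  | b' :: r', b :: r =>
    (if b' && ~~ b && (r' == r) then 1 else 0) +
    (if b' == b then (if b then q else q^-1) * Fm r' r else 0)
  | _, _ => 0
  end.

Lemma Fm_cat a' b' a b : size a' = size a ->
  Fm (a' ++ b') (a ++ b) =
  (if b' == b then Fm a' a else 0) + (if a' == a then kq a * Fm b' b else 0).
Proof.
elim: a' a => [|c' a' IHa] [|c a] //= => [_|[h]].
  by rewrite kq_nil mul1r if_same add0r.
rewrite IHa // eqseq_cat // eqseq_cons kq_cons.
case: (c' =P c) => [->|_] /=; last first.
  by case: (b' == b); rewrite ?andbT ?andbF ?addr0.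
rewrite andbN /= !add0r; case: (b' == b); case: (a' == a); rewrite ?addr0 ?add0r ?mulr0 //.
  by rewrite mulrDr mulrA.
by rewrite mulrA.
Qed.

Lemma Fm_count s' s : size s' = size s -> Fm s' s != 0 -> count id s' = (count id s).+1.
Proof.
elim: s' s => [|b' s' IHs] [|b s] //= => [_|[h]]; first by rewrite eqxx.
case: (b' =P b) => [->|ne].
  rewrite andbN add0r mulf_eq0 negb_or => /andP[_ /(IHs _ h) ->].
  by rewrite addnS.
rewrite addr0; case: b' b ne => [] [] ne; rewrite /= ?eqxx //; try by case: ne.
by case: (s' =P s) => [->|_]; rewrite ?eqxx.
Qed.

Lemma sum_Fm_sy z W : size W = z ->
  \sum_(u <- words z) Fm W u * sy u = qn (count id W) * sy W.
Proof.
elim: z W => [|z IHz] [|b W] //= => [_|[hW]]; first by rewrite big_seq1 mul0r qnum0 mul0r.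
rewrite -/(words z.+1) big_wordsS.
have E0 : \sum_(s <- words z) (if b then if W == s then 1 else 0 else 0) * sy (false :: s)
    = if b then q^-1 ^+ count id W * sy W else 0.
  case: b; last by rewrite big1 // => s _; rewrite mul0r.
  rewrite -(sy_cons q false) -(@big_words_delta _ z (fun s => sy (false :: s)) W) //.
  by apply: eq_bigr => s _; rewrite eq_sym; case: eqP; rewrite ?mul1r ?mul0r.
case: b E0 => /= E0.
  under [X in _ + X]eq_bigr => s _ do rewrite add0r sy_cons mul1r -mulrA.
  under eq_bigr => s _ do rewrite addr0.
  rewrite E0 -mulr_sumr IHz // sy_cons mul1r add1n qnumSl; ring.
rewrite [X in _ + X]big1 ?addr0 => [|s _]; last by rewrite mul0r.
have -> : \sum_(s <- words z) (0 + q^-1 * Fm W s) * sy (false :: s) =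
    q^-1 ^+ count id W * \sum_(s <- words z) Fm W s * sy s.
  rewrite mulr_sumr; apply: eq_big_words => s hs; rewrite add0r.
  have [->|nz] := eqVneq (Fm W s) 0; first by rewrite !(mulr0, mul0r).
  have -> : count id W = (count id s).+1 by apply: Fm_count => //; rewrite hW.
  by rewrite sy_cons exprS; ring.
by rewrite IHz // sy_cons add0n; ring.
Qed.

(** The transposed companion of [sum_Fm_sy]; up to K and a scalar it is the action of E on
    q-symmetric vectors. *)
Lemma sum_sy_Fm z w : size w = z ->
  \sum_(u <- words z) sy u * Fm u w =
  q ^+ (count id w).+1 * q^-1 ^+ count negb w * qn (count negb w) * sy w.
Proof.
elim: z w => [|z IHz] [|b w] //= => [_|[hw]]; first by rewrite big_seq1 qnum0 !(mulr0, mul0r).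
rewrite -/(words z.+1) big_wordsS /=.
case: b => /=.
  rewrite big1 => [|s _]; last by rewrite addr0 mulr0.
  rewrite add0r.
  under eq_bigr => s _ do rewrite add0r sy_cons mul1r mulrCA.
  by rewrite -mulr_sumr IHz // add1n add0n sy_cons mul1r [in RHS]exprS; ring.
have -> : \sum_(s <- words z) sy (true :: s) * ((if s == w then 1 else 0) + 0) = sy w.
  rewrite -(@big_words_delta _ z sy w) //; apply: eq_bigr => s _.
  by rewrite addr0 sy_cons mul1r; case: eqP => _; rewrite ?mulr1 ?mulr0.
have -> : \sum_(s <- words z) sy (false :: s) * (0 + q^-1 * Fm s w) =
   q^-1 ^+ (count id w).+2 * \sum_(s <- words z) sy s * Fm s w.
  rewrite mulr_sumr; apply: eq_big_words => s hs; rewrite add0r.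
  have [->|nz] := eqVneq (Fm s w) 0; first by rewrite !(mulr0, mul0r).
  have e : count id s = (count id w).+1 by apply: Fm_count => //; rewrite hw.
  by rewrite sy_cons e [q^-1 ^+ _.+2]exprS; ring.
rewrite IHz // add0n add1n qnumSr sy_cons.
have e (k : nat) : q ^+ k * q^-1 ^+ k = 1 by rewrite -exprMn divff // expr1n.
have e' (k : nat) : q^-1 ^+ k * q ^+ k = 1 by rewrite mulrC.
set c := count id w; set d := count negb w.
transitivity (sy w * (1 + q^-1 * q^-1 ^+ d * qn d * (q^-1 ^+ c.+1 * q ^+ c.+1))).
  by rewrite [q^-1 ^+ c.+2]exprS; ring.
transitivity (sy w * ((q^-1 ^+ c * q ^+ c) * (q * q^-1) * (q^-1 ^+ d * q ^+ d + q^-1 * q^-1 ^+ d * qn d))).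
  by rewrite !e' divff // !mulr1 !mul1r.
by rewrite [q ^+ c.+1]exprS [q^-1 ^+ d.+1]exprS; field.
Qed.

(** Commutation with F on matrices. Given [kcomp], commutation with E is the same condition on the
    transpose, since [Em] is the transpose of [Fm] up to K and a scalar. *)
Definition Fcomm z' z (A : seq bool -> seq bool -> K) := forall W w,
  size W = z' -> size w = z ->
  \sum_(u <- words z') Fm W u * A u w = \sum_(u <- words z) A W u * Fm u w.

Definition kcomp z' z (A : seq bool -> seq bool -> K) := forall W w,
  size W = z' -> size w = z -> A W w != 0 -> kq W = kq w.

Definition mtr (A : seq bool -> seq bool -> K) a b := A b a.

Definition mmul z (A B : seq bool -> seq bool -> K) a b :=
  \sum_(c <- words z) A a c * B c b.

Lemma Fcomm_mul z A B : Fcomm z z A -> Fcomm z z B -> Fcomm z z (mmul z A B).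
Proof.
move=> hA hB W w hW hw; rewrite /mmul.
transitivity (\sum_(c <- words z) (\sum_(u <- words z) Fm W u * A u c) * B c w).
  under eq_bigr => u _ do rewrite mulr_sumr.
  rewrite exchange_big /=; apply: eq_bigr => c _; rewrite mulr_suml.
  by apply: eq_bigr => u _; rewrite mulrA.
transitivity (\sum_(c <- words z) A W c * (\sum_(u <- words z) B c u * Fm u w)); last first.
  under [RHS]eq_bigr => u _ do rewrite mulr_suml.
  rewrite [RHS]exchange_big /=; apply: eq_bigr => c _; rewrite mulr_sumr.
  by apply: eq_bigr => u _; rewrite mulrA.
rewrite (eq_big_words (g := fun c => (\sum_(u <- words z) A W u * Fm u c) * B c w)); last first.
  by move=> c hc; rewrite hA.
rewrite [RHS](eq_big_words (g := fun c => A W c * \sum_(u <- words z) Fm c u * B u w)); last first.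
  by move=> c hc; rewrite -hB.
under eq_bigr => u _ do rewrite mulr_suml.
rewrite exchange_big /=; apply: eq_bigr => c _; rewrite mulr_sumr.
by apply: eq_bigr => u _; rewrite mulrA.
Qed.

Lemma Fcomm_scale z' z c A : Fcomm z' z A -> Fcomm z' z (fun a b => c * A a b).
Proof.
move=> h W w hW hw; under eq_bigr => u _ do rewrite mulrCA.
by rewrite -mulr_sumr h // mulr_sumr; apply: eq_bigr => u _; rewrite mulrA.
Qed.

(* The matrices of alpha, beta and their composites have this form. *)
Definition tm (tau : nat -> nat -> K) a b := tau (count id a) (count id b) * (sy a * sy b).

(** F and its transpose map q-symmetric vectors to multiples of q-symmetric vectors, so commutation
    is one scalar equation for each pair of weights. *)
Lemma Fcomm_tm z tau : (forall m k, (m <= z)%N -> (k <= z)%N ->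
    qn m * tau m.-1 k = tau m k.+1 * (q ^+ k.+1 * q^-1 ^+ (z - k) * qn (z - k))) ->
  Fcomm z z (tm tau).
Proof.
move=> h W w hW hw; have cW := count_le W; have cw := count_le w.
rewrite hW in cW; rewrite hw in cw.
transitivity (tau (count id W).-1 (count id w) * sy w * \sum_(u <- words z) Fm W u * sy u).
  rewrite mulr_sumr; apply: eq_big_words => u hu; rewrite /tm.
  have [->|nz] := eqVneq (Fm W u) 0; first by rewrite !(mulr0, mul0r).
  have -> : count id W = (count id u).+1 by apply: Fm_count => //; rewrite hW hu.
  by rewrite /=; ring.
transitivity (tau (count id W) (count id w).+1 * sy W * \sum_(u <- words z) sy u * Fm u w).
  rewrite sum_Fm_sy // sum_sy_Fm // count_negb hw.
  have := h _ _ cW cw; move: (tau _.-1 _) (tau _ _.+1) => t1 t2 e.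
  transitivity (qn (count id W) * t1 * (sy w * sy W)); first by ring.
  by rewrite e; ring.
rewrite mulr_sumr; apply: eq_big_words => u hu; rewrite /tm.
have [->|nz] := eqVneq (Fm u w) 0; first by rewrite !(mulr0, mul0r).
have -> : count id u = (count id w).+1 by apply: Fm_count => //; rewrite hu hw.
by ring.
Qed.

(** F annihilates the nested cap: this is the vanishing of the coefficient at [Y' ++ bar Y], the two
    terms coming from the two summands of the coproduct. *)
Lemma Fm_bar Y Y' : size Y = size Y' ->
  capc q Y * Fm Y' Y = - (capc q Y' * kq Y' * Fm (bar Y) (bar Y')).
Proof.
elim: Y Y' => [|b Y IHY] [|b' Y'] //= => [_|[h]]; first by rewrite !mulr0 oppr0.
rewrite !bar_cons Fm_cat ?size_bar // /capc !big_cons -!/(capc _ _) kq_cons.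
rewrite (can_eq barK) [Y' == Y]eq_sym.
have kb : kq (bar Y') * kq Y' = 1 by exact: kq_bar.
have IH := IHY Y' h.
case: (Y =P Y') IH => [->|_] IH; last first.
  case: b; case: b'; rewrite /= ?(mulr0, addr0, add0r, oppr0) //.
    transitivity (capc q Y * Fm Y' Y); first by field.
    by rewrite IH; field.
  transitivity (- q^-1 * (capc q Y * Fm Y' Y)); first by ring.
  by rewrite IH; ring.
case: b; case: b'; rewrite /= ?(mulr0, addr0, add0r, oppr0, mulr1) //.
- transitivity (capc q Y' * Fm Y' Y'); first by field.
  by rewrite IH; field.
- transitivity (- capc q Y' * 1); first by ring.
  by rewrite -kb; field.
transitivity (- q^-1 * (capc q Y' * Fm Y' Y')); first by ring.
by rewrite IH; ring.
Qed.

(** Dually, the nested cup annihilates the image of F. It follows from [Fm_bar] because a nonzero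
    entry of F fixes the ratios of the scalars involved. *)
Lemma Fm_bar_cup Y Y' : size Y = size Y' ->
  cupc q Y * Fm Y Y' = - (cupc q Y' * kq Y' * Fm (bar Y') (bar Y)).
Proof.
have capn0 s : capc q s != 0.
  by rewrite capcE mulf_neq0 ?signr_eq0 // expf_neq0 ?invr_neq0.
move=> h; have [e|nz] := eqVneq (Fm Y Y') 0.
  have := Fm_bar (esym h); rewrite e mulr0 => /esym/eqP; rewrite oppr_eq0 !mulf_eq0.
  by rewrite (negPf (capn0 _)) (negPf (kq_neq0 _)) /= => /eqP->; rewrite !mulr0 oppr0.
have hc := Fm_count h nz; have := Fm_bar (esym h).
have hn : count negb Y' = (count negb Y).+1.
  by have := count_le Y; have := count_le Y'; rewrite !count_negb hc -h; lia.
have e1 : capc q Y' = - q * capc q Y.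
  by rewrite !capcE hc hn [(-1) ^+ _.+1]exprS [q^-1 ^+ _.+1]exprS; field.
have e2 : kq Y = q ^+ 2 * kq Y'.
  by rewrite !kqE hc hn [q ^+ _.+1]exprS [q^-1 ^+ _.+1]exprS; field.
rewrite !cupcE // e1 e2 h => H; have Hf : Fm Y Y' = q * kq Y' * Fm (bar Y') (bar Y).
  apply: (@mulfI _ (- q * capc q Y)); first by rewrite mulf_neq0 ?oppr_eq0.
  by rewrite H; ring.
by rewrite Hf; ring.
Qed.

End FMatrix.

Lemma big_words_bar (V : nmodType) z (f : seq bool -> V) :
  \sum_(s <- words z) f (bar s) = \sum_(s <- words z) f s.
Proof.
rewrite -(big_map bar predT f); apply: perm_big; apply: uniq_perm.
- by rewrite map_inj_uniq ?uniq_words //; exact: (can_inj barK).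
- exact: uniq_words.
move=> s; rewrite mem_words -[s]barK mem_map ?mem_words ?size_bar //.
exact: (can_inj barK).
Qed.

(** * Operators closed by nested caps and cups *)

Section CapCupMatrices.
Variables (K : fieldType) (q : K) (n i : nat).
Hypotheses (q0 : q != 0) (qq : q - q^-1 != 0).
Local Notation sy := (sy q).
Local Notation M := (n + i)%N.
Local Notation N := (n + i + i)%N.
Local Notation Fm := (Fm q).
Local Notation kq := (kq q).
Implicit Types A : seq bool -> seq bool -> K.

(* The matrices of (A (x) 1^i)(1^n (x) cap^(i)) and (1^n (x) cup^(i))(A (x) 1^i). *)
Definition capm A W w := capc q (bar (drop M W)) * A (take M W) (w ++ bar (drop M W)).
Definition cupm A w W := cupc q (bar (drop M W)) * A (w ++ bar (drop M W)) (take M W).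

Lemma capm_cat A a y w : size a = M -> capm A (a ++ y) w = capc q (bar y) * A a (w ++ bar y).
Proof. by move=> ha; rewrite /capm take_size_cat // drop_size_cat. Qed.

Lemma cupm_cat A w a y : size a = M -> cupm A w (a ++ y) = cupc q (bar y) * A (w ++ bar y) a.
Proof. by move=> ha; rewrite /cupm take_size_cat // drop_size_cat. Qed.

(** Absorption for cups is reduced to absorption for caps of the transposed operator in this way. *)
Lemma cupm_capm A w W : size W = N -> cupm A w W = q ^+ i * capm (mtr A) W w.
Proof.
by move=> h; rewrite /cupm /capm cupcE // size_bar size_drop h addKn mulrA.
Qed.

Lemma kcomp_capm A : kcomp q M M A -> kcomp q N n (capm A).
Proof.
move=> h W w /cut_word[a [y [-> ha hy]]] hw; rewrite capm_cat // mulf_eq0 negb_or.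
case/andP=> _ /h; rewrite ha size_cat size_bar hw hy !kq_cat => -> //.
by rewrite -mulrA kq_bar // mulr1.
Qed.

Lemma kcomp_cupm A : kcomp q M M A -> kcomp q n N (cupm A).
Proof.
move=> h w W hw /cut_word[a [y [-> ha hy]]]; rewrite cupm_cat // mulf_eq0 negb_or.
case/andP=> _ /h; rewrite ha size_cat size_bar hw hy !kq_cat => <- //.
by rewrite -mulrA kq_bar // mulr1.
Qed.

(** F on the last [i] letters of the result cancels, by [Fm_bar], against F on the letters that the
    cap feeds into [A]; what remains is the commutation of [A] itself. *)
Lemma Fcomm_capm A : Fcomm q M M A -> kcomp q M M A -> Fcomm q N n (capm A).
Proof.
move=> hA hK W w /cut_word[a [y [-> ha hy]]] hw.
rewrite big_words_cat.
transitivity (capc q (bar y) * \sum_(b <- words M) Fm a b * A b (w ++ bar y) +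
   \sum_(z <- words i) kq a * Fm y z * capc q (bar z) * A a (w ++ bar z)).
  rewrite mulr_sumr -(@big_words_delta _ M (fun b => \sum_(z <- words i)
    kq b * Fm y z * capc q (bar z) * A b (w ++ bar z)) a) // -big_split /=.
  apply: eq_big_words => b hb.
  rewrite -(@big_words_delta _ i (fun z => capc q (bar z) * (Fm a b * A b (w ++ bar z))) y) //.
  rewrite eq_sym; case: (a =P b) => [<-|ne].
    rewrite -big_split /=; apply: eq_big_words => z hz.
    by rewrite Fm_cat ?ha // eqxx capm_cat // eq_sym; case: eqP => _; ring.
  rewrite addr0; apply: eq_big_words => z hz.
  rewrite Fm_cat ?ha ?hb // capm_cat // (introF eqP ne) eq_sym.
  by case: eqP => _; ring.
rewrite hA ?size_cat ?size_bar ?hw ?hy // big_words_cat.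
transitivity (capc q (bar y) * (\sum_(u <- words n) A a (u ++ bar y) * Fm u w +
   \sum_(z <- words i) A a (w ++ bar z) * (kq w * Fm (bar z) (bar y))) +
   \sum_(z <- words i) kq a * Fm y z * capc q (bar z) * A a (w ++ bar z)).
  congr (_ * _ + _).
  rewrite (big_words_bar i (fun z => A a (w ++ z) * (kq w * Fm z (bar y)))).
  rewrite -(@big_words_delta _ n (fun u => \sum_(z <- words i)
    A a (u ++ z) * (kq w * Fm z (bar y))) w) // -big_split /=.
  apply: eq_big_words => u hu.
  rewrite -(@big_words_delta _ i (fun z => A a (u ++ z) * Fm u w) (bar y)) ?size_bar //.
  case: (u =P w) => [->|ne].
    rewrite -big_split /=; apply: eq_big_words => z hz.
    by rewrite Fm_cat // eqxx; case: eqP => _; ring.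
  rewrite addr0; apply: eq_big_words => z hz.
  rewrite Fm_cat ?hu ?hw // (introF eqP ne).
  by case: eqP => _; ring.
rewrite mulrDr -addrA -[RHS]addr0; congr (_ + _).
  by rewrite mulr_sumr; apply: eq_bigr => u _; rewrite capm_cat // mulrA.
rewrite mulr_sumr -big_split /=; apply: big_words0P => z hz.
have [->|nz] := eqVneq (A a (w ++ bar z)) 0; first by rewrite !(mulr0, mul0r) addr0.
have := hK _ _ ha _ nz; rewrite size_cat size_bar hw hz kq_cat => -> //.
have := @Fm_bar _ q q0 (bar y) (bar z); rewrite !size_bar hy hz !barK => /(_ erefl) e.
transitivity (A a (w ++ bar z) * kq w * (capc q (bar y) * Fm (bar z) (bar y) +
   capc q (bar z) * kq (bar z) * Fm y z)); first by ring.
by rewrite e addNr mulr0.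
Qed.

Lemma Fcomm_cupm A : Fcomm q M M A -> kcomp q M M A -> Fcomm q n N (cupm A).
Proof.
move=> hA hK w W hw /cut_word[a [y [-> ha hy]]].
rewrite [RHS]big_words_cat.
transitivity (cupc q (bar y) * \sum_(b <- words M) A (w ++ bar y) b * Fm b a +
   \sum_(z <- words i) cupc q (bar z) * A (w ++ bar z) a * (kq a * Fm z y)); last first.
  rewrite mulr_sumr -(@big_words_delta _ M (fun b => \sum_(z <- words i)
    cupc q (bar z) * A (w ++ bar z) b * (kq a * Fm z y)) a) // -big_split /=.
  apply: eq_big_words => b hb.
  rewrite -(@big_words_delta _ i (fun z => cupc q (bar z) * (A (w ++ bar z) b * Fm b a)) y) //.
  case: (b =P a) => [->|ne].
    rewrite -big_split /=; apply: eq_big_words => z hz.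
    by rewrite Fm_cat // eqxx cupm_cat //; case: eqP => _; ring.
  rewrite addr0; apply: eq_big_words => z hz.
  rewrite Fm_cat ?hb ?ha // cupm_cat // (introF eqP ne).
  by case: eqP => _; ring.
rewrite -hA ?size_cat ?size_bar ?hw ?hy // big_words_cat.
transitivity (cupc q (bar y) * (\sum_(u <- words n) Fm w u * A (u ++ bar y) a +
   \sum_(z <- words i) kq w * Fm (bar y) (bar z) * A (w ++ bar z) a) +
   \sum_(z <- words i) cupc q (bar z) * A (w ++ bar z) a * (kq a * Fm z y)); last first.
  congr (_ * _ + _).
  rewrite (big_words_bar i (fun z => kq w * Fm (bar y) z * A (w ++ z) a)).
  rewrite -(@big_words_delta _ n (fun u => \sum_(z <- words i)
    kq w * Fm (bar y) z * A (u ++ z) a) w) // -big_split /=.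
  apply: eq_big_words => u hu.
  rewrite -(@big_words_delta _ i (fun z => Fm w u * A (u ++ z) a) (bar y)) ?size_bar //.
  rewrite eq_sym; case: (w =P u) => [<-|ne].
    rewrite -big_split /=; apply: eq_big_words => z hz.
    by rewrite Fm_cat // eqxx eq_sym; case: eqP => _; ring.
  rewrite addr0; apply: eq_big_words => z hz.
  rewrite Fm_cat ?hu ?hw // (introF eqP ne) eq_sym.
  by case: eqP => _; ring.
rewrite mulrDr -addrA -[LHS]addr0; congr (_ + _).
  by rewrite mulr_sumr; apply: eq_bigr => u _; rewrite cupm_cat // mulrCA.
symmetry; rewrite mulr_sumr -big_split /=; apply: big_words0P => z hz.
have [->|nz] := eqVneq (A (w ++ bar z) a) 0; first by rewrite !(mulr0, mul0r) addr0.
have := hK _ _ _ ha nz; rewrite size_cat size_bar hw hz kq_cat => <- //.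
have := @Fm_bar_cup _ q q0 qq (bar y) (bar z); rewrite !size_bar hy hz !barK => /(_ erefl) e.
transitivity (A (w ++ bar z) a * kq w * (cupc q (bar y) * Fm (bar y) (bar z) +
   cupc q (bar z) * kq (bar z) * Fm z y)); first by ring.
by rewrite e addNr mulr0.
Qed.

End CapCupMatrices.

Lemma sy_swap (K : fieldType) (q : K) a c :
  sy q (a ++ [:: false; true] ++ c) = q^-1 * sy q (a ++ [:: true; false] ++ c).
Proof.
rewrite !sy_cat; have -> : sy q [:: false; true] = q^-1 * sy q [:: true; false].
  by rewrite /sy /= expr0 expr1 mulr1.
by rewrite /= ; ring.
Qed.

(** * Outputs forced to be through strands *)

Section Through.
Variables (n m h : nat) (M : tl_pt n -> tl_pt n).
Hypotheses (plM : tl_planar M) (hm : (m <= n)%N) (hh : (h + (n - m) <= m)%N).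

Lemma no_arc_left :
  (forall j k : 'I_n, k = j.+1 :> nat -> (k < m)%N -> M (inl j) <> inl k) ->
  forall j k : 'I_n, (j < m)%N -> (k < m)%N -> M (inl j) <> inl k.
Proof.
have [MK Mf _ Mc] := plM; move=> nadj.
have main (j k : 'I_n) : (j < k)%N -> (k < m)%N -> M (inl j) <> inl k.
  move=> hjk hk e; have [|y [h1 h2 h3]] := @inner_arc n M (inl j) plM; first by rewrite e.
  move: h1 h2 h3; rewrite e /=; case: y => y /=; last by have := ltn_ord k; have := ltn_ord y; lia.
  case e' : (M (inl y)) => [z|z] /= h1 h2 h3; last by have := ltn_ord k; have := ltn_ord z; lia.
  by apply: (nadj y z _ _ e'); lia.
move=> j k hj hk e; have [hjk|hkj|hjk] := ltngtP j k; first exact: (main j k).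
  by apply: (main k j) => //; rewrite -e MK.
by have := Mf (inl j); rewrite e (val_inj hjk) eqxx.
Qed.

(** If output [j < h] were joined to an output [k], then [k >= m] by [no_arc_left], and the outputs
    strictly between [j] and [m] would be joined injectively to outputs from [m] to [k - 1]. There
    are at least [n - m] of the former and fewer of the latter. *)
Lemma left_through :
  (forall j k : 'I_n, k = j.+1 :> nat -> (k < m)%N -> M (inl j) <> inl k) ->
  forall j : 'I_n, (j < h)%N -> ~~ out (M (inl j)).
Proof.
have [MK Mf _ Mc] := plM => /no_arc_left nl j hj; case e : (M (inl j)) => [k|//] /=.
have hk : (m <= k)%N by rewrite leqNgt; apply/negP => hk; apply: (nl j k) => //; move: hj hh; clear; lia.
pose f (l : 'I_n) : nat := if M (inl l) is inl z then val z else 0.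
have fS (l : 'I_n) : (j < l < m)%N ->
    exists2 z : 'I_n, M (inl l) = inl z & f l = z /\ (m <= z < k)%N.
  move=> /andP[l1 l2].
  have n1 : (inl l : tl_pt n) != inl j.
    by apply/eqP => -[/(congr1 val)] /=; lia.
  have n2 : (inl l : tl_pt n) != M (inl j).
    by rewrite e; apply/eqP => -[/(congr1 val)] /=; lia.
  have := Mc (inl j) (inl l) isT isT n1 n2; rewrite e /crossing /plt.
  have n3 : M (inl l) != inl k.
    by apply: contra n1 => /eqP h'; rewrite -[inl l]MK h' -e MK.
  move: n3; rewrite /f; case e' : (M (inl l)) => [z|z] /= n3 hc; last first.
    by exfalso; move: hc; have := ltn_ord k; have := ltn_ord z; move: l1 l2 hk; clear; lia.
  have hz : (m <= z)%N by rewrite leqNgt; apply/negP => hz; exact: (nl l z).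
  have zk : z != k :> nat by apply: contra n3 => /eqP h'; rewrite (val_inj h').
  by exists z; split=> //; move: hc zk hz hk l1 l2; clear; lia.
pose g x := if insub x is Some l then f l else 0.
have jn : (m - j.+1 <= k - m)%N.
  rewrite -(size_iota j.+1 (m - j.+1)) -(size_iota m (k - m)) -(size_map g); apply: uniq_leq_size.
    rewrite map_inj_in_uniq ?iota_uniq // => x y; rewrite !mem_iota => hx hy.
    have hxn : (x < n)%N by move: hx hm; clear; lia.
    have hyn : (y < n)%N by move: hy hm; clear; lia.
    rewrite /g !insubT => exy.
    have [|z ez [fz _]] := fS (Ordinal hxn); first by move: hx; clear => /=; lia.
    have [|z' ez' [fz' _]] := fS (Ordinal hyn); first by move: hy; clear => /=; lia.
    have zz : z = z' by apply: val_inj; rewrite /= -fz -fz'.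
    by have := can_inj MK (etrans ez (etrans (congr1 inl zz) (esym ez'))) => -[].
  move=> y /mapP[x]; rewrite mem_iota => hx ->.
  have hxn : (x < n)%N by move: hx hm; clear; lia.
  have [|z _ [fz hz]] := fS (Ordinal hxn); first by move: hx; clear => /=; lia.
  by rewrite /g insubT fz mem_iota; move: hz; clear; lia.
by have := ltn_ord k; move: jn hj hk hh; clear; lia.
Qed.

End Through.

(** * Absorption of the idempotents *)

Lemma count_swap a c :
  count id (a ++ [:: false; true] ++ c) = count id (a ++ [:: true; false] ++ c).
Proof. by rewrite !count_cat. Qed.

Section StraightMatrix.
Variables (F : fieldType) (t : F) (n h : nat) (D : tl_diagram n).
Hypothesis hn : (h <= n)%N.
Hypothesis hD : forall j : 'I_n, (j < h)%N -> D (inl j) = inr j.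

Let P (z : tl_pt n) : bool := match z with inl j | inr j => (j < h)%N end.

(** Straight strands contribute an identity matrix, and the other factor does not see their letters;
    [nseq h false] is a mere placeholder there. *)
Lemma dmat_straight a0 b0 s' s : size a0 = h -> size b0 = h ->
  dmat t D (a0 ++ s') (b0 ++ s) = (a0 == b0)%:R *
  \prod_(z | ~~ P z) ptfac t D z (ptbit (nseq h false ++ s') (nseq h false ++ s) z)
     (ptbit (nseq h false ++ s') (nseq h false ++ s) (D z)).
Proof.
have [DK Df _ _] := diagram_planar D; move=> ha hb.
have hD' (j : 'I_n) : (j < h)%N -> D (inr j) = inl j by move=> hj; rewrite -hD // DK.
have DP z : P (D z) = P z.
  have PD z1 : P z1 -> P (D z1) by case: z1 => j /= hj; rewrite ?hD ?hD'.
  by apply/idP/idP => [/PD|/PD//]; rewrite DK.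
rewrite /dmat (bigID P) /=; congr (_ * _); last first.
  apply: eq_ptfac => z; last by rewrite DP.
  by case: z => j /=; rewrite -leqNgt => hj;
    rewrite !nth_cat size_nseq ?ha ?hb ltnNge hj.
case: eqP => [e|/eqP ne].
  rewrite big1 // => -[] j /= hj; rewrite /ptfac ?hD ?hD' //=.
  by rewrite e !nth_cat hb hj eqxx.
have /existsP[j hj] : [exists j : 'I_h, nth false a0 j != nth false b0 j].
  apply: contraR ne; rewrite negb_exists => /forallP e; apply/eqP.
  apply: (@eq_from_nth _ false); rewrite ?ha ?hb // => l hl.
  by have := e (Ordinal hl); rewrite negbK => /eqP.
have hjn : (j < n)%N by apply: leq_trans hn.
rewrite (bigD1 (inl (Ordinal hjn))) /=; last exact: ltn_ord.
rewrite /ptfac hD /=; last exact: ltn_ord.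
by rewrite !nth_cat ha hb ltn_ord (negPf hj) mul0r.
Qed.

End StraightMatrix.

Section Absorption.
Variables (K : fieldType) (q : K) (p i : nat).
Hypotheses (p2 : (2 <= p)%N) (q0 : q != 0) (qp : q ^+ p = -1).
Hypothesis char0 : forall m, (0 < m)%N -> m%:R != 0 :> K.
Local Notation x := (q^-1 ^+ 2).
Hypothesis xj : forall j, (0 < j < p)%N -> 1 - x ^+ j != 0.
Hypothesis hi : (0 < i < p)%N.
Local Notation t := (@FracField.tofrac {poly K} 'X).
Local Notation M := (2 * p - 1)%N.
Local Notation N := (2 * p + i - 1)%N.
Local Notation n := (2 * p - i - 1)%N.
Local Notation sy := (sy q).

Let hN : N = (M + i)%N. Proof. by lia. Qed.
Let hN2 : N = (n + (i + i))%N. Proof. by lia. Qed.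
Let hM : M = (n + i)%N. Proof. by lia. Qed.

(** In [gbin_subr] the exponents multiplying [gbin x M m] run from [M - m] down over [i] values, and
    for these [m] they include [p], while the factors of the other product are all nonzero. *)
Lemma gn_zero m : (p - i <= m <= p.-1)%N -> gbin x n m = 0.
Proof.
move=> hm; have := @gbin_subr _ x i M m; rewrite (_ : M - i = n)%N; last by lia.
move=> /(_ ltac:(lia)) e.
have D0 : \prod_(j < i) (1 - x ^+ (M - j)) != 0.
  apply/prodf_neq0 => j _; have hj := ltn_ord j; apply: (x_neq p2 q0 qp xj).
  apply/negP => /dvdnP[c hc]; move: hi hj hc; case: c => [|[|c]]; rewrite ?mulSn; nlia.
apply: (mulfI D0); rewrite mulr0 -e.
have hj : (M - m - p < i)%N by nlia.
rewrite (bigD1 (Ordinal hj)) //= (_ : M - m - (M - m - p) = p)%N; last by nlia.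
by rewrite (xp qp) subrr !mul0r.
Qed.


Section Kill.
Variable tau : nat -> nat -> K.
Hypothesis tauC : forall m k, (m < M)%N -> (k < M)%N ->
  q * tau m k + q^-1 * q^-1 ^+ (M.-1 - m) * q^-1 ^+ (M.-1 - k) * tau m.+1 k.+1 != 0 ->
  m = p.-1.
Local Notation T := (capm q n i (tm q tau)).

Lemma T_cat a y w : size a = M -> T (a ++ y) w =
  capc q (bar y) * (tau (count id a) (count id (w ++ bar y)) * (sy a * sy (w ++ bar y))).
Proof. by move=> ha; rewrite capm_cat -?hM. Qed.

Lemma T_swap_left a c v w : (size a + (2 + size c))%N = M ->
  T ((a ++ [:: false; true] ++ c) ++ v) w = q^-1 * T ((a ++ [:: true; false] ++ c) ++ v) w.
Proof.
move=> h; have hs b1 b2 : size (a ++ [:: b1; b2] ++ c) = M by rewrite !size_cat -h.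
by rewrite !T_cat // sy_swap count_swap; ring.
Qed.

Lemma T_swap_right a b c w : size a = M ->
  T (a ++ b ++ [:: false; true] ++ c) w = q^-1 * T (a ++ b ++ [:: true; false] ++ c) w.
Proof.
move=> ha; rewrite !T_cat // !bar_cat -!catA.
have -> : bar [:: false; true] = [:: false; true] by [].
have -> : bar [:: true; false] = [:: true; false] by [].
have capE r : capc q (bar c ++ r ++ bar b) = capc q (bar c) * capc q r * capc q (bar b).
  by rewrite /capc !big_cat /= mulrA.
by rewrite !capE [w ++ _]catA [in RHS](catA w) sy_swap count_swap /capc !big_cons !big_nil; ring.
Qed.

Lemma T_swap_in a b w : (size a + 2 + size b)%N = n ->
  size w = N -> T w (a ++ [:: false; true] ++ b) = q^-1 * T w (a ++ [:: true; false] ++ b).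
Proof.
move=> h; rewrite [N]hN => /cut_word[c [y [-> hc hy]]].
by rewrite !T_cat // -!catA sy_swap count_swap; ring.
Qed.

Section Diagram.
Variables (D : tl_diagram N) (w v : seq bool) (m : nat).
Hypotheses (nid : D != id_diagram N) (hw : size w = n) (hv : size v = i).
Local Notation psi := (fun a => if count id a == m then sy a else 0).

Lemma kill_left (j k : 'I_N) : k = j.+1 :> nat -> (k < M)%N -> D (inl j) = inl k ->
  forall X, \sum_(a <- words M) psi a * \sum_(s <- words N) dmat q D (a ++ v) s * X s = 0.
Proof.
move=> jk hk e X.
pose phi W := if drop M W == v then psi (take M W) else 0.
have E s : \sum_(a <- words M) psi a * dmat q D (a ++ v) s =
    \sum_(W <- words N) phi W * dmat q D W s.
  rewrite (congr1 words hN) [RHS]big_words_cat.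
  apply: eq_big_words => a ha.
  rewrite -(@big_words_delta _ i (fun z => psi a * dmat q D (a ++ z) s) v) //.
  apply: eq_big_words => z hz.
  by rewrite /phi take_size_cat // drop_size_cat //; case: eqP => _; rewrite ?mul0r.
under eq_bigr => a _ do rewrite mulr_sumr.
rewrite exchange_big /=; apply: big_words0P => s hs.
under eq_bigr => a _ do rewrite mulrA.
rewrite -mulr_suml E (kill_out jk _ e) ?mul0r // => a c ha hc.
rewrite /phi; have [c1 [c2 [-> h1 h2]]] : exists c1 c2,
    [/\ c = c1 ++ c2, size c1 = (M - j - 2)%N & size c2 = i].
  by apply: cut_word; move: hc jk hk; clear; nlia.
have hs1 (r : seq bool) : size r = 2 -> size (a ++ r ++ c1) = M.
  by rewrite !size_cat h1 ha => ->; move: jk hk; clear; nlia.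
rewrite ![_ ++ c1 ++ c2]catA ![a ++ (_ ++ c2)]catA !take_size_cat ?hs1 // !drop_size_cat ?hs1 //.
rewrite count_swap sy_swap; case: eqP => _; rewrite ?mulr0 //.
by case: eqP => _; rewrite ?mulr0.
Qed.

Lemma kill_right (j k : 'I_N) : k = j.+1 :> nat -> (k < M)%N || (M <= j)%N ->
  D (inr j) = inr k ->
  forall W, \sum_(s <- words N) dmat q D W s * T s w = 0.
Proof.
move=> jk hk e W; apply: (kill_in jk _ q0 e) => a c ha hc.
case/orP: hk => hk.
  have [c1 [c2 [-> h1 h2]]] : exists c1 c2,
      [/\ c = c1 ++ c2, size c1 = (M - j - 2)%N & size c2 = i].
    by apply: cut_word; move: hc jk hk; clear; nlia.
  have := @T_swap_left a c1 c2 w; rewrite -!catA; apply.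
  by rewrite ha h1; move: jk hk; clear; nlia.
have [a1 [a2 [-> h1 h2]]] : exists a1 a2,
    [/\ a = a1 ++ a2, size a1 = M & size a2 = (j - M)%N].
  by apply: cut_word; rewrite ha; move: hk; clear; nlia.
by rewrite -!catA T_swap_right.
Qed.

(** The cup contracts the last of the first [M] letters with its right neighbour and leaves [tau1],
    which by [tauC] forces weight [p - 1] on the [M - 1] letters before it. The first [n] of these
    are straight strands paired with [psi]; summing over them gives a binomial on [n] letters that
    vanishes by [gn_zero]. *)
Lemma kill_gap (j k : 'I_N) : j = M.-1 :> nat -> k = j.+1 :> nat -> D (inr j) = inr k ->
  (forall l : 'I_N, (l < n)%N -> D (inl l) = inr l) ->
  \sum_(a <- words M) psi a * \sum_(s <- words N) dmat q D (a ++ v) s * T s w = 0.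
Proof.
move=> hj jk e hD.
pose z0 := nseq n false.
have G W1 W2 : size W1 = n -> \sum_(s <- words N) dmat q D (W1 ++ W2) s * T s w =
    \sum_(s <- words (i + i)) dmat q D (z0 ++ W2) (z0 ++ s) * T (W1 ++ s) w.
  move=> h1; rewrite (congr1 words hN2) big_words_cat.
  rewrite -(@big_words_delta _ n (fun s1 => \sum_(s <- words (i + i))
     dmat q D (z0 ++ W2) (z0 ++ s) * T (s1 ++ s) w) W1) //.
  have hnN : (n <= N)%N by nlia.
  apply: eq_big_words => s1 hs1; rewrite eq_sym; case: (W1 =P s1) => [<-|/eqP/negPf ne].
    apply: eq_bigr => s _; congr (_ * _).
    rewrite (dmat_straight _ hnN hD) // [in RHS](dmat_straight _ hnN hD) ?size_nseq //.
    by rewrite !eqxx.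
  by apply: big1 => s _; rewrite (dmat_straight _ hnN hD) // ne !mul0r.
have ii : (i + i = i.-1 + (2 + i.-1))%N by move: hi; clear; lia.
pose tau1 a b := q * tau a b + q^-1 * q^-1 ^+ (M.-1 - a) * q^-1 ^+ (M.-1 - b) * tau a.+1 b.+1.
pose R W2 c d := (-1) ^+ j *
    \prod_(z | (z != inr j) && (z != inr k))
      ptfac q D z (ptbit (z0 ++ W2) ((z0 ++ c) ++ [:: false; false] ++ d) z)
                (ptbit (z0 ++ W2) ((z0 ++ c) ++ [:: false; false] ++ d) (D z)).
have G' W1 W2 : size W1 = n -> \sum_(s <- words N) dmat q D (W1 ++ W2) s * T s w =
   \sum_(c <- words i.-1) \sum_(d <- words i.-1) R W2 c d * capc q (bar d) *
     (sy (W1 ++ c) * sy (w ++ bar d)) * tau1 (count id (W1 ++ c)) (count id (w ++ bar d)).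
  move=> h1; rewrite G // ii big_words_cat; apply: eq_big_words => c hc.
  rewrite big_words_cat exchange_big; apply: eq_big_words => d hd.
  have hzc : size (z0 ++ c) = j by rewrite size_cat size_nseq hc hj; move: hi; clear; lia.
  have hsz : size (W1 ++ c) = M.-1 by rewrite size_cat h1 hc; move: hi; clear; lia.
  have hsw : size (w ++ bar d) = M.-1 by rewrite size_cat size_bar hw hd; move: hi; clear; lia.
  have Db b1 b2 : dmat q D (z0 ++ W2) (z0 ++ c ++ [:: b1; b2] ++ d) =
      cup_coef q b1 b2 * R W2 c d.
    by rewrite catA (dmat_arc_in _ jk _ _ _ _ e hzc) /R; ring.
  have Tb b1 b2 : T (W1 ++ c ++ [:: b1; b2] ++ d) w =
     capc q (bar d ++ [:: ~~ b2]) * (tau (count id ((W1 ++ c) ++ [:: b1]))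
       (count id ((w ++ bar d) ++ [:: ~~ b2])) *
     (sy ((W1 ++ c) ++ [:: b1]) * sy ((w ++ bar d) ++ [:: ~~ b2]))).
    rewrite [W1 ++ _]catA [(W1 ++ c) ++ _](catA _ [:: b1] (b2 :: d)).
    rewrite T_cat ?bar_cons ?catA // size_cat hsz /=; move: hi; clear; lia.
  have cq b1 : capc q (bar d ++ [:: b1]) = capc q (bar d) * (if b1 then q^-1 else -1).
    by rewrite /capc big_cat big_seq1.
  rewrite !big_wordsS !big_words0 !Db !Tb !cq /=.
  rewrite ![sy (_ ++ [:: _])]sy_cat !sy1 ![count id (_ ++ [:: _])]count_cat /= !count_negb hsz hsw.
  rewrite !addn0 !muln0 !muln1 !addn1 expr0 /tau1; ring.
rewrite (congr1 words hM) big_words_cat exchange_big; apply: big_words0P => u hu.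
transitivity (\sum_(W1 <- words n) \sum_(c <- words i.-1) \sum_(d <- words i.-1)
   psi (W1 ++ u) * (R (u ++ v) c d * capc q (bar d) *
     (sy (W1 ++ c) * sy (w ++ bar d)) * tau1 (count id (W1 ++ c)) (count id (w ++ bar d)))).
  apply: eq_big_words => W1 h1; rewrite -catA G' // mulr_sumr.
  by apply: eq_bigr => c _; rewrite mulr_sumr.
rewrite exchange_big; apply: big_words0P => c hc.
rewrite exchange_big; apply: big_words0P => d hd.
have cc := count_le c; rewrite hc in cc.
(* The weight left for the [n] straight letters; since [c] has [i - 1] letters, it lies in the range
   of [gn_zero]. *)
have [r hr] : exists r, r = (p.-1 - count id c)%N by eexists.
have rP : (p - i <= r <= p.-1)%N by rewrite hr; move: cc hi; clear; lia.
pose C := (if (r + count id u)%N == m then sy u * q^-1 ^+ ((n - r) * count id u) else 0) *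
  (R (u ++ v) c d * capc q (bar d) * (sy c * q^-1 ^+ ((n - r) * count id c) * sy (w ++ bar d)) *
   tau1 (r + count id c)%N (count id (w ++ bar d))).
rewrite (eq_big_words (g := fun W1 => C * (if count id W1 == r then sy W1 ^+ 2 else 0))).
  by rewrite -mulr_sumr sum_sy2 gn_zero ?mulr0.
move=> W1 h1; case: (count id W1 =P r) => [e1|ne].
  rewrite /C !count_cat !sy_cat !count_negb h1 e1; case: ifP => _; ring.
rewrite mulr0; have [->|nz] := eqVneq (tau1 (count id (W1 ++ c)) (count id (w ++ bar d))) 0.
  by rewrite !mulr0.
case: ne; have cw := count_le (w ++ bar d); have c1 := count_le (W1 ++ c).
rewrite size_cat size_bar hw hd in cw; rewrite size_cat h1 hc in c1.
have := tauC _ _ nz; rewrite count_cat hr => e1.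
have : (count id W1 + count id c = p.-1)%N.
  by apply: e1; [move: c1; rewrite count_cat | move: cw]; move: hi; clear; lia.
by move: cc hi; clear; lia.
Qed.

(** Without neighbouring arcs among the first [M] outputs or the first [M] inputs, the first [n]
    strands are straight by [left_through]. A diagram other than the identity still has an arc
    between neighbouring inputs; the only new position is the one straddling [M], treated by
    [kill_gap]. *)
Lemma kill_diagram :
  \sum_(a <- words M) psi a * \sum_(s <- words N) dmat q D (a ++ v) s * T s w = 0.
Proof.
have plD := diagram_planar D; have plF := flip_planar plD.
have [/existsP[j /existsP[k /and3P[/eqP jk hk /eqP e]]]|no] := boolP [exists j : 'I_N,
    exists k : 'I_N, [&& k == j.+1 :> nat, (k < M)%N & D (inl j) == inl k]].
  exact: kill_left jk hk e _.
have right (j k : 'I_N) : k = j.+1 :> nat -> (k < M)%N || (M <= j)%N -> D (inr j) = inr k ->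
    \sum_(a <- words M) psi a * \sum_(s <- words N) dmat q D (a ++ v) s * T s w = 0.
  by move=> jk hk e; apply: big_words0P => a _; rewrite (kill_right jk hk e) mulr0.
have [/existsP[j /existsP[k /and3P[/eqP jk hk /eqP e]]]|ni] := boolP [exists j : 'I_N,
    exists k : 'I_N, [&& k == j.+1 :> nat, (k < M)%N & D (inr j) == inr k]].
  by apply: (right j k); rewrite // hk.
have hnh : (n + (N - M) <= M)%N by move: hi; clear; lia.
have MN : (M <= N)%N by move: hi; clear; lia.
have str : forall j : 'I_N, (j < n)%N -> D (inl j) = inr j.
  apply: straight => // j hj; apply/andP; split.
    apply: (left_through plD MN hnh) => // j1 k1 jk hk e.
    case/negP: no; apply/existsP; exists j1; apply/existsP; exists k1.
    by rewrite jk eqxx -jk hk e eqxx.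
  have := left_through plF MN hnh _ hj; rewrite /=; case: (D (inr j)) => //= l; apply.
  move=> j1 k1 jk hk e; case/negP: ni; apply/existsP; exists j1; apply/existsP; exists k1.
  rewrite jk eqxx -jk hk /=; apply/eqP; move: e => /(congr1 (@flip N)).
  by rewrite flipK.
have [j [k [jk e]]] := adjacent_in plD (id_diagramP nid).
have [hjk|hjk] := boolP ((k < M)%N || (M <= j)%N); first exact: right jk hjk e.
by apply: (kill_gap _ jk e) => //; move: hjk jk; clear; lia.
Qed.

End Diagram.

Local Notation em := (corrected_jw t N M n i (2 * p - i) (2 * p)).
Local Notation mq := (tlmat q (tl_eval q em)).

Lemma minus_capm W w : size W = N -> size w = n ->
  \sum_(s <- words N) mq W s * T s w = T W w.
Proof.
move=> hW hw; pose y W := \sum_(s <- words N) mq W s * T s w - T W w.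
suff y0 a v : size a = M -> size v = i -> y (a ++ v) = 0.
  have [a [v [-> ha hv]]] := cut_word (etrans hW hN).
  by apply/eqP; rewrite -subr_eq0; apply/eqP; exact: y0.
move=> ha hv.
have yA a2 : size a2 = M -> count id a2 = count id a -> sy a * y (a2 ++ v) = sy a2 * y (a ++ v).
  move=> h2 c2; rewrite /y !mulrBr !mulr_sumr; congr (_ - _); last first.
    by rewrite !T_cat // c2; ring.
  apply: eq_big_words => s hs; rewrite [LHS]mulrA [RHS]mulrA; congr (_ * _).
  exact: (minus_left p2 q0 qp char0 xj hi).
have yB : \sum_(a2 <- words M) (if count id a2 == count id a then sy a2 else 0) *
    y (a2 ++ v) = 0.
  have yE a2 : size a2 = M -> y (a2 ++ v) = \sum_(D | D != id_diagram N)
      tl_eval q em D * \sum_(s <- words N) dmat q D (a2 ++ v) s * T s w.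
    move=> h2; rewrite /y; apply/eqP; rewrite subr_eq eq_sym; apply/eqP.
    have h2v : size (a2 ++ v) = N by rewrite size_cat h2 hv -hN.
    transitivity (\sum_D tl_eval q em D * \sum_(s <- words N) dmat q D (a2 ++ v) s * T s w).
      rewrite [RHS](bigD1 (id_diagram N)) //= (@minus_id K q p i p2 hi) mul1r addrC.
      congr (_ + _); rewrite -(@big_words_delta _ N (fun s => T s w) (a2 ++ v)) //.
      apply: eq_big_words => s hs; rewrite dmat_id // eq_sym.
      by case: eqP => _; rewrite ?mul1r ?mul0r.
    under eq_bigr => D _ do rewrite mulr_sumr.
    rewrite exchange_big; apply: eq_bigr => s _; rewrite mulr_suml.
    by apply: eq_bigr => D _; rewrite mulrA.
  transitivity (\sum_(D | D != id_diagram N) tl_eval q em D * \sum_(a2 <- words M)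
     (if count id a2 == count id a then sy a2 else 0) *
     \sum_(s <- words N) dmat q D (a2 ++ v) s * T s w).
    under [RHS]eq_bigr => D _ do rewrite mulr_sumr.
    rewrite [RHS]exchange_big; apply: eq_big_words => a2 h2.
    by rewrite yE // mulr_sumr; apply: eq_bigr => D _; rewrite mulrCA.
  by rewrite big1 // => D nid; rewrite kill_diagram ?mulr0.
(* By [yA] all terms of [yB] are multiples of [y (a ++ v)], and their coefficients add up to the
   squared norm of a q-symmetric vector. *)
have : gbin x M (count id a) * y (a ++ v) = 0.
  transitivity (sy a * 0); last by rewrite mulr0.
  rewrite -[in RHS]yB -sum_sy2 mulr_suml [RHS]mulr_sumr.
  apply: eq_big_words => a2 h2; case: eqP => [e|_]; last by rewrite !mul0r mulr0.
  by rewrite mulrCA yA // mulrA.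
have g0 : gbin x M (count id a) != 0.
  by apply: (gM_neq0 p2 q0 qp xj); rewrite -ha count_le.
by move/eqP; rewrite mulf_eq0 (negPf g0) => /eqP.
Qed.

End Kill.


Local Notation em := (corrected_jw t N M n i (2 * p - i) (2 * p)).
Local Notation mq := (tlmat q (tl_eval q em)).
Local Notation pq := (tlmat q (tl_eval q (corrected_jw t n (p - 1) (i - 1) (p - i) i p))).

(** The coefficient [tau1] of [kill_gap]: its two terms are the two pairs of opposite letters that
    the cup straddling position [M] accepts. *)
Definition gap (tau : nat -> nat -> K) m k :=
  q * tau m k + q^-1 * q^-1 ^+ (M.-1 - m) * q^-1 ^+ (M.-1 - k) * tau m.+1 k.+1.

Lemma minus_cupm tau : (forall m k, (m < M)%N -> (k < M)%N -> gap tau m k != 0 -> k = p.-1) ->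
  forall w W, size w = n -> size W = N ->
  \sum_(s <- words N) cupm q n i (tm q tau) w s * mq s W = cupm q n i (tm q tau) w W.
Proof.
move=> hC w W hw hW; pose tau' m k := tau k m.
have E s : size s = N -> cupm q n i (tm q tau) w s = q ^+ i * capm q n i (tm q tau') s w.
  move=> hs; rewrite cupm_capm //; last by rewrite hs; move: hi; clear; lia.
  by congr (_ * (_ * _)); rewrite /mtr /tm /tau'; ring.
rewrite E // -(minus_capm _ hW hw) => [|m k hm hk nz]; last first.
  apply: (hC k m) => //; apply: contra nz => /eqP e; apply/eqP; rewrite -[RHS]e /gap /tau'; ring.
rewrite mulr_sumr; apply: eq_big_words => s hs.
by rewrite E // (minus_sym p2 q0 qp char0 xj hi) //; ring.
Qed.

Lemma plus_id : tl_eval q (corrected_jw t n (p - 1) (i - 1) (p - i) i p) (id_diagram n) = 1.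
Proof. by apply: corrected_jw_id; move: hi; clear; lia. Qed.

(** As a function of [w] the operator is q-symmetric in all [n] letters, so only the identity
    diagram contributes, with coefficient 1. *)
Lemma plus_capm tau W w : size W = N -> size w = n ->
  \sum_(s <- words n) capm q n i (tm q tau) W s * pq s w = capm q n i (tm q tau) W w.
Proof.
move=> hW hw; set T := capm q n i _.
transitivity (\sum_D tl_eval q (corrected_jw t n (p - 1) (i - 1) (p - i) i p) D *
   \sum_(s <- words n) T W s * dmat q D s w).
  under [RHS]eq_bigr => D _ do rewrite mulr_sumr.
  rewrite [RHS]exchange_big; apply: eq_bigr => s _; rewrite mulr_sumr.
  by apply: eq_bigr => D _; rewrite mulrCA.
rewrite (bigD1 (id_diagram n)) //= plus_id mul1r [X in _ + X]big1 => [|D nid]; [rewrite addr0|].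
  rewrite -(@big_words_delta _ n (T W) w) //; apply: eq_big_words => s hs.
  by rewrite dmat_id //; case: eqP => _; rewrite ?mulr1 ?mulr0.
have [j [k [jk e]]] := adjacent_out (diagram_planar D) (id_diagramP nid).
rewrite (kill_out jk _ e) ?mulr0 // => a c ha hc; apply: T_swap_in => //.
by rewrite ha -addnA.
Qed.

Lemma plus_cupm tau w W : size w = n -> size W = N ->
  \sum_(s <- words n) pq w s * cupm q n i (tm q tau) s W = cupm q n i (tm q tau) w W.
Proof.
move=> hw hW; set S := cupm q n i _.
transitivity (\sum_D tl_eval q (corrected_jw t n (p - 1) (i - 1) (p - i) i p) D *
   \sum_(s <- words n) dmat q D w s * S s W).
  under [RHS]eq_bigr => D _ do rewrite mulr_sumr.
  rewrite [RHS]exchange_big; apply: eq_bigr => s _; rewrite mulr_suml.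
  by apply: eq_bigr => D _; symmetry; apply: mulrA.
rewrite (bigD1 (id_diagram n)) //= plus_id mul1r [X in _ + X]big1 => [|D nid]; [rewrite addr0|].
  apply: etrans (@big_words_delta _ n (S^~ W) w hw); apply: eq_big_words => s hs.
  by rewrite dmat_id // eq_sym; case: eqP => _; rewrite ?mul1r ?mul0r.
have [j [k [jk e]]] := adjacent_in (diagram_planar D) (id_diagramP nid).
rewrite (kill_in jk _ q0 e) ?mulr0 // => a c ha hc.
pose tau' m k' := tau k' m.
have E s : S s W = q ^+ i * capm q n i (tm q tau') W s.
  rewrite /S cupm_capm //; last by rewrite hW; move: hi; clear; lia.
  by congr (_ * (_ * _)); rewrite /mtr /tm /tau'; ring.
by rewrite !E T_swap_in // ?ha -?addnA //; ring.
Qed.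

End Absorption.

(** * The operators alpha and beta on words *)

Section Taus.
Variables (K : fieldType) (q : K) (p : nat).
Hypotheses (p2 : (2 <= p)%N) (q0 : q != 0) (qp : q ^+ p = -1) (qq : q - q^-1 != 0).
Local Notation x := (q^-1 ^+ 2).
Hypothesis xj : forall j, (0 < j < p)%N -> 1 - x ^+ j != 0.
Local Notation M := (2 * p - 1)%N.
Local Notation qn := (qnum q).
Local Notation sy := (sy q).

Lemma qnum_pD j : qn (p + j) = - qn j.
Proof.
by rewrite /qnum !exprD qp invfM invrN1 !mulN1r -opprD mulNr.
Qed.

Lemma qnum_pB j : (j <= p)%N -> qn (p - j) = qn j.
Proof.
move=> hj; rewrite /qnum; congr (_ / _).
have e : q ^+ (p - j) = - q ^- j.
  by apply: (mulIf (expf_neq0 j q0)); rewrite -exprD subnK // mulNr mulVf ?expf_neq0.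
by rewrite e invrN invrK opprK addrC.
Qed.

Lemma qnum_2pB j : (j <= p)%N -> qn (2 * p - j) = - qn j.
Proof.
by move=> hj; rewrite (_ : 2 * p - j = p + (p - j))%N ?qnum_pD ?qnum_pB //; lia.
Qed.

Lemma q2p u : q ^+ (2 * p * u) = 1.
Proof. by rewrite exprM mulnC exprM qp sqrrN expr1n expr1n. Qed.

(** Equality of Laurent monomials whose exponents agree modulo [2p], with negative powers cleared so
    that only natural numbers are compared. *)
Lemma qexp a b c d u : (a + d = b + c + 2 * p * u)%N ->
  q ^+ a * q^-1 ^+ b = q ^+ c * q^-1 ^+ d.
Proof.
move=> h; apply: (mulIf (expf_neq0 b q0)); apply: (mulIf (expf_neq0 d q0)).
have e (k : nat) : q^-1 ^+ k * q ^+ k = 1 by rewrite -exprMn mulVf // expr1n.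
transitivity (q ^+ a * q ^+ d * (q^-1 ^+ b * q ^+ b)); first by ring.
transitivity (q ^+ b * q ^+ c * (q^-1 ^+ d * q ^+ d)); last by ring.
by rewrite !e !mulr1 -!exprD h exprD q2p mulr1.
Qed.

(** Gives alpha up to a constant: the exponent [k(2p-1-k)] found in [ab_coefE] is [-k(k+1)] modulo
    [2p]. *)
Definition ta m k : K := if (k < p)%N && (m == k + p)%N then q^-1 ^+ (k * k.+1) else 0.
Definition tb m k : K := ta k m.
(** The Gaussian binomial is the squared norm of the q-symmetric vector of weight [k + p] through
    which the composite factors. *)
Definition tba m k : K :=
  if (k < p)%N && (m == k) then q^-1 ^+ (2 * (k * k.+1)) * gbin x M (k + p) else 0.
Definition tab m k : K :=
  if (p <= k)%N && (m == k) then q^-1 ^+ (2 * ((k - p) * (k - p).+1)) * gbin x M (k - p) else 0.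

Lemma mmul_tab a b : size a = M -> size b = M ->
  mmul M (tm q ta) (tm q tb) a b = tm q tab a b.
Proof.
move=> ha hb; have cb := count_le b; have ca := count_le a.
rewrite hb in cb; rewrite ha in ca.
pose C := if (p <= count id b)%N && (count id a == count id b) then
  q^-1 ^+ (2 * ((count id b - p) * (count id b - p).+1)) * sy a * sy b else 0.
transitivity (\sum_(c <- words M) C * (if count id c == (count id b - p)%N then sy c ^+ 2 else 0)).
  apply: eq_bigr => c _; rewrite /tm /tb /ta /C.
  case: (count id c =P (count id b - p)%N) => [e|ne].
    rewrite e (_ : (count id b - p < p)%N); last by move: cb p2; clear; lia.
    case: leqP => /= h; rewrite ?(mul0r, mulr0) //.
      rewrite subnK // eqxx; case: eqP => _; rewrite ?(mul0r, mulr0) //.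
      by rewrite [in RHS]mul2n -addnn exprD; ring.
    have -> : (count id b == count id b - p + p)%N = false.
      by apply/negbTE; move: h p2; clear; lia.
    by rewrite /= !(mul0r, mulr0).
  rewrite mulr0; case: (ltnP (count id c) p) => //= hc; rewrite ?(mul0r, mulr0) //.
  case: (count id b =P (count id c + p)%N) => [e|]; rewrite ?(mul0r, mulr0) //.
  by case: ne; rewrite e addnK.
rewrite -mulr_sumr sum_sy2 /C /tm /tab.
by case: ifP => _; rewrite ?mul0r //; ring.
Qed.

Lemma mmul_tba a b : size a = M -> size b = M ->
  mmul M (tm q tb) (tm q ta) a b = tm q tba a b.
Proof.
move=> ha hb; have cb := count_le b; have ca := count_le a.
rewrite hb in cb; rewrite ha in ca.
pose C := if (count id b < p)%N && (count id a == count id b) then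
  q^-1 ^+ (2 * (count id b * (count id b).+1)) * sy a * sy b else 0.
transitivity (\sum_(c <- words M) C * (if count id c == (count id b + p)%N then sy c ^+ 2 else 0)).
  apply: eq_bigr => c _; rewrite /tm /tb /ta /C.
  case: (count id c =P (count id b + p)%N) => [e|ne]; last first.
    by rewrite [X in _ * X * _]mulrC !andbF ?(mul0r, mulr0).
  rewrite e eqn_add2r andbT [count id b == _]eq_sym.
  case: (count id a =P count id b) => [->|_]; rewrite ?andbF ?(mul0r, mulr0) //.
  rewrite andbT; case: ifP => _; rewrite ?(mul0r, mulr0) //.
  by rewrite [in RHS]mul2n -addnn exprD; ring.
rewrite -mulr_sumr sum_sy2 /C /tm /tba.
by case: ifP => _; rewrite ?mul0r //; ring.
Qed.

Lemma Fcomm_ta : Fcomm q M M (tm q ta).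
Proof.
apply: Fcomm_tm => // m k hm hk; rewrite /ta.
have [e|ne] := eqVneq m (k.+1 + p)%N; last first.
  rewrite andbF mul0r; case: ifP; rewrite ?mulr0 // => /andP[_ /eqP e].
  by exfalso; move: ne e p2; clear; case: m => [|m] /=; lia.
have kp : (k.+1 < p)%N by move: hm; rewrite e; clear; lia.
rewrite kp ltnW //= e addSn /= eqxx (addnC k p) -addnS qnum_pD.
have -> : (M - k = 2 * p - k.+1)%N by lia.
rewrite qnum_2pB; last by lia.
have -> : q^-1 ^+ (k * k.+1) = q ^+ k.+1 * (q^-1 ^+ (k.+1 * k.+2) * q^-1 ^+ (2 * p - k.+1)).
  by rewrite -exprD -[LHS]mul1r -[1](expr0 q); apply: (@qexp _ _ _ _ 1); move: kp; clear; nia.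
by ring.
Qed.

Lemma Fcomm_tb : Fcomm q M M (tm q tb).
Proof.
apply: Fcomm_tm => // m k hm hk; rewrite /tb /ta; case: m hm => [|m] hm /=.
  rewrite qnum0 mul0r; case: ifP => [/andP[_ /eqP e]|]; rewrite ?mul0r //.
  have -> : (M - k = p - 0)%N by move: e; clear; lia.
  by rewrite qnum_pB // qnum0 !mulr0.
have [e|ne] := eqVneq k (m + p)%N; last first.
  rewrite addSn eqSS (negPf ne) !andbF mulr0 mul0r //.
rewrite e addSn eqxx !andbT; case: (ltnP m.+1 p) => h; last first.
  case: ifP => h'; rewrite ?mulr0 ?mul0r //.
  have -> : (m.+1 = p - 0)%N by move: h h'; clear; lia.
  by rewrite qnum_pB // qnum0 !mul0r.
rewrite ltnW //; have -> : (M - (m + p) = p - m.+1)%N by move: h; clear; lia.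
rewrite qnum_pB; last by rewrite ltnW.
have -> : q^-1 ^+ (m * m.+1) = q ^+ (m + p).+1 * (q^-1 ^+ (m.+1 * m.+2) * q^-1 ^+ (p - m.+1)).
  by rewrite -exprD -[LHS]mul1r -[1](expr0 q); apply: (@qexp _ _ _ _ 0); move: h; clear; nia.
by ring.
Qed.

Lemma Fcomm_eq z' z A B : (forall a b, size a = z' -> size b = z -> A a b = B a b) ->
  Fcomm q z' z A -> Fcomm q z' z B.
Proof.
move=> e h W w hW hw; rewrite -(eq_big_words (f := fun u => Fm q W u * A u w)).
  by rewrite h //; apply: eq_big_words => u hu; rewrite e.
by move=> u hu; rewrite e.
Qed.

Lemma Fcomm_tab : Fcomm q M M (tm q tab).
Proof. by apply: Fcomm_eq mmul_tab _; apply: Fcomm_mul; [exact: Fcomm_ta | exact: Fcomm_tb]. Qed.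

Lemma Fcomm_tba : Fcomm q M M (tm q tba).
Proof. by apply: Fcomm_eq mmul_tba _; apply: Fcomm_mul; [exact: Fcomm_tb | exact: Fcomm_ta]. Qed.

(** Shifting the weight by [p] multiplies the eigenvalue of K by [q^(2p) = 1] or its inverse. *)
Lemma kcomp_tm tau : (forall m k, (m <= M)%N -> (k <= M)%N -> tau m k != 0 ->
    [\/ m = k, m = (k + p)%N | k = (m + p)%N]) -> kcomp q M M (tm q tau).
Proof.
move=> h W w hW hw; have cW := count_le W; have cw := count_le w.
rewrite hW in cW; rewrite hw in cw.
rewrite /tm mulf_eq0 negb_or => /andP[/(h _ _ cW cw) hc _].
rewrite !kqE !count_negb hW hw; move: (count id W) (count id w) cW cw hc => m k hm hk.
case=> [->//|e|e].
  by apply: (@qexp _ _ _ _ 1); move: hm; rewrite e; clear; lia.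
by symmetry; apply: (@qexp _ _ _ _ 1); move: hk; rewrite e; clear; lia.
Qed.

Lemma gM_step m : (m < M)%N -> ~~ (p %| m.+1)%N ->
  gbin x M m.+1 = - q ^+ (2 * m.+1) * gbin x M m.
Proof.
move=> hm nd; rewrite (gM_succ p2 q0 qp xj nd hm); congr (- _ * _).
by rewrite -exprM exprVn invrK.
Qed.

(** Within these bounds the two terms are both present or both absent, and they cancel because
    [q^p = -1]. *)
Lemma gap_ta m k : (m < M)%N -> (k < M)%N -> gap q p ta m k = 0.
Proof.
move=> hm hk; rewrite /gap /ta; have [e|ne] := eqVneq m (k + p)%N; last first.
  by rewrite addSn eqSS (negPf ne) !andbF !mulr0 addr0.
rewrite e addSn eqxx !andbT; have kp : (k.+1 < p)%N by move: hm; rewrite e; clear; lia.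
rewrite kp ltnW //.
have := @qexp 1 (k * k.+1) p (1 + (M.-1 - (k + p)) + (M.-1 - k) + k.+1 * k.+2) 1.
rewrite qp expr1 !exprD expr1 => E; rewrite E; first by ring.
by move: kp; clear; nia.
Qed.

Lemma gap_tb m k : (m < M)%N -> (k < M)%N -> gap q p tb m k = 0.
Proof. by move=> hm hk; rewrite -(gap_ta hk hm) /gap /tb; ring. Qed.

(** Inside the support of [tba] the two terms cancel by [gM_step]; only at its upper edge
    [k = p - 1] does a single term survive. For [tab] the same happens at the lower edge. *)
Lemma gap_tba m k : (m < M)%N -> (k < M)%N -> gap q p tba m k != 0 -> m = p.-1 /\ k = p.-1.
Proof.
move=> hm hk; rewrite /gap /tba eqSS; have [->|ne] := eqVneq m k; last first.
  by rewrite !andbF !mulr0 addr0 eqxx.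
rewrite !andbT; case: (ltnP k.+1 p) => h.
  rewrite ltnW // addSn gM_step; first last.
  - apply/negP => /dvdnP[c]; move: h; case: c => [|[|c]]; rewrite ?mulSn; clear; lia.
  - by move: h; clear; lia.
  have := @qexp 1 (2 * (k * k.+1)) (2 * (k + p).+1) (1 + (M.-1 - k) + (M.-1 - k) + 2 * (k.+1 * k.+2)) 1.
  rewrite expr1 [q^-1 ^+ (1 + _ + _ + _)]exprD ![q^-1 ^+ (_ + (M.-1 - k))]exprD expr1 => E.
  rewrite (_ : _ + _ = 0) ?eqxx // [q * (_ * _)]mulrA E; first by ring.
  by move: h; clear; nia.
case: ifP => [h' _|_]; last by rewrite !mulr0 addr0 eqxx.
by have -> : k = p.-1 by move: h h'; clear; lia.
Qed.

Lemma gap_tab m k : (m < M)%N -> (k < M)%N -> gap q p tab m k != 0 -> m = p.-1 /\ k = p.-1.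
Proof.
move=> hm hk; rewrite /gap /tab eqSS; have [->|ne] := eqVneq m k; last first.
  by rewrite !andbF !mulr0 addr0 eqxx.
rewrite !andbT; case: (leqP p k) => h.
  rewrite leqW // subSn // gM_step; first last.
  - apply/negP => /dvdnP[c]; move: h hk; case: c => [|c]; rewrite ?mulSn; clear; nia.
  - by move: h hk; clear; lia.
  have := @qexp 1 (2 * ((k - p) * (k - p).+1)) (2 * (k - p).+1)
    (1 + (M.-1 - k) + (M.-1 - k) + 2 * ((k - p).+1 * (k - p).+2)) 1.
  rewrite expr1 [q^-1 ^+ (1 + _ + _ + _)]exprD ![q^-1 ^+ (_ + (M.-1 - k))]exprD expr1 => E.
  rewrite (_ : _ + _ = 0) ?eqxx // [q * (_ * _)]mulrA E; first by ring.
  have [j hj] : exists j, k = (p + j)%N by exists (k - p)%N; rewrite subnKC.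
  by move: hk; rewrite hj addKn; clear; nia.
case: ifP => [h' _|_]; last by rewrite !mulr0 addr0 eqxx.
by have -> : k = p.-1 by move: h h'; clear; lia.
Qed.

End Taus.

(** * Linear maps given by matrices on words *)

Section HasMatrix.
Variable K : fieldType.
Implicit Types A B : seq bool -> seq bool -> K.

Definition hasmat z z' (f : tpow K z -> tpow K z') A :=
  forall v w', f v w' = \sum_(w : z.-tuple bool) v w * A w' w.

Lemma hasmat_ext z z' f A B : (forall a b, size a = z' -> size b = z -> A a b = B a b) ->
  @hasmat z z' f A -> hasmat f B.
Proof.
by move=> e h v w'; rewrite h; apply: eq_bigr => w _; rewrite e ?size_tuple.
Qed.

Lemma hasmat_eq z z' (f g : tpow K z -> tpow K z') A : hasmat f A -> hasmat g A -> f =1 g.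
Proof. by move=> hf hg v; apply/ffunP => w; rewrite hf hg. Qed.

Lemma hasmat_lext z z' (f : z.-tuple bool -> tpow K z') A :
  (forall w w', f w w' = A w' w) -> hasmat (lext f) A.
Proof. by move=> e v w'; rewrite sum_ffunE; apply: eq_bigr => w _; rewrite ffunE e. Qed.

Lemma hasmat_id z : hasmat (@id (tpow K z)) (fun a b => (a == b)%:R).
Proof.
move=> v w'; rewrite (bigD1 w') //= eqxx mulr1 big1 ?addr0 // => w /negPf ne.
by rewrite -[_ == _]/(w' == w) eq_sym ne mulr0.
Qed.

Lemma hasmat_comp z1 z2 z3 (f : tpow K z1 -> tpow K z2) (g : tpow K z2 -> tpow K z3) A B :
  hasmat f A -> hasmat g B -> hasmat (g \o f) (mmul z2 B A).
Proof.
move=> hf hg v w' /=; rewrite hg.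
transitivity (\sum_(c : z2.-tuple bool) \sum_(w : z1.-tuple bool) v w * A c w * B w' c).
  by apply: eq_bigr => c _; rewrite hf mulr_suml.
rewrite exchange_big /=; apply: eq_bigr => w _; rewrite /mmul -big_words_tuple mulr_sumr.
by apply: eq_bigr => c _; ring.
Qed.

Lemma hasmat_add z z' (f g : tpow K z -> tpow K z') A B : hasmat f A -> hasmat g B ->
  hasmat (fun v => f v + g v) (fun a b => A a b + B a b).
Proof.
move=> hf hg v w'; rewrite ffunE hf hg -big_split /=.
by apply: eq_bigr => w _; rewrite mulrDr.
Qed.

Lemma hasmat_linear z z' (f : tpow K z -> tpow K z') A : hasmat f A -> linear f.
Proof.
move=> h c u v; apply/ffunP => w'; rewrite !ffunE !h scaler_sumr -big_split /=.
by apply: eq_bigr => w _; rewrite !ffunE mulrDl -mulrA.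
Qed.

Lemma coordE z (v : tpow K z) s (hs : size s == z) : Defs.coord v s = v (Tuple hs).
Proof.
by rewrite /Defs.coord (big_pred1 (Tuple hs)).
Qed.

Lemma coord_mat z z' (f : tpow K z -> tpow K z') A s' s : hasmat f A ->
  size s' = z' -> size s = z -> Defs.coord (f (rho K z s)) s' = A s' s.
Proof.
move=> h /eqP hs' /eqP hs; rewrite (coordE _ hs') h (bigD1 (Tuple hs)) //=.
rewrite ffunE /= eqxx mul1r big1 ?addr0 // => w ne; rewrite ffunE.
by rewrite (_ : (tval w == s) = false) ?mul0r //; apply: negPf.
Qed.

Lemma hasmat_tens m1 n1 m2 n2 m n (f : tpow K m1 -> tpow K n1) (g : tpow K m2 -> tpow K n2) A B :
  m = (m1 + m2)%N -> n = (n1 + n2)%N -> hasmat f A -> hasmat g B ->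
  hasmat (@tens K m1 n1 m2 n2 m n f g)
    (fun w' w => A (take n1 w') (take m1 w) * B (drop n1 w') (drop m1 w)).
Proof.
move=> hm hn hf hg; apply: hasmat_lext => w w'; rewrite ffunE.
have e k l (u : k.-tuple bool) : (l <= k)%N -> size (take l u) = l.
  by move=> h; rewrite size_takel ?size_tuple.
rewrite (coord_mat hf) ?e ?(coord_mat hg) ?size_drop ?size_tuple //; lia.
Qed.

Lemma hasmat_tl_act n (q : K) (f : tl_alg K n) : hasmat (tl_act q f) (tlmat q f).
Proof.
apply: hasmat_lext => w w'; rewrite ffunE.
by apply: eq_bigr => D _; rewrite dmat_tuple.
Qed.

End HasMatrix.

(** * E, F and K on words *)

Section Actions.
Variables (K : fieldType) (q : K).
Hypotheses (q0 : q != 0) (qq : q - q^-1 != 0).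
Local Notation kq := (kq q).
Local Notation Fm := (Fm q).
Local Notation sy := (sy q).

Definition Em s' s : K := q^-1 * (kq s')^-1 * Fm s s'.

Lemma size1P (w : seq bool) : size w = 1%N -> w = [:: head false w].
Proof. by case: w => [|b []]. Qed.

Lemma actions_mat z :
  [/\ hasmat (actE (tpow_action q z)) Em, hasmat (actF (tpow_action q z)) Fm,
      hasmat (actK (tpow_action q z)) (fun a b => (a == b)%:R * (kq b)^-1) &
      hasmat (actKV (tpow_action q z)) (fun a b => (a == b)%:R * kq b)].
Proof.
have th (w : 1.-tuple bool) : thead w = head false w by rewrite /thead (tnth_nth false) nth0.
have e1 (w : 1.-tuple bool) c : (tval w == [:: c]) = (head false w == c).
  by rewrite {1}(size1P (size_tuple w)) eqseq_cons andbT.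
have e2 (w w' : 1.-tuple bool) : (tval w == w') = (head false w == head false w').
  by rewrite {1}(size1P (size_tuple w')) e1.
have XE : hasmat (actE (X_action q)) (fun a b => (~~ head false a && head false b)%:R).
  apply: hasmat_lext => w w'; rewrite th; case: (head false w); rewrite ffunE ?e1 ?andbF //.
  by case: (head false w').
have XF : hasmat (actF (X_action q)) (fun a b => (head false a && ~~ head false b)%:R).
  apply: hasmat_lext => w w'; rewrite th; case: (head false w); rewrite ffunE ?e1 ?andbF //.
  by case: (head false w').
have XK : hasmat (actK (X_action q)) (fun a b => (head false a == head false b)%:R *
     (if head false b then q^-1 else q)).
  by apply: hasmat_lext => w w'; rewrite th !ffunE e2 [_ *: _]mulrC.
have XKV : hasmat (actKV (X_action q)) (fun a b => (head false a == head false b)%:R *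
     (if head false b then q else q^-1)).
  by apply: hasmat_lext => w w'; rewrite th !ffunE e2 [_ *: _]mulrC.
elim: z => [|z [IE IF IK IKV]].
  have nilw (w : 0.-tuple bool) : w = [tuple] by apply: tuple0.
  have e0 (F : 0.-tuple bool -> K) : \sum_w F w = F [tuple].
    by rewrite (big_pred1 [tuple]) // => w; rewrite (nilw w).
  split=> v w'; rewrite e0 (nilw w') /= ?ffunE /Em /= ?kq_nil ?invr1 ?mulr0 ?mulr1 //.
have cE a b : size a = z.+1 -> size b = z.+1 -> exists x y s r,
    [/\ a = x :: s, b = y :: r, size s = z & size r = z].
  by case: a b => [|x s] // [|y r] // [hs] [hr]; exists x, y, s, r.
split.
- apply: hasmat_ext (hasmat_add (hasmat_tens _ _ XE IK) (hasmat_tens _ _ (@hasmat_id K 1) IE)) => //.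
  move=> a b /cE h /h[x [y [s [r [-> -> hs hr]]]]] /=.
  rewrite !drop0 !take0 /Em /= !kq_cons !invfM eqseq_cons eqxx andbT [y == x]eq_sym [r == s]eq_sym ?invrK.
  case: x; case: y => /=; rewrite ?(mul0r, mulr0, addr0, add0r, mul1r, mulr1) //.
  + by field; rewrite ?q0 ?kq_neq0.
  + by case: eqP => [->|_]; rewrite ?(mulr0n, mul0r, mulr0, mul1r) // invrK mulrA mulVf ?mul1r ?mulr1.
  + by field; rewrite ?q0 ?kq_neq0 ?oner_neq0.
- apply: hasmat_ext (hasmat_add (hasmat_tens _ _ XF (@hasmat_id K z)) (hasmat_tens _ _ XKV IF)) => //.
  move=> a b /cE h /h[x [y [s [r [-> -> hs hr]]]]] /=.
  rewrite !drop0; case: x; case: y => /=; rewrite ?(mul0r, mulr0, addr0, add0r, mul1r, mulr1) //.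
  by case: eqP.
- apply: hasmat_ext (hasmat_tens _ _ XK IK) => //.
  move=> a b /cE h /h[x [y [s [r [-> -> hs hr]]]]] /=.
  rewrite !drop0 kq_cons invfM eqseq_cons mulrACA -natrM mulnb.
  by case: y; rewrite ?invrK.
- apply: hasmat_ext (hasmat_tens _ _ XKV IKV) => //.
  move=> a b /cE h /h[x [y [s [r [-> -> hs hr]]]]] /=.
  by rewrite !drop0 kq_cons eqseq_cons mulrACA -natrM mulnb.
Qed.


Lemma count_id_eq0 s : (count id s == 0%N) = (s == nseq (size s) false).
Proof. by elim: s => //= -[] s IHs; rewrite eqseq_cons // -IHs. Qed.

Lemma count_negb_eq0 s : (count negb s == 0%N) = (s == nseq (size s) true).
Proof. by elim: s => //= -[] s IHs; rewrite eqseq_cons // -IHs. Qed.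

Lemma count_id0_sy s : count id s = 0%N -> sy s = 1.
Proof.
elim: s => [|b s IHs] //=; rewrite sy_cons; case: b => //=.
by rewrite add0n => h; rewrite h IHs // mulr1.
Qed.

Lemma count_negb0_sy s : count negb s = 0%N -> sy s = 1.
Proof. by elim: s => [|[] s IHs] //=; rewrite sy_cons mul1r. Qed.

Lemma iter_F z m (w : z.-tuple bool) :
  iter m (actF (tpow_action q z)) (rho K z (nseq z false)) w =
  if count id w == m then qfact q m * sy w else 0.
Proof.
have [_ hF _ _] := actions_mat z; elim: m w => [|m IHm] w.
  rewrite ffunE /qfact big_nil mul1r.
  have -> : (tval w == nseq z false) = (count id w == 0%N).
    by rewrite count_id_eq0 size_tuple.
  by case: eqP => // /count_id0_sy->.
rewrite /= hF.
transitivity (\sum_(u <- words z) Fm w u * (if (count id u).+1 == count id w then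
   if count id w == m.+1 then qfact q m * sy u else 0 else 0)).
  rewrite -big_words_tuple; apply: eq_bigr => u _; rewrite IHm mulrC.
  have [->|nz] := eqVneq (Fm w u) 0; first by rewrite !mul0r.
  by rewrite (Fm_count _ nz) ?size_tuple // eqxx eqSS.
case: (count id w =P m.+1) => [e|_]; last first.
  by rewrite big1 // => u _; rewrite if_same mulr0.
transitivity (qfact q m * \sum_(u <- words z) Fm w u * sy u).
  rewrite mulr_sumr; apply: eq_big_words => u hu.
  have [->|nz] := eqVneq (Fm w u) 0; first by rewrite !mul0r mulr0.
  by rewrite (Fm_count _ nz) ?size_tuple // eqxx; ring.
rewrite sum_Fm_sy ?size_tuple // e /qfact [in RHS]big_nat_recr //= mulrA.
by [].
Qed.

Lemma iter_E z m (w : z.-tuple bool) :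
  iter m (actE (tpow_action q z)) (rho K z (nseq z true)) w =
  if count negb w == m then qfact q m * sy w else 0.
Proof.
have [hE _ _ _] := actions_mat z; elim: m w => [|m IHm] w.
  rewrite ffunE /qfact big_nil mul1r.
  have -> : (tval w == nseq z true) = (count negb w == 0%N).
    by rewrite count_negb_eq0 size_tuple.
  by case: eqP => // /count_negb0_sy->.
rewrite /= hE.
transitivity (\sum_(u <- words z) Em w u * (if count negb w == m.+1 then qfact q m * sy u else 0)).
  rewrite -big_words_tuple; apply: eq_bigr => u _; rewrite IHm mulrC /Em.
  have [->|nz] := eqVneq (Fm u w) 0; first by rewrite !(mulr0, mul0r).
  have := Fm_count _ nz; rewrite !size_tuple => /(_ erefl) e.
  have := count_le u; rewrite !count_negb !size_tuple e => h.
  by rewrite (_ : (z - count id w = (z - (count id w).+1).+1)%N) ?eqSS //; lia.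
case: (count negb w =P m.+1) => [e|_]; last first.
  by rewrite big1 // => u _; rewrite mulr0.
transitivity (qfact q m * (q^-1 * (kq w)^-1 * \sum_(u <- words z) sy u * Fm u w)).
  rewrite mulrA mulr_sumr; apply: eq_bigr => u _; rewrite /Em; ring.
rewrite sum_sy_Fm ?size_tuple // e /qfact [in RHS]big_nat_recr //= kqE e [q ^+ _.+1]exprS.
set A := \prod_(_ <= _ < _) _.
have := expf_neq0 (count id w) q0; have : q^-1 ^+ m.+1 != 0 by rewrite expf_neq0 ?invr_neq0.
move: (q^-1 ^+ m.+1) (q ^+ _) => a b a0 b0.
by field; rewrite ?q0 ?a0 ?b0 ?oner_neq0.
Qed.

End Actions.

(** Turns the sum of positions in [ab_coef] into inversions, so that this coefficient becomes [sy]
    times a power of [q] depending on the weight alone. *)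
Lemma sum_positions (s : seq bool) :
  (\sum_(0 <= j < size s | nth false s j) j.+1 = inv s + 'C(count id s, 2) + count id s)%N.
Proof.
elim: s => [|b s IHs]; first by rewrite big_nil.
rewrite /= big_mkcond big_nat_recl //= -big_mkcond /=.
have -> : (\sum_(0 <= j < size s | nth false s j) j.+2 =
    \sum_(0 <= j < size s | nth false s j) j.+1 + count id s)%N.
  transitivity (\sum_(0 <= j < size s | nth false s j) (j.+1 + 1))%N.
    by apply: eq_bigr => j _; rewrite addn1.
  rewrite big_split /=; congr (_ + _)%N; elim: s {IHs} => [|c s IHs]; first by rewrite big_nil.
  by rewrite /= big_mkcond big_nat_recl //= -big_mkcond /= IHs; case: c.
rewrite IHs; case: b => /=; rewrite ?add0n ?add1n; last by lia.
by rewrite binS bin1; lia.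
Qed.

(** * The matrices of alpha and beta *)

Section Operators.
Variables (K : fieldType) (q : K) (p : nat).
Hypotheses (p2 : (2 <= p)%N) (q0 : q != 0) (qp : q ^+ p = -1) (qq : q - q^-1 != 0).
Local Notation x := (q^-1 ^+ 2).
Hypothesis xj : forall j, (0 < j < p)%N -> 1 - x ^+ j != 0.
Local Notation M := (2 * p - 1)%N.
Local Notation sy := (sy q).
Local Notation qf := (qfact q).

Lemma ab_coefE (w : M.-tuple bool) :
  ab_coef q w = q ^+ (count id w * (M - count id w)) * sy w.
Proof.
rewrite /ab_coef.
have -> : (\sum_(j < M | tnth w j) j.+1 = inv w + 'C(count id w, 2) + count id w)%N.
  rewrite -sum_positions size_tuple big_mkord.
  by apply: eq_bigl => j; rewrite (tnth_nth false).
have ck := count_le w; rewrite size_tuple in ck.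
rewrite syE; move: (count id w) (inv w) ck => k l hk.
have hC : (2 * 'C(k, 2) + k = k * k)%N.
  by elim: k {hk} => // k IHk; rewrite binS bin1; lia.
have -> : (k * M)%N%:Z - 'C(k, 2)%:Z - (l + 'C(k, 2) + k)%N%:Z = (k * (M - k))%N%:Z - l%:Z.
  have : (k * M = k * (M - k) + k * k)%N by rewrite -mulnDr subnK.
  by move: (k * M)%N (k * (M - k))%N (k * k)%N hC => a b c; lia.
by rewrite expfzDr // exprVn exprnN.
Qed.

(** Since [[p-k-1] = [k+1]], a factor can move from one factorial to the other. Hence [[k]!] in
    alpha and the factorial produced by the power of E combine to a constant. *)
Lemma qfact_pB k : (k < p)%N -> qf k * qf (p - k - 1) = qf (p - 1).
Proof.
elim: k => [|k IHk] hk; first by rewrite {1}/qfact big_nil mul1r subn0.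
rewrite -IHk; last by rewrite ltnW.
rewrite [qf k.+1]big_nat_recr //= -/(qf k) -mulrA; congr (_ * _).
rewrite (_ : p - k - 1 = (p - k.+1 - 1).+1)%N; last by lia.
rewrite [qf _.+1]big_nat_recr //= mulrC; congr (_ * _).
by rewrite (_ : (p - k.+1 - 1).+1 = p - k.+1)%N ?qnum_pB //; lia.
Qed.

Lemma qn_neq0 j : (0 < j < p)%N -> qnum q j != 0.
Proof.
move=> hj; rewrite /qnum mulf_neq0 ?invr_neq0 //.
have -> : q ^+ j - q ^- j = q ^+ j * (1 - x ^+ j).
  rewrite -exprM exprVn mul2n -addnn exprD mulrBr mulr1 invfM mulrA divff ?mul1r //.
  by rewrite expf_neq0.
by rewrite mulf_neq0 ?expf_neq0 ?xj.
Qed.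

Lemma qfact_neq0 j : (j < p)%N -> qf j != 0.
Proof.
elim: j => [|j IHj] hj; first by rewrite /qfact big_nil oner_neq0.
by rewrite [qf _]big_nat_recr //= mulf_neq0 ?qn_neq0 ?IHj // ltnW.
Qed.


Lemma alpha_mat :
  hasmat (alpha p q) (fun a b => qf (p - 1) * tm q (ta q p) a b).
Proof.
apply: hasmat_lext => w w'; cbv zeta; case: (ltnP (count id w) p) => hw; last first.
  by rewrite ffunE /tm /ta ltnNge hw mul0r mulr0.
rewrite ffunE iter_E // ab_coefE /tm /ta hw /=.
have c' := count_le w'; have -> : (count negb w' == p - count id w - 1)%N =
    (count id w' == count id w + p)%N.
  by rewrite count_negb size_tuple; rewrite size_tuple in c'; move: c' hw; clear; lia.
case: eqP => [e|_]; last by rewrite scaler0 mul0r mulr0.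
rewrite -(qfact_pB hw).
have -> : q ^+ (count id w * (M - count id w)) = q^-1 ^+ (count id w * (count id w).+1).
  have := @qexp _ q p q0 qp (count id w * (M - count id w)) 0 0
    (count id w * (count id w).+1) (count id w).
  rewrite !expr0 mulr1 mul1r; apply; move: (count id w) hw; clear=> k hk.
  have [m hm] : exists m, p = (k.+1 + m)%N by exists (p - k.+1)%N; lia.
  have -> : (M - k = k + 2 * m + 1)%N by lia.
  by rewrite hm; nia.
rewrite /GRing.scale /=; ring.
Qed.

Lemma beta_mat :
  hasmat (beta p q) (fun a b => (-1) ^+ p.+1 * qf (p - 1) * tm q (tb q p) a b).
Proof.
apply: hasmat_lext => w w'; cbv zeta; have cw := count_le w; rewrite size_tuple in cw.
case: (leqP p (count id w)) => hw; last first.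
  rewrite ffunE /tm /tb /ta [(count id w == _)](_ : _ = false) ?andbF ?mul0r ?mulr0 //.
  by apply/eqP; move: hw; clear; lia.
rewrite ffunE iter_F // ab_coefE /tm /tb /ta.
case: (count id w' =P (count id w - p)%N) => [e|ne]; last first.
  rewrite scaler0 [(count id w == _)](_ : _ = false) ?andbF ?mul0r ?mulr0 //.
  by apply/eqP; move: hw ne; clear; lia.
have hm : (count id w' < p)%N by rewrite e; move: hw cw p2; clear; lia.
have ew : (count id w = count id w' + p)%N by rewrite e subnK.
rewrite -e hm ew eqxx /= -(qfact_pB hm).
have -> : (M - (count id w' + p) = p - count id w' - 1)%N by move: hm; clear; lia.
have -> : q ^+ ((count id w' + p) * (p - count id w' - 1)) =
    (-1) ^+ p.+1 * q^-1 ^+ (count id w' * (count id w').+1).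
  (* With [k] the number of letters [true] in [w'], the exponent [(k+p)(p-k-1)] equals
     [p(p-1) - k(k+1)], and [q^p = -1] turns its first part into a sign. *)
  have -> : (-1) ^+ p.+1 = q ^+ (p * (p - 1)).
    rewrite exprM qp -signr_odd -[RHS]signr_odd; congr (_ ^+ (nat_of_bool _)).
    by move: p2; clear; case: p => // k; rewrite subn1 /= negbK.
  have := @qexp _ q p q0 qp ((count id w' + p) * (p - count id w' - 1)) 0 (p * (p - 1))
    (count id w' * (count id w').+1) 0.
  rewrite !expr0 mulr1; apply; move: (count id w') hm; clear=> k hk.
  have [m hm] : exists m, p = (k.+1 + m)%N by exists (p - k.+1)%N; lia.
  have -> : (p - k - 1 = m)%N by lia.
  have -> : (p - 1 = k + m)%N by lia.
  by rewrite hm; nia.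
rewrite /GRing.scale /=; ring.
Qed.

Lemma hasmat_comm z z' (f : tpow K z -> tpow K z') A : hasmat f A ->
  Fcomm q z' z A -> Fcomm q z z' (mtr A) -> kcomp q z' z A ->
  [/\ forall v, f (actE (tpow_action q z) v) = actE (tpow_action q z') (f v),
      forall v, f (actF (tpow_action q z) v) = actF (tpow_action q z') (f v) &
      forall v, f (actK (tpow_action q z) v) = actK (tpow_action q z') (f v)].
Proof.
move=> hf hF hT hK; have [E F Kz _] := actions_mat q0 z.
have [E' F' Kz' _] := actions_mat q0 z'.
split.
- apply: (hasmat_eq (hasmat_ext _ (hasmat_comp E hf)) (hasmat_comp hf E')) => w' w hw' hw.
  rewrite /mmul /Em.
  transitivity (q^-1 * (kq q w')^-1 * \sum_(c <- words z) A w' c * Fm q w c).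
    rewrite mulr_sumr; apply: eq_big_words => c hc.
    have [->|nz] := eqVneq (A w' c) 0; first by rewrite !(mul0r, mulr0).
    by rewrite (hK _ _ hw' hc nz); ring.
  transitivity (q^-1 * (kq q w')^-1 * \sum_(c <- words z') A c w * Fm q c w').
    congr (_ * _); have := hT w w' hw hw'; rewrite /mtr => e.
    by rewrite -e; apply: eq_bigr => c _; rewrite mulrC.
  by rewrite mulr_sumr; apply: eq_bigr => c _; ring.
- apply: (hasmat_eq (hasmat_ext _ (hasmat_comp F hf)) (hasmat_comp hf F')) => w' w hw' hw.
  by rewrite /mmul hF.
apply: (hasmat_eq (hasmat_ext _ (hasmat_comp Kz hf)) (hasmat_comp hf Kz')) => w' w hw' hw.
rewrite /mmul.
transitivity (A w' w * (kq q w)^-1).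
  rewrite -(@big_words_delta _ z (fun c => A w' c * (kq q w)^-1) w) //.
  by apply: eq_bigr => c _; case: eqP => _; rewrite ?mul1r // mul0r mulr0.
transitivity ((kq q w')^-1 * A w' w).
  have [->|nz] := eqVneq (A w' w) 0; first by rewrite mul0r mulr0.
  by rewrite (hK _ _ hw' hw nz) mulrC.
rewrite -(@big_words_delta _ z' (fun c => (kq q c)^-1 * A c w) w') //.
by apply: eq_bigr => c _; rewrite eq_sym; case: eqP => _; rewrite ?mul1r // !mul0r.
Qed.

Section CapThen.
Variable i : nat.
Hypothesis hi : (0 < i < p)%N.
Local Notation n := (2 * p - i - 1)%N.
Local Notation N := (2 * p + i - 1)%N.

Lemma ncap_mat : hasmat (@ncap K q i)
  (fun w' _ => if drop i w' == bar (take i w') then capc q (take i w') else 0).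
Proof.
apply: hasmat_lext => w w'; rewrite ffunE -(@ncap_cat _ q i) ?cat_take_drop ?size_takel ?size_drop ?size_tuple //; lia.
Qed.

Lemma ncup_mat : hasmat (@ncup K q i)
  (fun _ w => if drop i w == bar (take i w) then cupc q (take i w) else 0).
Proof.
apply: hasmat_lext => w w'; rewrite !ffunE tuple0 eqxx [_ *: _]mulr1.
rewrite -(@ncup_cat _ q i) ?cat_take_drop ?size_takel ?size_drop ?size_tuple //; lia.
Qed.

Lemma cap_then_mat (T : tpow K M -> tpow K M) A : hasmat T A ->
  hasmat (cap_then q i T) (capm q n i A).
Proof.
move=> hT; have h1 : N = (M + i)%N by lia.
have h2 : n = (n + 0)%N by rewrite addn0.
have h3 : N = (n + (i + i))%N by lia.
have h4 : N = (n + 2 * i)%N by lia.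
have h5 : M = (n + i)%N by lia.
have g1 := hasmat_tens h1 h1 hT (@hasmat_id K i).
have g2 := hasmat_tens h2 h4 (@hasmat_id K n) ncap_mat.
apply: hasmat_ext (hasmat_comp g2 g1) => W w hW hw.
have [a [y [-> ha hy]]] := cut_word (etrans hW h1).
rewrite capm_cat -?h5 // /mmul (congr1 words h3) big_words_cat.
rewrite !take_size_cat // !drop_size_cat //.
transitivity (\sum_(s1 <- words n) if s1 == w then capc q (bar y) * A a (s1 ++ bar y) else 0).
  apply: eq_big_words => s1 hs1; rewrite big_words_cat.
  transitivity (\sum_(u <- words i) if u == bar y then
      (if s1 == w then capc q u * A a (s1 ++ u) else 0) else 0).
    apply: eq_big_words => u hu.
    rewrite -(@big_words_delta _ i (fun z => if u == bar y then
      (if s1 == w then capc q u * A a (s1 ++ u) else 0) else 0) y) //.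
    apply: eq_big_words => z hz.
    have k1 : take M (s1 ++ u ++ z) = s1 ++ u by rewrite catA take_size_cat // size_cat hs1 hu.
    have k2 : drop M (s1 ++ u ++ z) = z by rewrite catA drop_size_cat // size_cat hs1 hu.
    rewrite k1 k2 take_size_cat // drop_size_cat // take_size_cat // drop_size_cat //.
    rewrite take_oversize ?hw // [z == y]eq_sym.
    case: (y =P z) => [<-|_]; last by rewrite mulr0 mul0r.
    rewrite mulr1 -{1}[y]barK (can_eq barK) [bar y == u]eq_sym; case: (s1 == w); case: (u == bar y);
      rewrite ?(mul1r, mul0r, mulr0) //; ring.
  by rewrite (@big_words_delta _ i (fun u => if s1 == w then capc q u * A a (s1 ++ u) else 0))
    ?size_bar.
exact: (@big_words_delta _ n (fun s1 => capc q (bar y) * A a (s1 ++ bar y)) w).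
Qed.

Lemma then_cup_mat (T : tpow K M -> tpow K M) A : hasmat T A ->
  hasmat (then_cup q i T) (cupm q n i A).
Proof.
move=> hT; have h1 : N = (M + i)%N by lia.
have h2 : n = (n + 0)%N by rewrite addn0.
have h3 : N = (n + (i + i))%N by lia.
have h4 : N = (n + 2 * i)%N by lia.
have h5 : M = (n + i)%N by lia.
have g1 := hasmat_tens h1 h1 hT (@hasmat_id K i).
have g2 := hasmat_tens h4 h2 (@hasmat_id K n) ncup_mat.
apply: hasmat_ext (hasmat_comp g1 g2) => w W hw hW.
have [a [y [-> ha hy]]] := cut_word (etrans hW h1).
rewrite cupm_cat -?h5 // /mmul (congr1 words h3) big_words_cat.
rewrite !take_size_cat // !drop_size_cat //.
transitivity (\sum_(s1 <- words n) if s1 == w then cupc q (bar y) * A (s1 ++ bar y) a else 0).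
  apply: eq_big_words => s1 hs1; rewrite big_words_cat.
  transitivity (\sum_(u <- words i) if u == bar y then
      (if s1 == w then cupc q u * A (s1 ++ u) a else 0) else 0).
    apply: eq_big_words => u hu.
    rewrite -(@big_words_delta _ i (fun z => if u == bar y then
      (if s1 == w then cupc q u * A (s1 ++ u) a else 0) else 0) y) //.
    apply: eq_big_words => z hz.
    have k1 : take M (s1 ++ u ++ z) = s1 ++ u by rewrite catA take_size_cat // size_cat hs1 hu.
    have k2 : drop M (s1 ++ u ++ z) = z by rewrite catA drop_size_cat // size_cat hs1 hu.
    rewrite k1 k2 take_size_cat // drop_size_cat // take_size_cat // drop_size_cat //.
    rewrite take_oversize ?hw // [w == s1]eq_sym.
    case: (z =P y) => [->|_]; last by rewrite !mulr0.
    rewrite mulr1 -{1}[y]barK (can_eq barK) [bar y == u]eq_sym; case: (s1 == w); case: (u == bar y);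
      rewrite ?(mul1r, mul0r, mulr0) //; ring.
  by rewrite (@big_words_delta _ i (fun u => if s1 == w then cupc q u * A (s1 ++ u) a else 0))
    ?size_bar.
exact: (@big_words_delta _ n (fun s1 => cupc q (bar y) * A (s1 ++ bar y) a) w).
Qed.

End CapThen.

End Operators.

(** * Homomorphisms between projective modules *)

Section ProjBasis.
Variables (K : fieldType) (p s : nat).

Definition pe (e : proj_idx p s) : proj_mod K p s :=
  match e with
  | inl (inl k) => pa K p s k
  | inl (inr k) => pb K p s k
  | inr (inl j) => px K p s j
  | inr (inr j) => py K p s j
  end.

Lemma peE e e' : pe e e' = (e' == e)%:R.
Proof. by case: e => -[] k; case: e' => -[] k'; rewrite ffunE. Qed.

Lemma pe_sum (v : proj_mod K p s) : v = \sum_e v e *: pe e.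
Proof.
apply/ffunP => e; rewrite sum_ffunE (bigD1 e) //= ffunE peE eqxx.
rewrite big1 ?addr0 => [|e' /negPf ne]; first by rewrite [_ *: _]mulr1.
by rewrite ffunE peE eq_sym ne scaler0.
Qed.

Lemma lext_pe (V : lmodType K) (f : proj_idx p s -> V) e : lext f (pe e) = f e.
Proof.
rewrite /lext (bigD1 e) //= peE eqxx scale1r big1 ?addr0 // => e' /negPf ne.
by rewrite peE ne scale0r.
Qed.

Lemma lext_pa (V : lmodType K) (f : proj_idx p s -> V) k (hk : (k < s)%N) :
  lext f (pa K p s k) = f (inl (inl (Ordinal hk))).
Proof. exact: (lext_pe f (inl (inl (Ordinal hk)))). Qed.
Lemma lext_pb (V : lmodType K) (f : proj_idx p s -> V) k (hk : (k < s)%N) :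
  lext f (pb K p s k) = f (inl (inr (Ordinal hk))).
Proof. exact: (lext_pe f (inl (inr (Ordinal hk)))). Qed.
Lemma lext_px (V : lmodType K) (f : proj_idx p s -> V) k (hk : (k < p - s)%N) :
  lext f (px K p s k) = f (inr (inl (Ordinal hk))).
Proof. exact: (lext_pe f (inr (inl (Ordinal hk)))). Qed.
Lemma lext_py (V : lmodType K) (f : proj_idx p s -> V) k (hk : (k < p - s)%N) :
  lext f (py K p s k) = f (inr (inr (Ordinal hk))).
Proof. exact: (lext_pe f (inr (inr (Ordinal hk)))). Qed.

Lemma pa_big k : (s <= k)%N -> pa K p s k = 0.
Proof.
move=> hk; apply/ffunP => -[] [] j; rewrite !ffunE //.
by rewrite (_ : (nat_of_ord j == k) = false) //; apply/eqP; have := ltn_ord j; lia.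
Qed.

Lemma py_big k : (p - s <= k)%N -> py K p s k = 0.
Proof.
move=> hk; apply/ffunP => -[] [] j; rewrite !ffunE //.
by rewrite (_ : (nat_of_ord j == k) = false) //; apply/eqP; have := ltn_ord j; lia.
Qed.

Lemma pe_neq0 e : pe e != 0.
Proof.
apply/eqP => /ffunP/(_ e); rewrite peE eqxx ffunE; apply/eqP; exact: oner_neq0.
Qed.

End ProjBasis.

Section ProjActions.
Variables (K : fieldType) (p : nat) (q : K) (neg : bool) (s : nat).
Local Notation A := (proj_action p q neg s).
Local Notation sg := ((-1) ^+ neg : K).

Lemma lext_lin (V : lmodType K) (f : proj_idx p s -> V) c1 c2 u v :
  lext f (c1 *: u + c2 *: v) = c1 *: lext f u + c2 *: lext f v.
Proof.
rewrite /lext !scaler_sumr -big_split /=.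
by apply: eq_bigr => e _; rewrite !ffunE scalerDl -!scalerA.
Qed.

Lemma actF_lin c1 c2 u v : actF A (c1 *: u + c2 *: v) = c1 *: actF A u + c2 *: actF A v.
Proof. exact: lext_lin. Qed.
Lemma actE_lin c1 c2 u v : actE A (c1 *: u + c2 *: v) = c1 *: actE A u + c2 *: actE A v.
Proof. exact: lext_lin. Qed.

Lemma F_a k : (k < s)%N -> actF A (pa K p s k) = pa K p s k.+1.
Proof. by move=> hk; rewrite /= lext_pa. Qed.

Lemma F_b k : (k.+1 < s)%N -> actF A (pb K p s k) = pb K p s k.+1.
Proof.
move=> hk; rewrite /= lext_pb; first by lia.
by move=> hk'; rewrite /= (_ : (k < s - 1)%N) //; lia.
Qed.

Lemma F_b_last : (0 < s)%N -> actF A (pb K p s (s - 1)) = py K p s 0.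
Proof.
move=> hs; rewrite /= lext_pb; first by lia.
by move=> hk'; rewrite /= ltnn.
Qed.

Lemma F_x k : (k.+1 < p - s)%N -> actF A (px K p s k) = px K p s k.+1.
Proof.
move=> hk; rewrite /= lext_px; first by lia.
by move=> hk'; rewrite /= (_ : (k < p - s - 1)%N) //; lia.
Qed.

Lemma F_x_last : (0 < p - s)%N -> actF A (px K p s (p - s - 1)) = pa K p s 0.
Proof.
move=> hs; rewrite /= lext_px; first by lia.
by move=> hk'; rewrite /= ltnn.
Qed.

Lemma F_y k : (k < p - s)%N -> actF A (py K p s k) = py K p s k.+1.
Proof. by move=> hk; rewrite /= lext_py. Qed.

Lemma E_b0 : (0 < s)%N -> actE A (pb K p s 0) = px K p s (p - s - 1).
Proof. by move=> hs; rewrite /= lext_pb. Qed.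

Lemma E_y0 : (0 < p - s)%N -> actE A (py K p s 0) = pa K p s (s - 1).
Proof. by move=> hs; rewrite /= lext_py. Qed.

Lemma E_a k : (k < s)%N ->
  actE A (pa K p s k) = (sg * qnum q k * qnum q (s - k)) *: pa K p s k.-1.
Proof. by move=> hk; rewrite /= lext_pa. Qed.

Lemma E_x k : (k < p - s)%N ->
  actE A (px K p s k) = (- sg * qnum q k * qnum q (p - s - k)) *: px K p s k.-1.
Proof. by move=> hk; rewrite /= lext_px. Qed.

End ProjActions.

(* theta1, theta2, Gamma1 and Gamma2 are instances of these two maps. *)
Section Homs.
Variables (K : fieldType) (p : nat) (q : K) (s s' : nat).
Hypotheses (q0 : q != 0) (qp : q ^+ p = -1) (qq : q - q^-1 != 0).
Hypothesis xj : forall j, (0 < j < p)%N -> 1 - q^-1 ^+ 2 ^+ j != 0.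
Hypotheses (hs : (0 < s)%N) (hs' : (0 < s')%N) (ss : (s + s' = p)%N).
Variable neg : bool.

Definition hom1 : proj_mod K p s -> proj_mod K p s' :=
  lext (fun e : proj_idx p s => match e with
    | inl (inr m) => px K p s' m | inr (inr n) => pa K p s' n | _ => 0 end).
Definition hom2 : proj_mod K p s -> proj_mod K p s' :=
  lext (fun e : proj_idx p s => match e with
    | inl (inr m) => py K p s' m | inr (inl n) => pa K p s' n | _ => 0 end).

Let A := proj_action p q neg s.
Let B := proj_action p q (~~ neg) s'.

(** Writing the sign as [q^p] where needed, the exponent of the weight of [z] differs from [s - 1],
    modulo [2p], by some [2m] with [0 < m < p]. *)
Lemma proj_wt_neq (z : proj_idx p s') :
  (if z is inr (inl j) then j != 0 :> nat else if z is inr (inr j) then j != 0 :> nat else true) ->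
  proj_wt q (~~ neg) z != (-1) ^+ neg * q ^ (s%:Z - 1).
Proof.
have x1 m : (0 < m < p)%N -> q ^ ((2 * m)%N%:Z) != 1.
  move=> hm; apply/eqP => e; have := xj hm; rewrite -exprM exprVn.
  by rewrite -exprnP in e; rewrite e invr1 subrr eqxx.
have sg : (-1) ^+ (~~ neg) = - (-1) ^+ neg :> K by case: neg; rewrite ?opprK.
have s0 : (-1) ^+ neg != 0 :> K by rewrite signr_eq0.
have ac (k : nat) : (k < s')%N -> - (-1) ^+ neg * q ^ (s'%:Z - 1 - (2 * k)%N%:Z) !=
    (-1) ^+ neg * q ^ (s%:Z - 1).
  move=> hk; apply: contra (x1 (s + k)%N _) => [/eqP e|]; last by lia.
  have : q ^ (p%:Z) * q ^ (s'%:Z - 1 - (2 * k)%N%:Z) = q ^ (s%:Z - 1).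
    by apply: (mulfI s0); rewrite -e -exprnP qp; ring.
  rewrite -expfzDr // => e'.
  have e2 : q ^ (s%:Z - 1) = q ^ ((2 * p)%N%:Z) * q ^ (s%:Z - 1).
    by rewrite -exprnP mulnC exprM qp sqrrN expr1n mul1r.
  apply/eqP; apply: (mulfI (expfz_neq0 (p%:Z + (s'%:Z - 1 - (2 * k)%N%:Z)) q0)).
  by rewrite mulr1 -expfzDr // [RHS]e' e2 -expfzDr //; congr (q ^ _); lia.
have xc (k : nat) : (k < p - s')%N -> k != 0%N -> - - (-1) ^+ neg * q ^ ((p - s')%N%:Z - 1 - (2 * k)%N%:Z) !=
    (-1) ^+ neg * q ^ (s%:Z - 1).
  move=> hk k0; apply: contra (x1 k _) => [/eqP e|]; last by lia.
  have {}e : q ^ ((p - s')%N%:Z - 1 - (2 * k)%N%:Z) = q ^ (s%:Z - 1).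
    by apply: (mulfI s0); rewrite -e opprK.
  apply/eqP; apply: (mulfI (expfz_neq0 ((p - s')%N%:Z - 1 - (2 * k)%N%:Z) q0)).
  by rewrite mulr1 -expfzDr // [RHS]e; congr (q ^ _); lia.
case: z => -[] k; rewrite /= sg => h; try exact: ac; exact: xc.
Qed.

(** From the image of [b_0], F yields those of the [b_m] and then of the [y_n]. E yields the last
    [x_n] and, its structure constants being nonzero, the earlier ones; F then leads on to the
    [a_m], which are sent to 0. *)
Lemma hom_classify (h : {linear proj_mod K p s -> proj_mod K p s'}) :
  uq_hom A B h -> exists c1 c2, forall u, h u = c1 *: hom1 u + c2 *: hom2 u.
Proof.
case=> hE hF hK.
have hps : (p - s = s')%N by lia.
have hps' : (p - s' = s)%N by lia.
have b0E : exists c1 c2, h (pb K p s 0) = c1 *: px K p s' 0 + c2 *: py K p s' 0.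
  have hp0 : (0 < p - s')%N by lia.
  exists (h (pb K p s 0) (inr (inl (Ordinal hp0)))), (h (pb K p s 0) (inr (inr (Ordinal hp0)))).
  apply/ffunP => e; rewrite !ffunE.
  have wt0 : proj_wt q (~~ neg) e * h (pb K p s 0) e = (-1) ^+ neg * q ^ (s%:Z - 1) * h (pb K p s 0) e.
    have := hK (pb K p s 0); have -> : actK A (pb K p s 0) = ((-1) ^+ neg * q ^ (s%:Z - 1)) *: pb K p s 0.
      apply/ffunP => -[] [] k; rewrite !ffunE ?mulr0 ?scaler0 //=.
      case: eqP => [->|_]; rewrite ?mulr0 ?scaler0 //.
      by rewrite muln0 subr0.
    by rewrite linearZ /= => /ffunP/(_ e); rewrite !ffunE => <-.
  have z0 : (if e is inr (inl j) then j != 0 :> nat else if e is inr (inr j) then j != 0 :> nat else true) ->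
      h (pb K p s 0) e = 0.
    move=> /proj_wt_neq ne; apply/eqP; apply: contraTT isT => nz.
    by case/eqP: ne; apply: (mulIf nz).
  case: e z0 {wt0} => -[] k z0.
  - by rewrite z0 // !scaler0 addr0.
  - by rewrite z0 // !scaler0 addr0.
  - case: (nat_of_ord k =P 0%N) z0 => [k0 _|_ ->] //; last by rewrite !scaler0 addr0.
    by rewrite [_ *: 1%:R]mulr1 scaler0 addr0; congr (h _ (inr (inl _))); exact: val_inj.
  - case: (nat_of_ord k =P 0%N) z0 => [k0 _|_ ->] //; last by rewrite !scaler0 addr0.
    by rewrite [_ *: 1%:R]mulr1 scaler0 add0r; congr (h _ (inr (inr _))); exact: val_inj.
have [c1 [c2 hb0]] := b0E; exists c1, c2.
have hb m : (m < s)%N -> h (pb K p s m) = c1 *: px K p s' m + c2 *: py K p s' m.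
  elim: m => [//|m IHm] hm; rewrite -(F_b p q neg hm) hF (IHm (ltnW hm)) actF_lin.
  by rewrite F_x ?F_y //; lia.
have hy n : (n < p - s)%N -> h (py K p s n) = c1 *: pa K p s' n.
  elim: n => [|n IHn] hn.
    rewrite -(F_b_last p q neg hs) hF hb; last by lia.
    rewrite actF_lin (_ : s - 1 = p - s' - 1)%N; last by lia.
    rewrite F_x_last ?F_y ?(@py_big _ _ _ _.+1) ?scaler0 ?addr0 //; lia.
  rewrite -(F_y q neg (ltnW hn)) hF (IHn (ltnW hn)).
  by rewrite -[c1 *: _]addr0 -(scale0r (pa K p s' n)) actF_lin F_a ?scale0r ?addr0 //; lia.
have hx k n : (n + k).+1 = (p - s)%N -> h (px K p s n) = c2 *: pa K p s' n.
  elim: k n => [|k IHk] n hn.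
    rewrite (_ : n = p - s - 1)%N; last by lia.
    rewrite -(E_b0 p q neg hs) hE hb0 actE_lin E_x ?E_y0 ?qnum0; try lia.
    by rewrite mulr0 mul0r scale0r scaler0 add0r hps.
  have hn1 : (n.+1 < p - s)%N by lia.
  have := congr1 h (E_x q neg hn1).
  rewrite hE (IHk n.+1) ?linearZ; last by lia.
  have -> : c2 *: pa K p s' n.+1 = c2 *: pa K p s' n.+1 + 0 *: pa K p s' n.+1.
    by rewrite scale0r addr0.
  rewrite actE_lin scale0r addr0 E_a; last by lia.
  have hpn : (p - s - n.+1 = s' - n.+1)%N by lia.
  rewrite /= scalerA mulrC -scalerA hpn.
  have -> : (-1) ^+ (~~ neg) = - (-1) ^+ neg :> K by case: neg; rewrite ?opprK.
  have nz : - (-1) ^+ neg * qnum q n.+1 * qnum q (s' - n.+1) != 0.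
    by apply: mulf_neq0; [apply: mulf_neq0; first by rewrite oppr_eq0 signr_eq0|];
      apply: (qn_neq0 q0 qq xj); lia.
  by move/(scalerI nz) => <-.
have ha m : (m < s)%N -> h (pa K p s m) = 0.
  elim: m => [|m IHm] hm.
    rewrite -(F_x_last q neg (_ : (0 < p - s)%N)) ?hF ?(hx 0%N); try lia.
    rewrite -[c2 *: _]addr0 -(scale0r (pa K p s' 0)) actF_lin F_a ?scale0r ?addr0; last by lia.
    by rewrite pa_big ?scaler0 //; lia.
  rewrite -(F_a p q neg (ltnW hm)) hF (IHm (ltnW hm)).
  have -> : (0 : proj_mod K p s') = 0 *: 0 + 0 *: 0 by rewrite !scale0r addr0.
  by rewrite actF_lin !scale0r addr0.
move=> u; rewrite [in LHS](pe_sum u) [in RHS](pe_sum u) linear_sum.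
rewrite /hom1 /hom2 /lext !scaler_sumr -big_split /=; apply: eq_bigr => e _.
rewrite linearZ /= -!pe_sum !scalerA [c1 * _]mulrC [c2 * _]mulrC -!scalerA -scalerDr; congr (_ *: _).
case: e => -[] k /=; have hk := ltn_ord k; rewrite ?scaler0 ?addr0 ?add0r.
- exact: ha.
- exact: hb.
- by apply: (hx (p - s - k.+1)%N); lia.
- exact: hy.
Qed.

End Homs.

(** * Decomposition of the operators *)

Section Weights.
Variables (K : fieldType) (z : nat).
Implicit Types v : tpow K z.

Definition off k v := forall w : z.-tuple bool, count id w = k -> v w = 0.

Lemma off_weight m k v : in_weight m v -> m != k -> off k v.
Proof.
move=> hv ne w hw; apply/eqP; apply: contraNT ne => /hv <-.
by rewrite hw.
Qed.

Lemma off_add k u v : off k u -> off k v -> off k (u + v).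
Proof. by move=> hu hv w hw; rewrite ffunE hu ?hv ?addr0. Qed.

Lemma off_scale k c v : off k v -> off k (c *: v).
Proof. by move=> hv w hw; rewrite ffunE hv ?scaler0. Qed.

Lemma in_weight_add k u v : in_weight k u -> in_weight k v -> in_weight k (u + v).
Proof.
move=> hu hv w; rewrite ffunE; have [e|nz] := eqVneq (u w) 0; last by move=> _; exact: hu.
by rewrite e add0r; exact: hv.
Qed.

Lemma in_weight_scale k c v : in_weight k v -> in_weight k (c *: v).
Proof. by move=> hv w; rewrite ffunE => nz; apply: hv; apply: contraNneq nz => ->; rewrite scaler0. Qed.

Lemma weight_part k u v : in_weight k u -> off k v -> off k (u + v) -> u = 0.
Proof.
move=> hu hv huv; apply/ffunP => w; rewrite ffunE.
have [//|nz] := eqVneq (u w) 0; have := huv w (hu w nz).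
by rewrite ffunE (hv w (hu w nz)) addr0.
Qed.

End Weights.

Lemma off_mat (K : fieldType) z z' (f : tpow K z -> tpow K z') A k k' v :
  hasmat f A -> in_weight k v ->
  (forall W w, size W = z' -> size w = z -> count id W = k' -> count id w = k -> A W w = 0) ->
  off k' (f v).
Proof.
move=> hf hv h W hW; rewrite hf big1 // => w _.
have [->|nz] := eqVneq (v w) 0; first by rewrite mul0r.
by rewrite h ?size_tuple ?mulr0 //; exact: hv.
Qed.

(** * The common properties of the four operators *)

Section Final.
Variables (K : fieldType) (q : K) (p i : nat).
Hypotheses (p2 : (2 <= p)%N) (q0 : q != 0) (qp : q ^+ p = -1) (qq : q - q^-1 != 0).
Hypothesis char0 : forall m, (0 < m)%N -> m%:R != 0 :> K.
Hypothesis xj : forall j, (0 < j < p)%N -> 1 - q^-1 ^+ 2 ^+ j != 0.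
Hypothesis hi : (0 < i < p)%N.
Local Notation M := (2 * p - 1)%N.
Local Notation N := (2 * p + i - 1)%N.
Local Notation n := (2 * p - i - 1)%N.

Let hN : N = (M + i)%N. Proof. by lia. Qed.
Let hM : M = (n + i)%N. Proof. by lia. Qed.

(** [good_FT] concerns the transpose and gives commutation with E. All clauses are stable under
    scalars, so normalizing constants can be put in afterwards. *)
Record good (tau : nat -> nat -> K) : Prop := Good {
  good_F : Fcomm q M M (tm q tau);
  good_FT : Fcomm q M M (tm q (fun m k => tau k m));
  good_supp : forall m k, (m <= M)%N -> (k <= M)%N -> tau m k != 0 ->
    [\/ m = k, m = (k + p)%N | k = (m + p)%N];
  good_gap : forall m k, (m < M)%N -> (k < M)%N -> gap q p tau m k != 0 ->
    m = p.-1 /\ k = p.-1 }.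

Lemma good_scale c tau : good tau -> good (fun m k => c * tau m k).
Proof.
have e (tau' : nat -> nat -> K) a b : c * tm q tau' a b = tm q (fun m k => c * tau' m k) a b.
  by rewrite /tm mulrA.
case=> h1 h2 h3 h4; split.
- by apply: Fcomm_eq (Fcomm_scale c h1) => a b _ _; exact: e.
- by apply: Fcomm_eq (Fcomm_scale c h2) => a b _ _; exact: e.
- by move=> m k hm hk; rewrite mulf_eq0 negb_or => /andP[_]; exact: h3.
- move=> m k hm hk; have -> : gap q p (fun m k => c * tau m k) m k = c * gap q p tau m k.
    by rewrite /gap; ring.
  by rewrite mulf_eq0 negb_or => /andP[_]; exact: h4.
Qed.

Lemma ta_supp m k : ta q p m k != 0 -> (k < p)%N /\ m = (k + p)%N.
Proof. by rewrite /ta; case: ifP => [/andP[? /eqP ?]|]; rewrite ?eqxx. Qed.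
Lemma tb_supp m k : tb q p m k != 0 -> (m < p)%N /\ k = (m + p)%N.
Proof. exact: ta_supp. Qed.
Lemma tba_supp m k : tba q p m k != 0 -> (k < p)%N /\ m = k.
Proof. by rewrite /tba; case: ifP => [/andP[? /eqP ?]|]; rewrite ?eqxx. Qed.
Lemma tab_supp m k : tab q p m k != 0 -> (p <= k)%N /\ m = k.
Proof. by rewrite /tab; case: ifP => [/andP[? /eqP ?]|]; rewrite ?eqxx. Qed.

Lemma good_ta : good (ta q p).
Proof.
split; [exact: Fcomm_ta | exact: Fcomm_tb | |].
  by move=> m k _ _ /ta_supp[_ ->]; constructor 2.
by move=> m k hm hk; rewrite gap_ta // eqxx.
Qed.

Lemma good_tb : good (tb q p).
Proof.
split; [exact: Fcomm_tb | exact: Fcomm_ta | |].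
  by move=> m k _ _ /tb_supp[_ ->]; constructor 3.
by move=> m k hm hk; rewrite gap_tb // eqxx.
Qed.

Lemma good_tba : good (tba q p).
Proof.
split; [exact: Fcomm_tba | | |].
- apply: (Fcomm_eq (A := tm q (tba q p))); last exact: Fcomm_tba.
  by move=> a b _ _; rewrite /tm /tba eq_sym; case: eqP => [->|]; rewrite ?andbF.
- by move=> m k _ _ /tba_supp[_ ->]; constructor 1.
- by move=> m k hm hk; apply: gap_tba.
Qed.

Lemma good_tab : good (tab q p).
Proof.
split; [exact: Fcomm_tab | | |].
- apply: (Fcomm_eq (A := tm q (tab q p))); last exact: Fcomm_tab.
  by move=> a b _ _; rewrite /tm /tab eq_sym; case: eqP => [->|]; rewrite ?andbF.
- by move=> m k _ _ /tab_supp[_ ->]; constructor 1.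
- by move=> m k hm hk; apply: gap_tab.
Qed.

Section Operator.
Variables (tau : nat -> nat -> K) (T0 : tpow K M -> tpow K M).
Hypotheses (hg : good tau) (hT0 : hasmat T0 (tm q tau)).

Let kc : kcomp q M M (tm q tau).
Proof. by apply: kcomp_tm => //; exact: good_supp. Qed.
Let kcT : kcomp q M M (tm q (fun m k => tau k m)).
Proof.
apply: kcomp_tm => // m k hm hk /(good_supp hg hk hm).
by case=> ->; [constructor 1 | constructor 3 | constructor 2].
Qed.

Lemma capm_supp W w : size W = N -> size w = n -> capm q n i (tm q tau) W w != 0 ->
  exists m k l, [/\ tau m k != 0, (l <= i)%N, count id W = (m + l)%N &
    k = (count id w + (i - l))%N].
Proof.
move=> hW hw; have [a [y [-> ha hy]]] := cut_word (etrans hW hN).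
rewrite capm_cat -?hM // /tm !mulf_eq0 !negb_or => /and3P[_ h _].
exists (count id a), (count id (w ++ bar y)), (count id y); split=> //.
- by have := count_le y; rewrite hy.
- exact: count_cat.
- by rewrite count_cat count_bar count_negb hy.
Qed.

Lemma cupm_supp W w : size W = N -> size w = n -> cupm q n i (tm q tau) w W != 0 ->
  exists m k l, [/\ tau m k != 0, (l <= i)%N, count id W = (k + l)%N &
    m = (count id w + (i - l))%N].
Proof.
move=> hW hw; have [a [y [-> ha hy]]] := cut_word (etrans hW hN).
rewrite cupm_cat -?hM // /tm !mulf_eq0 !negb_or => /and3P[_ h _].
exists (count id (w ++ bar y)), (count id a), (count id y); split=> //.
- by have := count_le y; rewrite hy.
- exact: count_cat.
- by rewrite count_cat count_bar count_negb hy.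
Qed.

Lemma capm_comm :
  [/\ Fcomm q N n (capm q n i (tm q tau)), Fcomm q n N (mtr (capm q n i (tm q tau)))
    & kcomp q N n (capm q n i (tm q tau))].
Proof.
have [h1 h2 _ _] := hg.
have e1 := @Fcomm_capm _ q n i q0 (tm q tau); rewrite -hM -hN in e1.
have e2 := @Fcomm_cupm _ q n i q0 qq (tm q (fun m k => tau k m)); rewrite -hM -hN in e2.
have e3 := @kcomp_capm _ q n i q0 (tm q tau); rewrite -hM -hN in e3.
split; [exact: e1 | | exact: e3].
apply: Fcomm_eq (Fcomm_scale (q^-1 ^+ i) (e2 h2 kcT)) => w W hw hW.
rewrite cupm_capm // -?hM -?hN // mulrA -exprMn mulVf // expr1n mul1r.
by rewrite /capm /mtr /tm; ring.
Qed.

Lemma cupm_comm :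
  [/\ Fcomm q n N (cupm q n i (tm q tau)), Fcomm q N n (mtr (cupm q n i (tm q tau)))
    & kcomp q n N (cupm q n i (tm q tau))].
Proof.
have [h1 h2 _ _] := hg.
have e1 := @Fcomm_cupm _ q n i q0 qq (tm q tau); rewrite -hM -hN in e1.
have e2 := @Fcomm_capm _ q n i q0 (tm q (fun m k => tau k m)); rewrite -hM -hN in e2.
have e3 := @kcomp_cupm _ q n i q0 (tm q tau); rewrite -hM -hN in e3.
split; [exact: e1 | | exact: e3].
apply: Fcomm_eq (Fcomm_scale (q ^+ i) (e2 h2 kcT)) => W w hW hw.
rewrite /mtr cupm_capm // -?hM -?hN //.
by rewrite /capm /mtr /tm; ring.
Qed.

Let T := cap_then q i T0.
Let S := then_cup q i T0.

Lemma T_mat : hasmat T (capm q n i (tm q tau)). Proof. exact: cap_then_mat. Qed.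
Lemma S_mat : hasmat S (cupm q n i (tm q tau)). Proof. exact: then_cup_mat. Qed.

Lemma T_minus v : @idem_minus K p q i (T v) = T v.
Proof.
apply: (hasmat_eq (hasmat_ext _ (hasmat_comp T_mat (hasmat_tl_act _ _))) T_mat) => W w hW hw.
apply: (minus_capm p2 q0 qp char0 xj hi) => // m k hm hk nz.
by case: (good_gap hg hm hk nz).
Qed.

Lemma T_plus v : T (@idem_plus K p q i v) = T v.
Proof.
apply: (hasmat_eq (hasmat_ext _ (hasmat_comp (hasmat_tl_act _ _) T_mat)) T_mat) => W w hW hw.
exact: plus_capm.
Qed.

Lemma S_minus v : S (@idem_minus K p q i v) = S v.
Proof.
apply: (hasmat_eq (hasmat_ext _ (hasmat_comp (hasmat_tl_act _ _) S_mat)) S_mat) => W w hW hw.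
apply: (minus_cupm p2 q0 qp char0 xj hi) => // m k hm hk nz.
by case: (good_gap hg hm hk nz).
Qed.

Lemma S_plus v : @idem_plus K p q i (S v) = S v.
Proof.
apply: (hasmat_eq (hasmat_ext _ (hasmat_comp S_mat (hasmat_tl_act _ _))) S_mat) => W w hW hw.
exact: plus_cupm.
Qed.

End Operator.
End Final.

(** * Reading off the four coefficients *)

Section Decomposition.
Variables (K : fieldType) (q : K) (p i : nat).
Hypotheses (p2 : (2 <= p)%N) (q0 : q != 0) (qp : q ^+ p = -1) (qq : q - q^-1 != 0).
Hypothesis char0 : forall m, (0 < m)%N -> m%:R != 0 :> K.
Hypothesis xj : forall j, (0 < j < p)%N -> 1 - q^-1 ^+ 2 ^+ j != 0.
Hypothesis hi : (0 < i < p)%N.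
Local Notation M := (2 * p - 1)%N.
Local Notation N := (2 * p + i - 1)%N.
Local Notation n := (2 * p - i - 1)%N.
Variables (inc : {linear proj_mod K p i -> tpow K n}) (prj : {linear tpow K n -> proj_mod K p i}).
Hypothesis hplus : plus_summand q inc prj.
Variables (incl incu : {linear proj_mod K p (p - i) -> tpow K N})
  (prjl prju : {linear tpow K N -> proj_mod K p (p - i)}).
Hypothesis hminus : minus_summands q incl incu prjl prju.
Variables (tau : nat -> nat -> K) (T0 : tpow K M -> tpow K M).
Hypotheses (hg : good q p tau) (hT0 : hasmat T0 (tm q tau)).
Local Notation T := (cap_then q i T0).
Local Notation S := (then_cup q i T0).
Local Notation th1 := (@hom1 K p i (p - i)).
Local Notation th2 := (@hom2 K p i (p - i)).
Local Notation Th1 := (@hom1 K p (p - i) i).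
Local Notation Th2 := (@hom2 K p (p - i) i).

Let Tm : hasmat T (capm q n i (tm q tau)). Proof. exact: T_mat. Qed.
Let Sm : hasmat S (cupm q n i (tm q tau)). Proof. exact: S_mat. Qed.

Let TL : {linear tpow K n -> tpow K N} :=
  HB.pack T (GRing.isLinear.Build _ _ _ _ T (hasmat_linear Tm)).
Let SL : {linear tpow K N -> tpow K n} :=
  HB.pack S (GRing.isLinear.Build _ _ _ _ S (hasmat_linear Sm)).

Let T_hom (prj' : {linear tpow K N -> proj_mod K p (p - i)}) :
  uq_hom (tpow_action q N) (proj_action p q true (p - i)) prj' ->
  exists c1 c2, forall u, prj' (T (inc u)) = c1 *: th1 u + c2 *: th2 u.
Proof.
case=> pE pF pK; have [[iE iF iK] _ _ _ _ _ _ _] := hplus.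
have [h1 h2 h3] := capm_comm p2 q0 qp qq hi hg.
have [tE tF tK] := hasmat_comm q0 Tm h1 h2 h3.
have := @hom_classify K p q i (p - i) q0 qp qq xj _ _ _ false (prj' \o TL \o inc).
case; try lia.
  by split=> v /=; rewrite ?iE ?iF ?iK -?/T ?tE ?tF ?tK ?pE ?pF ?pK.
by move=> c1 [c2 h]; exists c1, c2 => u; exact: h.
Qed.

Let S_hom (inc' : {linear proj_mod K p (p - i) -> tpow K N}) :
  uq_hom (proj_action p q true (p - i)) (tpow_action q N) inc' ->
  exists c1 c2, forall u, prj (S (inc' u)) = c1 *: Th1 u + c2 *: Th2 u.
Proof.
case=> iE iF iK; have [_ [pE pF pK] _ _ _ _ _ _] := hplus.
have [h1 h2 h3] := cupm_comm p2 q0 qp qq hi hg.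
have [tE tF tK] := hasmat_comm q0 Sm h1 h2 h3.
have := @hom_classify K p q (p - i) i q0 qp qq xj _ _ _ true (prj \o SL \o inc').
case; try lia.
  by split=> v /=; rewrite ?iE ?iF ?iK -?/S ?tE ?tF ?tK ?pE ?pF ?pK.
by move=> c1 [c2 h]; exists c1, c2 => u; exact: h.
Qed.

(** The vectors [x_0], [y_0] have weights 0 and [p] in the lower copy, [p] and [2p] in the upper
    one. Weight [p] occurs twice, so [T b_0] cannot separate [c2] from [c3]; the last two clauses
    do, since [x_0] is moved by theta2 only and [y_0] by theta1 only. *)
Lemma T_decomp : exists c1 c2 c3 c4,
  (forall v, T v = incl (c1 *: th1 (prj v) + c2 *: th2 (prj v)) +
                   incu (c3 *: th1 (prj v) + c4 *: th2 (prj v))) /\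
  [/\ off 0 (T (inc (pb K p i 0))) -> c1 = 0,
      off p (T (inc (pb K p i 0))) -> c2 = 0 /\ c3 = 0,
      off (2 * p) (T (inc (pb K p i 0))) -> c4 = 0,
      (forall k, off k (T (inc (px K p i 0)))) -> c2 = 0 /\ c4 = 0 &
      (forall k, off k (T (inc (py K p i 0)))) -> c1 = 0 /\ c3 = 0].
Proof.
have [hl hu plu pul spl] := hminus.
have [lhi lhp lpi lx la lb ly] := hl; have [uhi uhp upi ux ua ub uy] := hu.
have [_ _ ppi pip _ _ _ _] := hplus.
have [c1 [c2 h12]] := T_hom lhp; have [c3 [c4 h34]] := T_hom uhp.
have dec u : T (inc u) = incl (c1 *: th1 u + c2 *: th2 u) + incu (c3 *: th1 u + c4 *: th2 u).
  by rewrite -h12 -h34 spl (T_minus p2 q0 qp qq char0 xj hi hg hT0).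
have allE u v : incl u + incu v = 0 -> u = 0 /\ v = 0.
  move=> e; split; first by have := congr1 prjl e; rewrite linearD lpi plu addr0 linear0.
  by have := congr1 prju e; rewrite linearD upi pul add0r linear0.
have i0 : (0 < i)%N by lia.
have pi0 : (0 < p - i)%N by lia.
have x0 : px K p (p - i) 0 != 0.
  have h : (0 < p - (p - i))%N by lia.
  exact: (pe_neq0 _ (inr (inl (Ordinal h)) : proj_idx p (p - i))).
have y0 : py K p (p - i) 0 != 0.
  have h : (0 < p - (p - i))%N by lia.
  exact: (pe_neq0 _ (inr (inr (Ordinal h)) : proj_idx p (p - i))).
have a0 : pa K p (p - i) 0 != 0.
  exact: (pe_neq0 _ (inl (inl (Ordinal pi0)) : proj_idx p (p - i))).
have scz (V : lmodType K) (c : K) (v : V) : v != 0 -> c *: v = 0 -> c = 0.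
  by move=> nz /eqP; rewrite scaler_eq0 (negPf nz) orbF => /eqP.
have all0 (v : tpow K N) : (forall k, off k v) -> v = 0.
  by move=> h; apply/ffunP => w; rewrite ffunE; exact: (h (count id w)).
have e1b : th1 (pb K p i 0) = px K p (p - i) 0 by rewrite /hom1 lext_pb.
have e2b : th2 (pb K p i 0) = py K p (p - i) 0 by rewrite /hom2 lext_pb.
have e1x : th1 (px K p i 0) = 0 by rewrite /hom1 lext_px.
have e2x : th2 (px K p i 0) = pa K p (p - i) 0 by rewrite /hom2 lext_px.
have e1y : th1 (py K p i 0) = pa K p (p - i) 0 by rewrite /hom1 lext_py.
have e2y : th2 (py K p i 0) = 0 by rewrite /hom2 lext_py.
have wlx : in_weight 0 (incl (px K p (p - i) 0)) by have := lx _ i0.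
have wly : in_weight p (incl (py K p (p - i) 0)) by have := ly _ i0; rewrite add0n addn0.
have wux : in_weight p (incu (px K p (p - i) 0)) by have := ux _ i0; rewrite addn0.
have wuy : in_weight (2 * p) (incu (py K p (p - i) 0)).
  by have := uy _ i0; rewrite (_ : p + p + 0 = 2 * p)%N //; lia.
have yE : T (inc (pb K p i 0)) = c1 *: incl (px K p (p - i) 0) + c2 *: incl (py K p (p - i) 0) +
    (c3 *: incu (px K p (p - i) 0) + c4 *: incu (py K p (p - i) 0)).
  by rewrite dec e1b e2b !linearD !linearZ.
have yE' := yE; rewrite -addrA in yE'.
exists c1, c2, c3, c4; split.
  by move=> v; rewrite -dec pip (T_plus p2 q0 qq hi hT0).
split.
- move=> h; apply: (scz _ _ _ x0); apply: (proj1 (allE _ 0 _)); rewrite linear0 addr0 linearZ /=.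
  apply: (weight_part (in_weight_scale wlx) (v := c2 *: incl (py K p (p - i) 0) +
    (c3 *: incu (px K p (p - i) 0) + c4 *: incu (py K p (p - i) 0)))).
    by do !apply: off_add; apply: off_scale; apply: off_weight; [exact: wly| |exact: wux| |exact: wuy|]; lia.
  by rewrite -yE'.
- move=> h; suff [e2 e3] : c2 *: py K p (p - i) 0 = 0 /\ c3 *: px K p (p - i) 0 = 0.
    by split; [apply: (scz _ _ _ y0) | apply: (scz _ _ _ x0)].
  apply: allE; rewrite !linearZ /=.
  apply: (weight_part (in_weight_add (in_weight_scale wly) (in_weight_scale wux))
    (v := c1 *: incl (px K p (p - i) 0) + c4 *: incu (py K p (p - i) 0))).
    by apply: off_add; apply: off_scale; apply: off_weight; [exact: wlx| |exact: wuy|]; lia.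
  by move: h; rewrite yE; congr (off _ _); rewrite [X in X + _ = _]addrC addrACA.
- move=> h; apply: (scz _ _ _ y0); apply: (proj2 (allE 0 _ _)); rewrite linear0 add0r linearZ /=.
  apply: (weight_part (in_weight_scale wuy) (v := c1 *: incl (px K p (p - i) 0) +
    (c2 *: incl (py K p (p - i) 0) + c3 *: incu (px K p (p - i) 0)))).
    by do !apply: off_add; apply: off_scale; apply: off_weight; [exact: wlx| |exact: wly| |exact: wux|]; lia.
  by move: h; rewrite yE; congr (off _ _); rewrite [RHS]addrC -!addrA.
- move=> /all0; rewrite dec e1x e2x !scaler0 !add0r => /allE[/(scz _ _ _ a0) -> /(scz _ _ _ a0) ->].
  by [].
- move=> /all0; rewrite dec e1y e2y !scaler0 !addr0 => /allE[/(scz _ _ _ a0) -> /(scz _ _ _ a0) ->].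
  by [].
Qed.

(** Each copy is tested separately through its own [b_0], and [x_0], [y_0] of the target have
    different weights, so no ambiguity arises here. *)
Lemma S_decomp : exists c1 c2 c3 c4,
  (forall v, S v = inc (c1 *: Th1 (prjl v) + c2 *: Th2 (prjl v)) +
                   inc (c3 *: Th1 (prju v) + c4 *: Th2 (prju v))) /\
  [/\ off 0 (S (incl (pb K p (p - i) 0))) -> c1 = 0,
      off p (S (incl (pb K p (p - i) 0))) -> c2 = 0,
      off 0 (S (incu (pb K p (p - i) 0))) -> c3 = 0 &
      off p (S (incu (pb K p (p - i) 0))) -> c4 = 0].
Proof.
have [hl hu plu pul spl] := hminus.
have [lhi lhp lpi lx la lb ly] := hl; have [uhi uhp upi ux ua ub uy] := hu.
have [_ _ ppi pip wx wa wb wy] := hplus.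
have [c1 [c2 h12]] := S_hom lhi; have [c3 [c4 h34]] := S_hom uhi.
have decl u : S (incl u) = inc (c1 *: Th1 u + c2 *: Th2 u).
  by rewrite -h12 pip (S_plus p2 q0 qq hi hT0).
have decu u : S (incu u) = inc (c3 *: Th1 u + c4 *: Th2 u).
  by rewrite -h34 pip (S_plus p2 q0 qq hi hT0).
have i0 : (0 < i)%N by lia.
have pi0 : (0 < p - i)%N by lia.
have x0 : px K p i 0 != 0 by exact: (pe_neq0 _ (inr (inl (Ordinal pi0)) : proj_idx p i)).
have y0 : py K p i 0 != 0 by exact: (pe_neq0 _ (inr (inr (Ordinal pi0)) : proj_idx p i)).
have scz (V : lmodType K) (c : K) (v : V) : v != 0 -> c *: v = 0 -> c = 0.
  by move=> nz /eqP; rewrite scaler_eq0 (negPf nz) orbF => /eqP.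
have inc0 u : inc u = 0 -> u = 0 by move=> /(congr1 prj); rewrite ppi linear0.
have e1b : Th1 (pb K p (p - i) 0) = px K p i 0 by rewrite /hom1 lext_pb.
have e2b : Th2 (pb K p (p - i) 0) = py K p i 0 by rewrite /hom2 lext_pb.
have wx0 : in_weight 0 (inc (px K p i 0)) by exact: wx.
have wy0 : in_weight p (inc (py K p i 0)) by have := wy _ pi0; rewrite addn0.
have kill c d : (off 0 (inc (c *: px K p i 0 + d *: py K p i 0)) -> c = 0) /\
    (off p (inc (c *: px K p i 0 + d *: py K p i 0)) -> d = 0).
  rewrite linearD; split=> h.
    apply: (scz _ _ _ x0); apply: inc0; move: h; rewrite !linearZ /= => h.
    apply: (weight_part (in_weight_scale wx0) (v := d *: inc (py K p i 0))) => //.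
    by apply: off_scale; apply: (off_weight wy0); lia.
  apply: (scz _ _ _ y0); apply: inc0; move: h; rewrite addrC !linearZ /= => h.
  apply: (weight_part (in_weight_scale wy0) (v := c *: inc (px K p i 0))) => //.
  by apply: off_scale; apply: (off_weight wx0); lia.
exists c1, c2, c3, c4; split.
  move=> v; rewrite -decl -decu -(S_minus p2 q0 qp qq char0 xj hi hg hT0) -spl.
  exact: (linearD SL).
by rewrite decl decu e1b e2b; split; [case: (kill c1 c2)|case: (kill c1 c2)|case: (kill c3 c4)|case: (kill c3 c4)].
Qed.

(** A nonzero value of [tau] gives a nonzero entry after capping or cupping; this is what makes the
    one surviving constant nonzero. *)
Lemma op_neq0 m k : (m <= M)%N -> (k <= M)%N -> tau m k != 0 ->
  ~ (forall v, T v = 0) /\ ~ (forall v, S v = 0).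
Proof.
have hN : N = (M + i)%N by lia.
have hM : M = (n + i)%N by lia.
move=> hm hk nz; have wd l : (l <= M)%N -> exists2 a, size a = M & count id a = l.
  move=> hl; exists (nseq l true ++ nseq (M - l) false).
    by rewrite size_cat !size_nseq subnKC.
  by rewrite count_cat !count_nseq /= mul0n mul1n addn0.
have capn0 (u : seq bool) : capc q u != 0.
  by rewrite capcE mulf_neq0 ?signr_eq0 // expf_neq0 ?invr_neq0.
have cupn0 (u : seq bool) : cupc q u != 0 by rewrite cupcE // mulf_neq0 ?expf_neq0.
have [a ha ca] := wd m hm; have [b hb cb] := wd k hk.
split.
  have [w [y [eb hw hy]]] := cut_word (etrans hb hM).
  have hW : size (a ++ bar y) = N by rewrite size_cat ha size_bar hy -hN.
  move=> h; have := coord_mat Tm hW hw; rewrite h /Defs.coord big1 => [|u _]; last by rewrite ffunE.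
  rewrite capm_cat -?hM // barK -eb /tm ca cb => /esym/eqP; apply/negP.
  by rewrite !mulf_neq0 ?sy_neq0.
have [w [y [ea hw hy]]] := cut_word (etrans ha hM).
have hW : size (b ++ bar y) = N by rewrite size_cat hb size_bar hy -hN.
move=> h; have := coord_mat Sm hw hW; rewrite h /Defs.coord big1 => [|u _]; last by rewrite ffunE.
rewrite cupm_cat -?hM // barK -ea /tm ca cb => /esym/eqP; apply/negP.
by rewrite !mulf_neq0 ?sy_neq0.
Qed.

End Decomposition.

(** * The root of unity *)

Section RootOfUnity.
Variables (R : realType) (p : nat).
Hypothesis p2 : (2 <= p)%N.

Let p0 : (p%:R : R) != 0. Proof. by rewrite pnatr_eq0; lia. Qed.

Lemma exp_ipiX k : exp_ipi R p ^+ k =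
  Complex (cos (k%:R * (pi / p%:R))) (sin (k%:R * (pi / p%:R))).
Proof.
elim: k => [|k IHk]; first by rewrite expr0 mul0r cos0 sin0.
have -> : k.+1%:R * (pi / p%:R) = k%:R * (pi / p%:R) + pi / p%:R :> R by rewrite -natr1 mulrDl mul1r.
rewrite exprS IHk cosD sinD /exp_ipi.
by apply/eqP; rewrite eq_complex /=; apply/andP; split; apply/eqP; ring.
Qed.

Lemma exp_ipi_p : exp_ipi R p ^+ p = -1.
Proof.
rewrite exp_ipiX mulrCA divff // mulr1 cospi sinpi.
by apply/eqP; rewrite eq_complex /= oppr0 !eqxx.
Qed.

(** Otherwise the [j]-th power would be 1 or -1, but its imaginary part is positive. *)
Lemma exp_ipi_2j j : (0 < j < p)%N -> exp_ipi R p ^+ (2 * j) != 1.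
Proof.
move=> hj; rewrite mulnC exprM sqrf_eq1 negb_or.
have s0 : 0 < sin (j%:R * (pi / p%:R)) :> R.
  apply: sin_gt0_pi.
  have p0' : 0 < (p%:R : R) by rewrite ltr0n; lia.
  apply/andP; split; first by rewrite mulr_gt0 ?divr_gt0 ?pi_gt0 ?ltr0n //; lia.
  rewrite mulrCA gtr_pMr ?pi_gt0 // ltr_pdivrMr // mul1r ltr_nat; lia.
by rewrite exp_ipiX !eq_complex /= oppr0 (gt_eqF s0) !andbF.
Qed.

Variables (K : fieldType) (iota : {rmorphism K -> complex R}) (q : K).
Hypothesis hq : iota q = exp_ipi R p.

Let inj x : (iota x == 0) = (x == 0). Proof. exact: fmorph_eq0. Qed.

Lemma root_neq0 : q != 0.
Proof.
apply/eqP => e; have := exp_ipi_p; rewrite -hq e rmorph0 expr0n.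
rewrite (_ : (p == 0)%N = false); last by lia.
by move/eqP; rewrite eq_sym oppr_eq0 oner_eq0.
Qed.

Lemma root_p : q ^+ p = -1.
Proof. by apply: (fmorph_inj iota); rewrite rmorphXn rmorphN1 /= hq exp_ipi_p. Qed.

Lemma root_x j : (0 < j < p)%N -> 1 - q^-1 ^+ 2 ^+ j != 0.
Proof.
move=> hj; rewrite subr_eq0 eq_sym; apply: contra (exp_ipi_2j hj) => /eqP e.
rewrite -hq -rmorphXn /= -(rmorph1 iota) (inj_eq (fmorph_inj iota)).
by move: e; rewrite -exprM exprVn => /(congr1 (@GRing.inv K)); rewrite invrK invr1 => ->.
Qed.

Lemma root_qq : q - q^-1 != 0.
Proof.
have := @root_x 1; rewrite expr1 => /(_ ltac:(lia)) h.
have -> : q - q^-1 = q * (1 - q^-1 ^+ 2).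
  by rewrite mulrBr mulr1 expr2 mulrA divff ?root_neq0 // mul1r.
by rewrite mulf_neq0 ?root_neq0.
Qed.

Lemma root_char m : (0 < m)%N -> m%:R != 0 :> K.
Proof. by move=> hm; rewrite -inj rmorph_nat pnatr_eq0 -lt0n. Qed.

End RootOfUnity.

(** * Alpha, beta and their composites *)

Section Conclusion.
Variables (K : fieldType) (q : K) (p i : nat).
Hypotheses (p2 : (2 <= p)%N) (q0 : q != 0) (qp : q ^+ p = -1) (qq : q - q^-1 != 0).
Hypothesis xj : forall j, (0 < j < p)%N -> 1 - q^-1 ^+ 2 ^+ j != 0.
Local Notation M := (2 * p - 1)%N.
Local Notation N := (2 * p + i - 1)%N.
Local Notation n := (2 * p - i - 1)%N.
Hypothesis hi : (0 < i < p)%N.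

Definition ca : K := qfact q (p - 1).
Definition cb : K := (-1) ^+ p.+1 * qfact q (p - 1).

Lemma alpha_tm : hasmat (alpha p q) (tm q (fun m k => ca * ta q p m k)).
Proof.
by apply: hasmat_ext (alpha_mat p2 q0 qp qq) => a b _ _; rewrite /tm mulrA.
Qed.

Lemma beta_tm : hasmat (beta p q) (tm q (fun m k => cb * tb q p m k)).
Proof.
by apply: hasmat_ext (beta_mat p2 q0 qp qq) => a b _ _; rewrite /tm /cb; ring.
Qed.

Lemma beta_alpha_tm : hasmat (beta p q \o alpha p q) (tm q (fun m k => cb * ca * tba q p m k)).
Proof.
apply: hasmat_ext (hasmat_comp alpha_tm beta_tm) => a b ha hb.
transitivity (cb * ca * tm q (tba q p) a b); last by rewrite /tm mulrA.
rewrite -mmul_tba // mulr_sumr; apply: eq_bigr => c _; rewrite /tm; ring.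
Qed.

Lemma alpha_beta_tm : hasmat (alpha p q \o beta p q) (tm q (fun m k => ca * cb * tab q p m k)).
Proof.
apply: hasmat_ext (hasmat_comp beta_tm alpha_tm) => a b ha hb.
transitivity (ca * cb * tm q (tab q p) a b); last by rewrite /tm mulrA.
rewrite -mmul_tab // mulr_sumr; apply: eq_bigr => c _; rewrite /tm; ring.
Qed.

Lemma ca_neq0 : ca != 0.
Proof. by apply: (qfact_neq0 q0 qq xj); move: p2; clear; lia. Qed.
Lemma cb_neq0 : cb != 0.
Proof. by rewrite mulf_neq0 ?signr_eq0 // ca_neq0. Qed.

Lemma off_cap (T0 : tpow K M -> tpow K M) tau k k' (v : tpow K n) :
  hasmat T0 (tm q tau) -> in_weight k v ->
  (forall m l, (l <= i)%N -> k' = (m + l)%N -> tau m (k + (i - l))%N = 0) ->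
  off k' (cap_then q i T0 v).
Proof.
move=> h hv ht; apply: (off_mat (T_mat p2 q0 qq hi h) hv) => W w hW hw cW cw.
apply/eqP; apply: contraT => /(capm_supp p2 q0 qq hi hW hw)[m [k1 [l [nz hl e1 e2]]]].
by rewrite e2 cw ht ?eqxx // -cW in nz.
Qed.

Lemma off_cup (T0 : tpow K M -> tpow K M) tau k k' (v : tpow K N) :
  hasmat T0 (tm q tau) -> in_weight k v ->
  (forall m l, (l <= i)%N -> k = (m + l)%N -> tau (k' + (i - l))%N m = 0) ->
  off k' (then_cup q i T0 v).
Proof.
move=> h hv ht; apply: (off_mat (S_mat p2 q0 qq hi h) hv) => w W hw hW cw cW.
apply/eqP; apply: contraT => /(cupm_supp p2 q0 qq hi hW hw)[m [k1 [l [nz hl e1 e2]]]].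
by rewrite e2 cw ht ?eqxx // -cW in nz.
Qed.

Lemma scaled_supp c (tau : nat -> nat -> K) m k (P : Prop) :
  (tau m k != 0 -> P) -> ~ P -> c * tau m k = 0.
Proof.
move=> h nP; have [->|/h//] := eqVneq (tau m k) 0; exact: mulr0.
Qed.

End Conclusion.

Lemma eq_up_to_const_inv (K : fieldType) (U : Type) (V : lmodType K) (f g : U -> V) c :
  (forall v, g v = c *: f v) -> ~ (forall v, g v = 0) -> eq_up_to_const f g.
Proof.
move=> h nz; have [c0|c0] := eqVneq c 0.
  by case: nz => v; rewrite h c0 scale0r.
by exists c^-1; [rewrite invr_eq0 | move=> v; rewrite h scalerA mulVf ?scale1r].
Qed.

Theorem proposition4p3 (R : realType) (p i : nat) (hp : (2 <= p)%N)
  (hi : (1 <= i <= p - 1)%N)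
  (K : fieldType) (iota : {rmorphism K -> complex R})
  (q : K) (hq : iota q = exp_ipi R p)
  (inc : {linear proj_mod K p i -> tpow K (2 * p - i - 1)})
  (prj : {linear tpow K (2 * p - i - 1) -> proj_mod K p i})
  (hplus : plus_summand q inc prj)
  (incl incu : {linear proj_mod K p (p - i) -> tpow K (2 * p + i - 1)})
  (prjl prju : {linear tpow K (2 * p + i - 1) -> proj_mod K p (p - i)})
  (hminus : minus_summands q incl incu prjl prju) :
  let theta1l := incl \o theta1 K p i \o prj in
  let theta2l := incl \o theta2 K p i \o prj in
  let theta1u := incu \o theta1 K p i \o prj in
  let theta2u := incu \o theta2 K p i \o prj in
  let Gamma1l := inc \o Gamma1 K p i \o prjl in
  let Gamma2l := inc \o Gamma2 K p i \o prjl in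
  let Gamma1u := inc \o Gamma1 K p i \o prju in
  let Gamma2u := inc \o Gamma2 K p i \o prju in
  let a := alpha p q in
  let b := beta p q in
  [/\ eq_up_to_const theta1l (cap_then q i b),
      eq_up_to_const theta2l (cap_then q i (b \o a)),
      eq_up_to_const theta1u (cap_then q i (a \o b)) &
      eq_up_to_const theta2u (cap_then q i a)] /\
  [/\ eq_up_to_const Gamma1l (then_cup q i (b \o a)),
      eq_up_to_const Gamma2l (then_cup q i a),
      eq_up_to_const Gamma1u (then_cup q i b) &
      eq_up_to_const Gamma2u (then_cup q i (a \o b))].
Proof.
move=> th1l th2l th1u th2u G1l G2l G1u G2u a b.
have q0 := root_neq0 hp hq; have qp := root_p hp hq; have qq := root_qq hp hq.
have xj := root_x hp hq; have ch := root_char iota.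
have hi' : (0 < i < p)%N by move: hp hi; clear; lia.
have i0 : (0 < i)%N by move: hi; clear; lia.
have pi0 : (0 < p - i)%N by move: hi'; clear; lia.
have ca0 := ca_neq0 hp q0 qq xj; have cb0 := cb_neq0 hp q0 qq xj.
have ga := good_scale (ca q p) (good_ta hp q0 qp qq).
have gb := good_scale (cb q p) (good_tb hp q0 qp qq).
have gba := good_scale (cb q p * ca q p) (good_tba hp q0 qp qq xj).
have gab := good_scale (ca q p * cb q p) (good_tab hp q0 qp qq xj).
have ma := alpha_tm hp q0 qp qq; have mb := beta_tm hp q0 qp qq.
have mba := beta_alpha_tm hp q0 qp qq; have mab := alpha_beta_tm hp q0 qp qq.
have [_ _ _ _ wx _ wb wy] := hplus.
have [[_ _ _ _ _ lb _] [_ _ _ _ _ ub _] _ _ _] := hminus.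
have cba0 := mulf_neq0 cb0 ca0; have cab0 := mulf_neq0 ca0 cb0.
have pM : (p <= 2 * p - 1)%N by move: hp; clear; lia.
(* One nonzero entry of each of the four operators, at the lowest weight of its support. *)
have ta0 : ca q p * ta q p p 0 != 0.
  apply: mulf_neq0 => //; rewrite /ta add0n eqxx andbT (ltnW hp) /=.
  by rewrite mul0n expr0 oner_neq0.
have tb0 : cb q p * tb q p 0 p != 0.
  apply: mulf_neq0 => //; rewrite /tb /ta add0n eqxx andbT (ltnW hp) /=.
  by rewrite mul0n expr0 oner_neq0.
have tba0 : cb q p * ca q p * tba q p 0 0 != 0.
  apply: mulf_neq0 => //; rewrite /tba eqxx andbT (ltnW hp) /=.
  by rewrite add0n muln0 expr0 mul1r; apply: (gM_neq0 hp q0 qp xj) pM.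
have tab0 : ca q p * cb q p * tab q p p p != 0.
  apply: mulf_neq0 => //; rewrite /tab eqxx leqnn /= subnn gbin0 mulr1.
  by rewrite mul0n muln0 expr0 oner_neq0.
have wb0 : in_weight (p - i) (inc (pb K p i 0)) by have := wb _ i0; rewrite addn0.
have wx0 : in_weight 0 (inc (px K p i 0)) by exact: wx.
have wy0 : in_weight p (inc (py K p i 0)) by have := wy _ pi0; rewrite addn0.
have wl0 : in_weight i (incl (pb K p (p - i) 0)) by have := lb _ pi0; rewrite addn0.
have wu0 : in_weight (p + i) (incu (pb K p (p - i) 0)) by have := ub _ pi0; rewrite addn0.
have za m k : ~ ((k < p)%N /\ m = (k + p)%N) -> ca q p * ta q p m k = 0.
  exact/scaled_supp/ta_supp.
have zb m k : ~ ((m < p)%N /\ k = (m + p)%N) -> cb q p * tb q p m k = 0.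
  exact/scaled_supp/tb_supp.
have zba m k : ~ ((k < p)%N /\ m = k) -> cb q p * ca q p * tba q p m k = 0.
  exact/scaled_supp/tba_supp.
have zab m k : ~ ((p <= k)%N /\ m = k) -> ca q p * cb q p * tab q p m k = 0.
  exact/scaled_supp/tab_supp.
split; split.
(* The cap adds [i] to the weight [p - i] of [b_0], and beta lowers the sum [p] to 0, the weight of
   [x_0] in the lower copy. *)
- have [c1 [c2 [c3 [c4 [hT [h1 h2 h3 _ _]]]]]] := T_decomp hp q0 qp qq ch xj hi' hplus hminus gb mb.
  have [n0 _] := op_neq0 hp q0 qq hi' mb (leq0n _) pM tb0.
  have [e2 e3] : c2 = 0 /\ c3 = 0.
    by apply: h2; apply: (off_cap hp q0 qq hi' mb wb0) => m l hl e; apply: zb; move: hi' hl e; clear; lia.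
  have e4 : c4 = 0.
    by apply: h3; apply: (off_cap hp q0 qq hi' mb wb0) => m l hl e; apply: zb; move: hi' hl e; clear; lia.
  apply: (eq_up_to_const_inv (c := c1)) n0 => v.
  by rewrite hT e2 e3 e4 !scale0r !addr0 linear0 addr0 linearZ.
(* The weight stays [p], which both copies contain. But beta alpha vanishes on weights at least [p]
   of its [2p - 1] letters, so it kills [y_0], and this excludes theta1. *)
- have [c1 [c2 [c3 [c4 [hT [h1 h2 h3 h4 h5]]]]]] := T_decomp hp q0 qp qq ch xj hi' hplus hminus gba mba.
  have [n0 _] := op_neq0 hp q0 qq hi' mba (leq0n _) (leq0n _) tba0.
  have e4 : c4 = 0.
    by apply: h3; apply: (off_cap hp q0 qq hi' mba wb0) => m l hl e; apply: zba; move: hi' hl e; clear; lia.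
  have [e1 e3] : c1 = 0 /\ c3 = 0.
    by apply: h5 => k; apply: (off_cap hp q0 qq hi' mba wy0) => m l hl e; apply: zba; move: hi' hl e; clear; lia.
  apply: (eq_up_to_const_inv (c := c2)) n0 => v.
  by rewrite hT e1 e3 e4 !scale0r !add0r linear0 addr0 linearZ.
(* Symmetrically, alpha beta vanishes on weights below [p], so it kills [x_0], and this excludes
   theta2. *)
- have [c1 [c2 [c3 [c4 [hT [h1 h2 h3 h4 h5]]]]]] := T_decomp hp q0 qp qq ch xj hi' hplus hminus gab mab.
  have [n0 _] := op_neq0 hp q0 qq hi' mab pM pM tab0.
  have e1 : c1 = 0.
    by apply: h1; apply: (off_cap hp q0 qq hi' mab wb0) => m l hl e; apply: zab; move: hi' hl e; clear; lia.
  have [e2 e4] : c2 = 0 /\ c4 = 0.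
    by apply: h4 => k; apply: (off_cap hp q0 qq hi' mab wx0) => m l hl e; apply: zab; move: hi' hl e; clear; lia.
  apply: (eq_up_to_const_inv (c := c3)) n0 => v.
  by rewrite hT e1 e2 e4 !scale0r !addr0 linear0 add0r linearZ.
- have [c1 [c2 [c3 [c4 [hT [h1 h2 h3 _ _]]]]]] := T_decomp hp q0 qp qq ch xj hi' hplus hminus ga ma.
  have [n0 _] := op_neq0 hp q0 qq hi' ma pM (leq0n _) ta0.
  have [e2 e3] : c2 = 0 /\ c3 = 0.
    by apply: h2; apply: (off_cap hp q0 qq hi' ma wb0) => m l hl e; apply: za; move: hi' hl e; clear; lia.
  have e1 : c1 = 0.
    by apply: h1; apply: (off_cap hp q0 qq hi' ma wb0) => m l hl e; apply: za; move: hi' hl e; clear; lia.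
  apply: (eq_up_to_const_inv (c := c4)) n0 => v.
  by rewrite hT e1 e2 e3 !scale0r !add0r linear0 add0r linearZ.
(* The cups remove [i] from the weights [i] and [p + i] of the two vectors [b_0]. On the upper copy
   the total weight would allow [y_0]; it is excluded because the image of beta alpha has weight
   below [p] in its [2p - 1] letters. *)
- have [c1 [c2 [c3 [c4 [hS [h1 h2 h3 h4]]]]]] := S_decomp hp q0 qp qq ch xj hi' hplus hminus gba mba.
  have [_ n0] := op_neq0 hp q0 qq hi' mba (leq0n _) (leq0n _) tba0.
  have e2 : c2 = 0.
    by apply: h2; apply: (off_cup hp q0 qq hi' mba wl0) => m l hl e; apply: zba; move: hi' hl e; clear; lia.
  have e3 : c3 = 0.
    by apply: h3; apply: (off_cup hp q0 qq hi' mba wu0) => m l hl e; apply: zba; move: hi' hl e; clear; lia.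
  have e4 : c4 = 0.
    by apply: h4; apply: (off_cup hp q0 qq hi' mba wu0) => m l hl e; apply: zba; move: hi' hl e; clear; lia.
  apply: (eq_up_to_const_inv (c := c1)) n0 => v.
  by rewrite hS e2 e3 e4 !scale0r !addr0 linear0 addr0 linearZ.
- have [c1 [c2 [c3 [c4 [hS [h1 h2 h3 h4]]]]]] := S_decomp hp q0 qp qq ch xj hi' hplus hminus ga ma.
  have [_ n0] := op_neq0 hp q0 qq hi' ma pM (leq0n _) ta0.
  have e1 : c1 = 0.
    by apply: h1; apply: (off_cup hp q0 qq hi' ma wl0) => m l hl e; apply: za; move: hi' hl e; clear; lia.
  have e3 : c3 = 0.
    by apply: h3; apply: (off_cup hp q0 qq hi' ma wu0) => m l hl e; apply: za; move: hi' hl e; clear; lia.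
  have e4 : c4 = 0.
    by apply: h4; apply: (off_cup hp q0 qq hi' ma wu0) => m l hl e; apply: za; move: hi' hl e; clear; lia.
  apply: (eq_up_to_const_inv (c := c2)) n0 => v.
  by rewrite hS e1 e3 e4 !scale0r !add0r linear0 addr0 linearZ.
- have [c1 [c2 [c3 [c4 [hS [h1 h2 h3 h4]]]]]] := S_decomp hp q0 qp qq ch xj hi' hplus hminus gb mb.
  have [_ n0] := op_neq0 hp q0 qq hi' mb (leq0n _) pM tb0.
  have e1 : c1 = 0.
    by apply: h1; apply: (off_cup hp q0 qq hi' mb wl0) => m l hl e; apply: zb; move: hi' hl e; clear; lia.
  have e2 : c2 = 0.
    by apply: h2; apply: (off_cup hp q0 qq hi' mb wl0) => m l hl e; apply: zb; move: hi' hl e; clear; lia.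
  have e4 : c4 = 0.
    by apply: h4; apply: (off_cup hp q0 qq hi' mb wu0) => m l hl e; apply: zb; move: hi' hl e; clear; lia.
  apply: (eq_up_to_const_inv (c := c3)) n0 => v.
  by rewrite hS e1 e2 e4 !scale0r !addr0 linear0 add0r linearZ.
(* On the lower copy the total weight would allow [x_0]; it is excluded because the image of alpha
   beta has weight at least [p] in its [2p - 1] letters. *)
have [c1 [c2 [c3 [c4 [hS [h1 h2 h3 h4]]]]]] := S_decomp hp q0 qp qq ch xj hi' hplus hminus gab mab.
have [_ n0] := op_neq0 hp q0 qq hi' mab pM pM tab0.
have e1 : c1 = 0.
  by apply: h1; apply: (off_cup hp q0 qq hi' mab wl0) => m l hl e; apply: zab; move: hi' hl e; clear; lia.
have e2 : c2 = 0.
  by apply: h2; apply: (off_cup hp q0 qq hi' mab wl0) => m l hl e; apply: zab; move: hi' hl e; clear; lia.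
have e3 : c3 = 0.
  by apply: h3; apply: (off_cup hp q0 qq hi' mab wu0) => m l hl e; apply: zab; move: hi' hl e; clear; lia.
apply: (eq_up_to_const_inv (c := c4)) n0 => v.
by rewrite hS e1 e2 e3 !scale0r !add0r linear0 add0r linearZ.
Qed.
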